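(* Consider the problem $\min_{x\in\mathbb{R}^d} f(x)=\frac1n\sum_{i=1}^n f_i(x)$ and the algorithm PPDC described in the context. Assume: (i) each $f_i:\mathbb{R}^d\to\mathbb{R}$ is differentiable and $L_f$-smooth for some $L_f>0$, i.e. $\|\nabla f_i(x)-\nabla f_i(y)\|\le L_f\|x-y\|$ for all $x,y\in\mathbb{R}^d$; (ii) the minimum value $f^*$ of $f$ satisfies $f^*>-\infty$; (iii) the undirected graph $\mathcal G$ is connected and its weight matrix $W$ is doubly stochastic; (iv) for some $\varphi\in(0,1]$ and $r>0$ the stochastic compressor $C:\mathbb{R}^d\to\mathbb{R}^d$ satisfies $\mathbb{E}_C\big[\|C(x)/r-x\|^2\big]\le(1-\varphi)\|x\|^2$ for all $x\in\mathbb{R}^d$. Suppose $\gamma=\tilde\zeta_1\omega$, $\omega>\tilde\zeta_2$, $\alpha_x\in(0,\frac1r)$ and $0<\eta<\tilde\zeta_3$, with $\tilde\zeta_1,\tilde\zeta_2,\tilde\zeta_3$ as specified in the context. Then for every integer $T\ge1$, $$\frac1T\sum_{k=0}^T\Big(\mathbb{E}\|\mathbf x_k-\bar{\mathbf x}_k\|^2+\mathbb{E}\|\nabla f(\bar x_k)\|^2\Big)\le\frac{\bar\kappa_3M_2}{T}+\check\kappa_1\,\mathbb{E}\Big\|\sum_{t=0}^\infty\bar{\boldsymbol\xi}_{v,t}\Big\|^2,$$ where $\bar\kappa_3=\max\{\frac4\eta,\frac1{(\kappa_1-\kappa_2\eta)\eta}\}$, $\check\kappa_1=\frac{\bar\kappa_3\kappa_{12}}{n}$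 and $M_2=\frac1n\mathbb{E}[\widetilde V_0]+(\kappa_{10}+\kappa_{11})\sum_{k=0}^\infty2d\,\bar q^{2k}\bar s_\xi^2$.
   Context: Network. $\mathcal G=(\mathcal V,\mathcal E)$, $\mathcal V=\{1,\dots,n\}$, is an undirected graph; $W=[w_{ij}]\in\mathbb{R}^{n\times n}$ is its symmetric weighted adjacency matrix ($w_{ij}>0$ if $(i,j)\in\mathcal E$, $w_{ij}=0$ otherwise, $w_{ii}=0$). $L=[L_{ij}]=D-W$ is the Laplacian, $D=\mathrm{diag}(d_1,\dots,d_n)$, $d_i=\sum_jw_{ij}$. $\bar\lambda_A$ is the spectral radius and $\underline\lambda_A$ the minimum positive eigenvalue of $A$. Noise. $\mathrm{Lap}(\theta)$ has density $\frac1{2\theta}e^{-|x|/\theta}$; $\mathrm{Lap}_d(\theta)$ means all $d$ components are $\mathrm{Lap}(\theta)$. $\xi_{x_i,k}\sim\mathrm{Lap}_d(s_{\xi_{x_i}}q_i^k)$, $\xi_{v_i,k}\sim\mathrm{Lap}_d(s_{\xi_{v_i}}q_i^k)$, with $s_{\xi_{x_i}},s_{\xi_{v_i}}>0$, $0<q_i<1$. All noise components are mutually independent, and the compressor's internal randomness is drawn afresh at each use, independently of everything else. $\bar q=\max_iq_i$, $\bar s_\xi=\max_i\{s_{\xi_{x_i}},s_{\xi_{v_i}}\}$. $\mathbb{E}_C$ is expectation over the internal randomness of $C$. Algorithm PPDC, with positive parameters $\eta,\gamma,\omega,\alpha_x$: $x_{i,0}\in\mathbb{R}^d$ arbitrary,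 $x^c_{i,0}=v_{i,0}=\mathbf 0$. For $k\ge0$, all $i\in\mathcal V$: $\hat x_{i,k}=x^c_{i,k}+C(x_{i,k}+\xi_{x_i,k}-x^c_{i,k})$; $x_{i,k+1}=x_{i,k}+\xi_{x_i,k}-\eta\big(\gamma\sum_{j=1}^nL_{ij}\hat x_{j,k}+\omega v_{i,k}+\nabla f_i(x_{i,k})\big)$; $v_{i,k+1}=v_{i,k}+\xi_{v_i,k}+\eta\omega\sum_{j=1}^nL_{ij}\hat x_{j,k}$; $x^c_{i,k+1}=(1-\alpha_x)x^c_{i,k}+\alpha_x\hat x_{i,k}$. Stacked notation. $\mathbf x_k,\mathbf v_k,\mathbf x^c_k,\xi_{x,k},\xi_{v,k}\in\mathbb{R}^{nd}$ stack the agents' vectors. $\bar x_k=\frac1n\sum_ix_{i,k}$, $\bar{\mathbf x}_k=\mathbf 1_n\otimes\bar x_k$, $\bar{\boldsymbol\xi}_{v,t}=\mathbf 1_n\otimes\frac1n\sum_i\xi_{v_i,t}$. $\mathbf g^b_k\in\mathbb{R}^{nd}$ stacks $\nabla f_i(\bar x_k)$, $i=1,\dots,n$. $\|x\|_A^2=x^\top Ax$. $\mathbf K=(I_n-\frac1n\mathbf 1_n\mathbf 1_n^\top)\otimes I_d$, $\mathbf L=L\otimes I_d$, $\mathbf P=P\otimes I_d$, where $P=[r_1\ R]\,\mathrm{diag}(\lambda_n^{-1},\Lambda_1^{-1})\,[r_1\ R]^\top$, $r_1=\frac1{\sqrt n}\mathbf 1_n$, $\Lambda_1=\mathrm{diag}(\lambda_2,\dots,\lambda_n)$,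 $\lambda_2\le\dots\le\lambda_n$ the nonzero eigenvalues of $L$, and the columns of $R$ corresponding orthonormal eigenvectors. In $\bar\lambda_{I+\eta\gamma\mathbf L}$ and $\bar\lambda_{\eta\gamma\mathbf L-I}$, $I=I_{nd}$. Finally $\widetilde V_k=\frac12\|\mathbf x_k\|^2_{\mathbf K}+\frac12\|\mathbf v_k+\frac1\omega\mathbf g^b_k\|^2_{\mathbf P+\frac\gamma\omega\mathbf P}+\mathbf x_k^\top\mathbf K\mathbf P(\mathbf v_k+\frac1\omega\mathbf g^b_k)+\|\mathbf x_k+\xi_{x,k}-\mathbf x^c_k\|^2+n(f(\bar x_k)-f^* )$. Constants. $r_0=2r^2(1-\varphi)+2(1-r)^2$; write $\underline\lambda=\underline\lambda_L$, $\bar\lambda=\bar\lambda_L$, $\varphi_2=\alpha_xr\varphi$. $\kappa_1=\frac{\gamma\underline\lambda}{2}-\frac14(7+9L_f^2+13\omega)$; $\kappa_2=\frac{5L_f^2}{2}+\frac{6(2+\varphi_2)}{\varphi_2}(\gamma^2\bar\lambda^2+L_f^2)+6\gamma^2\bar\lambda^2+\frac{9\omega^2+3\gamma^2}{2}\bar\lambda+3\omega^2+\frac32$; $\kappa_3=\frac\omega4-\frac3{\underline\lambda}-(\frac12+\frac1{2\omega})(1+\frac\gamma\omega)$; $\kappa_4=\frac1{\underline\lambda}+\frac{\omega^2\bar\lambda}{2}+2\omega^2\bar\lambda+6(1+\frac2{\varphi_2})\omega^2\underline\lambda$; $\kappa_5=\frac14-\big(\frac{L_f^2}{\omega\underline\lambda}+\frac{\gamma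 L_f^2}{\omega^2\underline\lambda}+\frac{L_f^2}{\omega^2\underline\lambda^2}\big)$; $\kappa_6=\frac{2L_f^2}{\omega^2\underline\lambda}+\frac{2L_f^2}{\omega^3\underline\lambda}+\frac{L_f^2}{\omega^2\underline\lambda^2}+\frac{3L_f^2}{2}+L_f$; $\kappa_7=\frac{\varphi_2}{2}(1+\varphi_2)$; $\ \kappa_8=\frac12(\gamma+4\omega)\bar\lambda+3\omega r_0$; $\kappa_9=6\gamma^2\bar\lambda^2r_0(1+\frac2{\varphi_2})+r_0\big(6\gamma^2\bar\lambda^2+\frac{9\omega^2+3\gamma^2}{2}\bar\lambda+3\omega^2+\frac32\big)$; $A_0=\frac{L_f^2}{\omega^2\underline\lambda}+\frac{\gamma L_f^2}{\omega^3\underline\lambda}+\frac{L_f^2}{2\eta\omega\underline\lambda}+\frac{\gamma L_f^2}{2\eta\omega^2\underline\lambda}+\frac{(1+2\eta)L_f^2}{2\eta\omega^2\underline\lambda^2}+\frac{3L_f^2}{4}+\frac1{2\eta}+\frac{L_f}{2}$; $\kappa_{10}=4A_0+\frac{\bar\lambda_{I+\eta\gamma\mathbf L}^2}{\eta}+10+(\frac12+3\omega+2\omega\bar\lambda)\eta+(\frac1{\eta\omega}+\frac12)\frac1{\underline\lambda}+\frac{12}{\varphi_2}+6\bar\lambda_{\eta\gamma\mathbf L-I}^2(1+\frac2{\varphi_2})+\eta^2\big(6\gamma^2\bar\lambda^2+\frac{9\omega^2+3\gamma^2}{2}\bar\lambda+3\omega^2+\frac32\big)$; $\kappa_{11}=\underline\lambda^{-1}\big(\frac1{2\eta}+\frac\gamma{2\eta\omega}+\frac52+\frac{3\gamma}{2\omega}+\eta\omega+\frac{\underline\lambda^{-1}}{\eta}\big)$;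 $\kappa_{12}=4\eta^2\omega^2A_0+\frac\eta4$. The parameters $\tilde\zeta_1,\dots,\tilde\zeta_5$ satisfy $\tilde\zeta_1\ge\max\{\frac{13+\tilde\zeta_4}{2\underline\lambda},1\}$; $\ \tilde\zeta_2=\max\{\tilde\zeta_4,\tilde\zeta_5\}$; $\ \tilde\zeta_3=\min\big\{\frac{\kappa_1}{\kappa_2},\frac{\kappa_3}{\kappa_4},\frac{\kappa_5}{\kappa_6},\frac{\sqrt{\kappa_8^2+4\kappa_7\kappa_9}-\kappa_8}{2\kappa_9}\big\}$; $\tilde\zeta_4=\frac6{\underline\lambda}+1+\tilde\zeta_1+2\sqrt{\big(\frac3{\underline\lambda}+\frac12(1+\tilde\zeta_1)\big)^2+\frac1{2\omega}(1+\tilde\zeta_1)}$; $\tilde\zeta_5=2\frac{L_f^2+\tilde\zeta_1L_f^2}{\underline\lambda}+2\sqrt{\big(\frac{L_f^2+\tilde\zeta_1L_f^2}{\underline\lambda}\big)^2+\frac{L_f^2}{\omega^2\underline\lambda^2}}$. If $\kappa_9=0$ (which occurs only when $r_0=0$), the last term in $\tilde\zeta_3$ is read as $\kappa_7/\kappa_8$. *)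

(* Defs.v *)
From HB Require Import structures.
From mathcomp Require Import all_boot all_order all_algebra.
From mathcomp Require Import all_classical all_reals all_analysis.
From mathcomp Require Import complex mxtens.

Set Implicit Arguments.
Unset Strict Implicit.
Unset Printing Implicit Defensive.

Import Order.TTheory GRing.Theory Num.Theory.
Import numFieldNormedType.Exports.

Local Open Scope classical_set_scope.
Local Open Scope ring_scope.

Section linear_algebra.
Context {R : realType}.

(* The library norm on matrices is the sup norm. *)
Definition l2norm m (x : 'cV[R]_m) : R := Num.sqrt (\sum_i x i 0 ^+ 2).

(* x^T A y; the squared A-seminorm of x is [bform A x x]. *)
Definition bform m (A : 'M[R]_m) (x y : 'cV[R]_m) : R := (x^T *m A *m y) 0 0.

Definition spectral_radius m (A : 'M[R]_m) : R :=
  sup [set ComplexField.Normc.normc a | a in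
        [set a : complex R |
           eigenvalue (map_mx (real_complex R) A) a]].

(* The set is finite, so that the infimum is a minimum when it is nonempty. *)
Definition min_pos_eigenvalue m (A : 'M[R]_m) : R :=
  inf [set a : R | (0 < a) && eigenvalue A a].

Definition grad m (f : 'cV[R]_m -> R) (x : 'cV[R]_m) : 'cV[R]_m :=
  \col_j 'D_(delta_mx j 0) f x.

End linear_algebra.

Section network.
Context {R : realType} {n : nat}.

Definition weighted_adjacency (e : rel 'I_n) (W : 'M[R]_n) : Prop :=
  [/\ W^T = W,
      forall i j, e i j -> 0 < W i j,
      forall i j, ~~ e i j -> W i j = 0
    & forall i, W i i = 0].

Definition graph_connected (e : rel 'I_n) : Prop := forall i j, connect e i j.

Definition doubly_stochastic (W : 'M[R]_n) : Prop :=
  [/\ forall i j, 0 <= W i j,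
      forall i, \sum_j W i j = 1
    & forall j, \sum_i W i j = 1].

Definition laplacian (W : 'M[R]_n) : 'M[R]_n :=
  diag_mx (\row_i \sum_j W i j) - W.

(* [lam 2 <= ... <= lam n] are the n - 1 nonzero eigenvalues of L (the values of
   [lam] at the other naturals are irrelevant), and the columns of [Rm] are
   corresponding orthonormal eigenvectors. *)
Definition nonzero_eigenbasis (L : 'M[R]_n) (lam : nat -> R)
    (Rm : 'M[R]_(n, n.-1)) : Prop :=
  [/\ forall i j, (2 <= i)%N -> (i <= j)%N -> (j <= n)%N -> lam i <= lam j,
      forall i, (2 <= i <= n)%N -> lam i != 0,
      forall j : 'I_n.-1, L *m col j Rm = lam (j + 2)%N *: col j Rm
    & Rm^T *m Rm = 1%:M].

(* P = [r_1 R] diag(lam_n^-1, Lambda_1^-1) [r_1 R]^T, r_1 = 1_n / sqrt n. *)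
Definition P_mx (lam : nat -> R) (Rm : 'M[R]_(n, n.-1)) : 'M[R]_n :=
  let r1 : 'cV[R]_n := (Num.sqrt n%:R)^-1 *: const_mx 1 in
  let Q : 'M[R]_(n, 1 + n.-1) := row_mx r1 Rm in
  let D : 'rV[R]_(1 + n.-1) :=
    row_mx (const_mx (lam n)^-1) (\row_(j < n.-1) (lam (j + 2)%N)^-1) in
  Q *m diag_mx D *m Q^T.

End network.

Section stacking.
Context {R : realType} {n d : nat}.

(* The agents' vectors are stacked in the order of the Kronecker product [*t]:
   coordinate j of agent i has index i * d + j. *)
Definition stack (x : 'I_n -> 'cV[R]_d) : 'cV[R]_(n * d) :=
  \col_p x (mxtens_unindex p).1 (mxtens_unindex p).2 0.

Definition mean (x : 'I_n -> 'cV[R]_d) : 'cV[R]_d :=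
  n%:R^-1 *: \sum_i x i.

Definition mean_stack (x : 'I_n -> 'cV[R]_d) : 'cV[R]_(n * d) :=
  (const_mx 1 : 'cV[R]_n) *t mean x.

Definition kron_id (A : 'M[R]_n) : 'M[R]_(n * d) := A *t (1%:M : 'M[R]_d).

Definition K_mx : 'M[R]_(n * d) :=
  kron_id (1%:M - n%:R^-1 *: ((const_mx 1 : 'cV[R]_n) *m (const_mx 1)^T)).

End stacking.

Section objective.
Context {R : realType} {n d : nat}.

Definition average (f : 'I_n -> 'cV[R]_d -> R) (x : 'cV[R]_d) : R :=
  n%:R^-1 * \sum_i f i x.

Definition smooth (L_f : R) (f : 'cV[R]_d -> R) : Prop :=
  (forall x, differentiable f x) /\
  (forall x y, l2norm (grad f x - grad f y) <= L_f * l2norm (x - y)).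

Definition min_value (f : 'cV[R]_d -> R) : \bar R :=
  ereal_inf [set (f x)%:E | x in [set: 'cV[R]_d]].

End objective.

Section randomness.
Context {R : realType} {n d : nat}.
Context {dO dS : measure_display}.
Context {Omega : measurableType dO} {S : measurableType dS}.

Definition laplace_pdf (theta x : R) : R :=
  (2 * theta)^-1 * expR (- (`|x| / theta)).

Definition laplace_law (P : probability Omega R) (X : {RV P >-> R})
    (theta : R) : Prop :=
  forall A : set R, measurable A ->
    P (X @^-1` A) =
      (\int[lebesgue_measure]_(x in A) (laplace_pdf theta x)%:E)%E.

Definition mutually_independent (P : probability Omega R) (I : eqType)
    (F : I -> set (set Omega)) : Prop :=
  forall (s : seq I) (A : I -> set Omega), uniq s ->
    (forall i, i \in s -> F i (A i)) ->
    P (\bigcap_(i in [set` s]) A i) = (\prod_(i <- s) P (A i))%E.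

(* One index for each scalar component of each xi_{x_i,k} and of each
   xi_{v_i,k}, and one for each use (i, k) of the compressor. *)
Definition source : eqType :=
  (('I_n * nat * 'I_d) + ('I_n * nat * 'I_d) + ('I_n * nat))%type.

Definition source_sigma_algebra (P : probability Omega R)
    (xi_x xi_v : 'I_n -> nat -> 'I_d -> {RV P >-> R})
    (U : 'I_n -> nat -> {RV P >-> S}) (a : source) : set (set Omega) :=
  match a with
  | inl (inl (i, k, j)) => preimage_set_system setT (xi_x i k j) measurable
  | inl (inr (i, k, j)) => preimage_set_system setT (xi_v i k j) measurable
  | inr (i, k) => preimage_set_system setT (U i k) measurable
  end.

Definition noise_vec (P : probability Omega R) (xi : 'I_d -> {RV P >-> R})
  (w : Omega) : 'cV[R]_d := \col_j xi j w.

(* A stochastic compressor is a map [C] with an extra argument: [C s x] is its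
   value at x when its internal randomness takes the value s. *)
Definition measurable_compressor (C : S -> 'cV[R]_d -> 'cV[R]_d) : Prop :=
  measurable_fun setT
    (fun p : S * g_sigma_algebraType (@open 'cV[R]_d) =>
       C p.1 p.2 : g_sigma_algebraType (@open 'cV[R]_d)).

Definition compressor_bound (mu : probability S R)
    (C : S -> 'cV[R]_d -> 'cV[R]_d) (phi r : R) : Prop :=
  forall x : 'cV[R]_d,
    (\int[mu]_s (l2norm (r^-1 *: C s x - x) ^+ 2)%:E
       <= ((1 - phi) * l2norm x ^+ 2)%:E)%E.

End randomness.

Record setting (R : realType) (n : nat) := Setting {
  p_W : 'M[R]_n;
  p_Lf : R;
  p_phi : R;
  p_r : R;
  p_eta : R;
  p_gamma : R;
  p_omega : R;
  p_alpha : R }.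

Section algorithm.
Context {R : realType} {n d : nat}.
Context {dO dS : measure_display}.
Context {Omega : measurableType dO} {S : measurableType dS}.
Variable p : setting R n.
Local Notation L := (laplacian (p_W p)).
Local Notation eta := (p_eta p).
Local Notation gamma := (p_gamma p).
Local Notation omega := (p_omega p).
Local Notation alpha := (p_alpha p).

Definition PPDC (f : 'I_n -> 'cV[R]_d -> R) (C : S -> 'cV[R]_d -> 'cV[R]_d)
    (P : probability Omega R)
    (xi_x xi_v : 'I_n -> nat -> 'I_d -> {RV P >-> R})
    (U : 'I_n -> nat -> {RV P >-> S}) (x0 : 'I_n -> 'cV[R]_d)
    (x v xc xhat : nat -> Omega -> 'I_n -> 'cV[R]_d) : Prop :=
  forall w : Omega,
  (forall i, [/\ x 0%N w i = x0 i, v 0%N w i = 0 & xc 0%N w i = 0]) /\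
  (forall k i,
    [/\ xhat k w i = xc k w i
          + C (U i k w) (x k w i + noise_vec (xi_x i k) w - xc k w i),
        x k.+1 w i = x k w i + noise_vec (xi_x i k) w
          - eta *: (gamma *: (\sum_j L i j *: xhat k w j)
                    + omega *: v k w i + grad (f i) (x k w i)),
        v k.+1 w i = v k w i + noise_vec (xi_v i k) w
          + (eta * omega) *: (\sum_j L i j *: xhat k w j)
      & xc k.+1 w i = (1 - alpha) *: xc k w i + alpha *: xhat k w i]).

Definition lyapunov (f : 'I_n -> 'cV[R]_d -> R) (lam : nat -> R)
    (Rm : 'M[R]_(n, n.-1)) (x v xc xi : 'I_n -> 'cV[R]_d) : R :=
  let PP : 'M[R]_(n * d) := kron_id (P_mx lam Rm) in
  let gb : 'cV[R]_(n * d) := stack (fun i => grad (f i) (mean x)) in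
  let u : 'cV[R]_(n * d) := stack v + omega^-1 *: gb in
  2^-1 * bform K_mx (stack x) (stack x)
  + 2^-1 * bform (PP + (gamma / omega) *: PP) u u
  + bform (K_mx *m PP) (stack x) u
  + l2norm (stack x + stack xi - stack xc) ^+ 2
  + n%:R * (average f (mean x) - fine (min_value (average f))).

End algorithm.

Section constants.
Context {R : realType} {n : nat}.
Variables (d : nat) (p : setting R n).
Local Notation L := (laplacian (p_W p)).
Local Notation Lf := (p_Lf p).
Local Notation phi := (p_phi p).
Local Notation r := (p_r p).
Local Notation eta := (p_eta p).
Local Notation gamma := (p_gamma p).
Local Notation omega := (p_omega p).
Local Notation alpha := (p_alpha p).

Definition lmin : R := min_pos_eigenvalue L.
Definition lmax : R := spectral_radius L.

Definition r0 : R := 2 * r ^+ 2 * (1 - phi) + 2 * (1 - r) ^+ 2.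
Definition phi2 : R := alpha * r * phi.

Definition kappa1 : R :=
  gamma * lmin / 2 - 1 / 4 * (7 + 9 * Lf ^+ 2 + 13 * omega).

Definition kappa2 : R :=
  5 * Lf ^+ 2 / 2
  + 6 * (2 + phi2) / phi2 * (gamma ^+ 2 * lmax ^+ 2 + Lf ^+ 2)
  + 6 * gamma ^+ 2 * lmax ^+ 2
  + (9 * omega ^+ 2 + 3 * gamma ^+ 2) / 2 * lmax
  + 3 * omega ^+ 2 + 3 / 2.

Definition kappa3 : R :=
  omega / 4 - 3 / lmin - (1 / 2 + 1 / (2 * omega)) * (1 + gamma / omega).

Definition kappa4 : R :=
  1 / lmin + omega ^+ 2 * lmax / 2 + 2 * omega ^+ 2 * lmax
  + 6 * (1 + 2 / phi2) * omega ^+ 2 * lmin.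

Definition kappa5 : R :=
  1 / 4 - (Lf ^+ 2 / (omega * lmin)
           + gamma * Lf ^+ 2 / (omega ^+ 2 * lmin)
           + Lf ^+ 2 / (omega ^+ 2 * lmin ^+ 2)).

Definition kappa6 : R :=
  2 * Lf ^+ 2 / (omega ^+ 2 * lmin)
  + 2 * Lf ^+ 2 / (omega ^+ 3 * lmin)
  + Lf ^+ 2 / (omega ^+ 2 * lmin ^+ 2)
  + 3 * Lf ^+ 2 / 2 + Lf.

Definition kappa7 : R := phi2 / 2 * (1 + phi2).

Definition kappa8 : R := 1 / 2 * (gamma + 4 * omega) * lmax + 3 * omega * r0.

Definition kappa9 : R :=
  6 * gamma ^+ 2 * lmax ^+ 2 * r0 * (1 + 2 / phi2)
  + r0 * (6 * gamma ^+ 2 * lmax ^+ 2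
          + (9 * omega ^+ 2 + 3 * gamma ^+ 2) / 2 * lmax
          + 3 * omega ^+ 2 + 3 / 2).

Definition A0 : R :=
  Lf ^+ 2 / (omega ^+ 2 * lmin)
  + gamma * Lf ^+ 2 / (omega ^+ 3 * lmin)
  + Lf ^+ 2 / (2 * eta * omega * lmin)
  + gamma * Lf ^+ 2 / (2 * eta * omega ^+ 2 * lmin)
  + (1 + 2 * eta) * Lf ^+ 2 / (2 * eta * omega ^+ 2 * lmin ^+ 2)
  + 3 * Lf ^+ 2 / 4 + 1 / (2 * eta) + Lf / 2.

Definition kappa10 : R :=
  let LL : 'M[R]_(n * d) := kron_id L in
  4 * A0
  + spectral_radius (1%:M + (eta * gamma) *: LL) ^+ 2 / eta
  + 10
  + (1 / 2 + 3 * omega + 2 * omega * lmax) * eta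
  + (1 / (eta * omega) + 1 / 2) * (1 / lmin)
  + 12 / phi2
  + 6 * spectral_radius ((eta * gamma) *: LL - 1%:M) ^+ 2 * (1 + 2 / phi2)
  + eta ^+ 2 * (6 * gamma ^+ 2 * lmax ^+ 2
                + (9 * omega ^+ 2 + 3 * gamma ^+ 2) / 2 * lmax
                + 3 * omega ^+ 2 + 3 / 2).

Definition kappa11 : R :=
  lmin^-1 * (1 / (2 * eta) + gamma / (2 * eta * omega) + 5 / 2
             + 3 * gamma / (2 * omega) + eta * omega + lmin^-1 / eta).

Definition kappa12 : R := 4 * eta ^+ 2 * omega ^+ 2 * A0 + eta / 4.

Definition kappa_bar3 : R :=
  Num.max (4 / eta) (1 / ((kappa1 - kappa2 * eta) * eta)).

Definition kappa_check1 : R := kappa_bar3 * kappa12 / n%:R.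

(* zeta4 and zeta5 are functions of zeta1 = gamma / omega, which is only
   constrained by an inequality. *)
Definition zeta4 (zeta1 : R) : R :=
  6 / lmin + 1 + zeta1
  + 2 * Num.sqrt ((3 / lmin + 1 / 2 * (1 + zeta1)) ^+ 2
                  + 1 / (2 * omega) * (1 + zeta1)).

Definition zeta5 (zeta1 : R) : R :=
  2 * ((Lf ^+ 2 + zeta1 * Lf ^+ 2) / lmin)
  + 2 * Num.sqrt (((Lf ^+ 2 + zeta1 * Lf ^+ 2) / lmin) ^+ 2
                  + Lf ^+ 2 / (omega ^+ 2 * lmin ^+ 2)).

Definition zeta2 (zeta1 : R) : R := Num.max (zeta4 zeta1) (zeta5 zeta1).

Definition zeta3 : R :=
  Num.min (kappa1 / kappa2)
    (Num.min (kappa3 / kappa4)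
       (Num.min (kappa5 / kappa6)
          (if kappa9 == 0 then kappa7 / kappa8
           else (Num.sqrt (kappa8 ^+ 2 + 4 * kappa7 * kappa9) - kappa8)
                  / (2 * kappa9)))).

(* All the maximized quantities are positive, so the default value 0 of the
   iterated maxima plays no role. *)
Definition q_bar (q : 'I_n -> R) : R := \big[Num.max/0]_i q i.

Definition s_bar (s_x s_v : 'I_n -> R) : R :=
  \big[Num.max/0]_i Num.max (s_x i) (s_v i).

Definition M2 (EV0 : \bar R) (q s_x s_v : 'I_n -> R) : \bar R :=
  ((n%:R^-1)%:E * EV0
   + (kappa10 + kappa11)%:E *
     \sum_(0 <= k <oo)
        (2 * d%:R * q_bar q ^+ (2 * k) * s_bar s_x s_v ^+ 2)%:E)%E.

End constants.

(* Main.v *)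
(* Along the eigenvectors of the Laplacian, and along the average, the algorithm
   decouples into scalar recursions, except for the gradients and the compressor.
   The compression error is not centred, but C(Y_k) = (x^c_{k+1} - x^c_k) / alpha is
   an increment, so that shifting x and v by suitable multiples of L x^c removes it
   from their dynamics. For the Lyapunov function of the paper evaluated at the
   shifted variables (its initial value is unchanged because x^c_0 = 0), Young's
   inequality gives a pathwise one-step descent up to terms in |Y_k|^2,
   |C(Y_k) / r - Y_k|^2, the squared noises and |mean v_k|^2. Taking expectations,
   the freshness of the compressor's randomness turns the first two into E|Y_k|^2.
   Finally mean v_k is the partial sum of the averaged xi_v noises; these are
   independent and symmetric, so that its second moment increases with k and is
   bounded by that of the infinite sum, which converges in L^2. *)
Require Import Defs.
From HB Require Import structures.
From mathcomp Require Import all_boot all_order all_algebra.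
From mathcomp Require Import all_classical all_reals all_analysis.
From mathcomp Require Import measurable_realfun complex mxtens.
From mathcomp Require Import ring lra.

Set Implicit Arguments.
Unset Strict Implicit.
Unset Printing Implicit Defensive.

Import Order.TTheory GRing.Theory Num.Theory.
Import numFieldNormedType.Exports.

Local Open Scope classical_set_scope.
Local Open Scope ring_scope.

(** * Scalar recursions *)

(** Absolute constants suffice in the estimates because the parameter conditions are more
    restrictive than they look. [W] has zero diagonal and unit row sums, so [L] has trace n and its
    n - 1 nonzero eigenvalues average to n / (n - 1) <= 2. The bound on zeta1 is implicit, since
    zeta4 itself grows at least like 2 zeta1, and it can hold only if the least positive eigenvalue
    exceeds 1. Together these force zeta1 >= 21/2 (n - 1) and omega >= 29, and the step size
    condition makes eta gamma lambda_max at most 1/36. Each mode is then a finite list of Young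
    inequalities closed by linear arithmetic. Two features of the Lyapunov function make this work:
    the weight 1 + gamma/omega cancels the leading cross terms between x^c and v on every consensus
    mode, and the dissipation thus obtained in x^c is transferred to x through the residual. On the
    average, L vanishes and nothing damps v; only there does a term in v survive. All expectations
    are integrals of nonnegative functions, so infinite values need no separate treatment. *)

Local Ltac num := clear; lra.

Section young.
Context {R : realFieldType}.
Implicit Types c d k x y : R.

Lemma young c d x y : 0 < c -> 1 <= 4 * c * d ->
  x * y <= c * x ^+ 2 + d * y ^+ 2.
Proof.
move=> c0 cd; rewrite -subr_ge0 -(pmulr_rge0 _ (_ : 0 < 4 * c)); last by lra.
have -> : 4 * c * (c * x ^+ 2 + d * y ^+ 2 - x * y) =
  (2 * c * x - y) ^+ 2 + (4 * c * d - 1) * y ^+ 2 by ring.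
by rewrite addr_ge0 ?sqr_ge0// mulr_ge0 ?sqr_ge0//; lra.
Qed.

Lemma young_weighted k c d x y : 0 <= k -> 0 < c -> 1 <= 4 * c * d ->
  k * (x * y) <= c * (k * x ^+ 2) + d * (k * y ^+ 2).
Proof.
move=> k0 c0 cd; have /(ler_wpM2l k0) := young x y c0 cd.
by rewrite mulrDr !(mulrCA k).
Qed.

Lemma young_weightedN k c d x y : 0 <= k -> 0 < c -> 1 <= 4 * c * d ->
  - (k * (x * y)) <= c * (k * x ^+ 2) + d * (k * y ^+ 2).
Proof.
by move=> k0 c0 cd; rewrite -mulrN -mulNr -(sqrrN x); exact: young_weighted.
Qed.

(** The scaled form trades terms of order [eta], which the dissipation absorbs, for noise terms of
    order [eta^-1]. *)
Lemma young_inv k c d x y : 0 < k -> 0 < c -> 1 <= 4 * c * d ->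
  x * y <= c * (k * x ^+ 2) + d * (k^-1 * y ^+ 2).
Proof.
move=> k0 c0 cd; rewrite (mulrA c) (mulrA d); apply: young => //.
  by rewrite mulr_gt0.
by rewrite (_ : 4 * _ * _ = 4 * c * d)//; field; rewrite gt_eqF.
Qed.

End young.

(* Coordinates along an eigenvector of the Laplacian with eigenvalue [lam], with
   [zt = gamma / omega] and [a = eta omega]: [h] is the coordinate of x^c, [Y] that
   of x + xi - x^c, [z] that of the shifted x, and [p] is [lam^-1] times that of the
   shifted v; [s] and [de] come from the gradients. *)
Section mode_definitions.
Context {R : realFieldType}.
Variables eta a zt lam b : R.

(** As [a = eta omega], the last two bounds mean [omega >= 29] and [omega >= 2 (1 + zt)], and
    [zt a lam] is [eta gamma lam]. *)
Definition mode_params : Prop :=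
  [/\ 0 < eta, 21 / 2 <= zt & 1 <= lam] /\ 0 <= b /\
  [/\ zt * a * lam <= 1 / 36, zt * b * lam <= 5 / 24, 29 * eta <= a
     & 2 * (1 + zt) * eta <= a].

Definition mode_z h Y xi : R := h + zt * b * lam * h + Y - xi.
(** Undoes the shift: [p] is [lam^-1] times the coordinate of v + omega^-1 grad - b L x^c, so this
    is the coordinate of v + omega^-1 grad. *)
Definition mode_u h p : R := lam * (p + b * h).
(** Contribution of one mode to the Lyapunov function. [P] acts as [lam^-1] there, so [lam p^2] is
    [lam^-1] times the squared coordinate of the shifted v. *)
Definition mode_Q z p : R :=
  1 / 2 * z ^+ 2 + 1 / 2 * (1 + zt) * lam * p ^+ 2 + z * p.
Definition mode_dz h p xi s : R :=
  xi - eta * s - (zt * a * lam * h + a * mode_u h p).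
(** Like [p], the inputs [ze] and [de] are here already divided by [lam]. *)
Definition mode_dp h ze de : R := ze + a * h + de.

End mode_definitions.

(** * Descent along a single eigenvector of the Laplacian *)

Section consensus_mode.
Context {R : realFieldType}.
Implicit Types eta a zt lam b h p Y xi ze s de : R.

Lemma atom_le k1 k2 c (x : R) : k1 <= c * k2 -> k1 * x ^+ 2 <= c * (k2 * x ^+ 2).
Proof. by move=> k; rewrite mulrA ler_wpM2r ?sqr_ge0. Qed.

Lemma mode_facts eta a zt lam b : mode_params eta a zt lam b ->
  [/\ 0 < a, 0 < lam, 0 < zt, 0 < a * lam & 0 <= zt * a * lam] /\
  [/\ a * lam <= 1 / 378, a <= a * lam, eta <= 1 / 1000, b * lam <= 1 / 50
     & b <= 1 / 50] /\
  [/\ zt * a * lam + a * (b * lam) <= 101 / 100 * (zt * a * lam),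
     10 <= (1 + zt) * lam,
     a <= 2 / 21 * (zt * a * lam), a * lam <= 2 / 21 * (zt * a * lam)
     & 304 * eta <= zt * a * lam].
Proof.
move=> [[e0 z1_ge l1] [bge0 [step b1_le eta_le eta_z1]]].
have a0 : 0 < a by lra.
have l0 : 0 < lam by lra.
have z0 : 0 < zt by lra.
have al0 : 0 < a * lam by rewrite mulr_gt0.
have zal : 21 / 2 * (a * lam) <= zt * (a * lam) by rewrite ler_wpM2r// ltW.
have aal : a <= a * lam by rewrite ler_peMr// ltW.
have zbl : 21 / 2 * (b * lam) <= zt * (b * lam).
  by rewrite ler_wpM2r// mulr_ge0// ltW.
have bl : b * lam <= 1 / 50 by lra.
have bbl : b <= b * lam by rewrite ler_peMr.
have abl := ler_wpM2l (ltW a0) bl.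
have zl : 10 * 1 <= (1 + zt) * lam by apply: ler_pM => //; lra.
repeat split => //; lra.
Qed.

Lemma sqr_le_inv_sqr eta (x : R) : 0 < eta -> eta <= 1 / 1000 ->
  x ^+ 2 <= 1 / 1000 * (eta^-1 * x ^+ 2).
Proof.
move=> e0 e1; have en0 : eta != 0 by rewrite gt_eqF.
rewrite -{1}(mulKf en0 (x ^+ 2)) [leRHS]mulrCA ler_wpM2l ?invr_ge0 ?(ltW e0)//.
by rewrite ler_wpM2r ?sqr_ge0.
Qed.

Lemma mode_atoms eta a zt lam b (x : R) : mode_params eta a zt lam b ->
  [/\ a * x ^+ 2 <= 2 / 21 * (zt * a * lam * x ^+ 2),
     a * lam * x ^+ 2 <= 2 / 21 * (zt * a * lam * x ^+ 2),
     304 * (eta * x ^+ 2) <= zt * a * lam * x ^+ 2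
   & 0 <= zt * a * lam * x ^+ 2].
Proof.
move=> /mode_facts[[_ _ _ _ g0] [_ [_ _ h1 h2 h3]]].
split; [exact: atom_le|exact: atom_le| |exact: mulr_ge0 (sqr_ge0 _)].
by rewrite mulrA ler_wpM2r ?sqr_ge0.
Qed.

(** The quadratic part of the increment of [mode_Q] is of second order in the step, hence absorbed
    by small fractions of the dissipation [zt a lam h^2 + a lam p^2] and small multiples of the
    inputs. *)
Lemma mode_second_order eta a zt lam b h p xi ze s de :
  mode_params eta a zt lam b ->
  1 / 2 * mode_dz eta a zt lam b h p xi s ^+ 2 + 1 / 2 * (1 + zt) * lam * mode_dp a h ze de ^+ 2
    + mode_dz eta a zt lam b h p xi s * mode_dp a h ze de
  <= 15 / 100 * (zt * a * lam * h ^+ 2) + 2 / 100 * (a * lam * p ^+ 2)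
     + 1 / 100 * (eta^-1 * xi ^+ 2) + 1 / 100 * (eta * s ^+ 2)
     + 1 / 100 * ((1 + zt) * lam * (eta^-1 * ze ^+ 2))
     + 1 / 100 * ((1 + zt) * lam * (eta^-1 * de ^+ 2)).
Proof.
move=> params; have [h1 h2 _ D0] := mode_atoms h params.
have [[a0 l0 z0 al0 g0] [[alle aal e3 bl b1_small] [kg zl10 ag alg eg]]] := mode_facts params.
case: params => -[e0 z1_ge l1] [bge0 [step b1_le eta_le eta_z1]].
set dz := mode_dz _ _ _ _ _ _ _ _ _; set dp := mode_dp _ _ _ _.
have zl0 : 0 <= (1 + zt) * lam by rewrite mulr_ge0 ?ltW// addr_gt0.
have x1 := sqr_le_inv_sqr xi e0 e3.
have z2 := sqr_le_inv_sqr ze e0 e3.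
have d2 := sqr_le_inv_sqr de e0 e3.
have dz2 : dz ^+ 2 <= 4 * (xi ^+ 2 + (eta * s) ^+ 2
    + ((zt * a * lam + a * (b * lam)) * h) ^+ 2 + (a * lam * p) ^+ 2).
  rewrite /dz /mode_dz /mode_u.
  have -> : xi - eta * s - (zt * a * lam * h + a * (lam * (p + b * h))) =
     xi - eta * s - (zt * a * lam + a * (b * lam)) * h - a * lam * p by ring.
  move: (eta * s) (_ * h) => E H.
  move: (a * lam * p) => q.
  move: (sqr_ge0 (xi + E)) (sqr_ge0 (xi + H)) (sqr_ge0 (xi + q)).
  move: (sqr_ge0 (E - H)) (sqr_ge0 (E - q)) (sqr_ge0 (H - q)).
  by clear; lra.
have cH : ((zt * a * lam + a * (b * lam)) * h) ^+ 2 <= 3 / 100 * (zt * a * lam * h ^+ 2).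
  rewrite exprMn; apply: atom_le.
  move: kg g0 step; set g := zt * a * lam; set k := g + _ => kg g0 gle.
  have k0 : 0 <= k by rewrite addr_ge0// !mulr_ge0// ltW.
  have k2 : k ^+ 2 <= (101 / 100 * g) ^+ 2.
    by apply: lerXn2r; rewrite ?nnegrE// (le_trans k0).
  have gg : g * g <= 1 / 36 * g by rewrite ler_wpM2r.
  by move: k2 gg g0; clear; lra.
have cp : (a * lam * p) ^+ 2 <= 1 / 378 * (a * lam * p ^+ 2).
  by rewrite exprMn; apply: atom_le; rewrite expr2 ler_wpM2r// ltW.
have cs : (eta * s) ^+ 2 <= 1 / 1000 * (eta * s ^+ 2).
  by rewrite exprMn; apply: atom_le; rewrite expr2 ler_wpM2r// ltW.
have dp2 : dp ^+ 2 <= 3 * (ze ^+ 2 + (a * h) ^+ 2 + de ^+ 2).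
  rewrite /dp /mode_dp; move: (a * h) => q.
  move: (sqr_ge0 (ze - q)) (sqr_ge0 (ze - de)) (sqr_ge0 (q - de)).
  by clear; lra.
have dzdp : dz * dp <= 1 / 2 * dz ^+ 2 + 1 / 2 * dp ^+ 2.
  by apply: young; num.
have dp3 : dp ^+ 2 <= 1 / 10 * ((1 + zt) * lam * dp ^+ 2).
  by move: (ler_wpM2r (sqr_ge0 dp) zl10); clear; lra.
have ca : (1 + zt) * lam * (a * h) ^+ 2 <= 1 / 200 * (zt * a * lam * h ^+ 2).
  rewrite exprMn mulrA; apply: atom_le.
  have al : (1 + zt) * (a * lam) <= 11 / 10 * (zt * a * lam).
    by move: ag alg; clear -al0 z1_ge; lra.
  have := ler_wpM2r (ltW a0) al.
  have ua : a <= 1 / 378 by exact: le_trans aal alle.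
  by move: g0 (ler_wpM2l g0 ua); clear; lra.
have dp4 := ler_wpM2l zl0 dp2.
have z3 := ler_wpM2l zl0 z2.
have d3 := ler_wpM2l zl0 d2.
have P0 : 0 <= a * lam * p ^+ 2 := mulr_ge0 (ltW al0) (sqr_ge0 p).
have S0 : 0 <= eta * s ^+ 2 := mulr_ge0 (ltW e0) (sqr_ge0 s).
have iv (x : R) : 0 <= eta^-1 * x ^+ 2.
  by apply: mulr_ge0 (sqr_ge0 _); rewrite invr_ge0 ltW.
have X0 := iv xi.
have Z0 := mulr_ge0 zl0 (iv ze).
have De0 := mulr_ge0 zl0 (iv de).
clearbody dz dp.
move: h1 x1 z2 d2 dz2 cH cp cs dp2 dzdp dp3 ca dp4 z3 d3 D0 P0 S0 X0 Z0 De0.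
by clear; lra.
Qed.

(** The products [a lam h p] come with coefficient -1 from [z dz], 1 + zt from the [p] term and -zt
    from [dz p], so they cancel; only multiples carrying the small factor [b] remain. This is the
    role of the weight 1 + zt in [mode_Q]. The dissipation is [-zt a lam h^2] from [z dz] and
    [-a lam p^2] from [dz p]; the adverse term [a h^2] from [z dp] is dominated because [zt] is
    large. *)
Lemma mode_first_order eta a zt lam b h p Y xi ze s de :
  mode_params eta a zt lam b ->
  mode_z zt lam b h Y xi * mode_dz eta a zt lam b h p xi s + (1 + zt) * lam * (p * mode_dp a h ze
    de)
    + mode_dz eta a zt lam b h p xi s * p + mode_z zt lam b h Y xi * mode_dp a h ze de
  <= - (64 / 100) * (zt * a * lam * h ^+ 2) - 17 / 100 * (a * lam * p ^+ 2)
     + 4 * (zt * a * lam * Y ^+ 2)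
     + 1 * (eta^-1 * xi ^+ 2) + 2 * (eta * s ^+ 2)
     + 36 / 100 * ((1 + zt) * lam * (eta^-1 * ze ^+ 2))
     + 67 / 100 * ((1 + zt) * lam * (eta^-1 * de ^+ 2)).
Proof.
move=> params; have [h1 h2 h3 D0] := mode_atoms h params.
have [y1 y2 y3 Y0] := mode_atoms Y params.
have [[a0 l0 z0 al0 g0] [[alle aal e3 bl b1_small] [kg zl10 ag alg eg]]] := mode_facts params.
case: params => -[e0 z1_ge l1] [bge0 [step b1_le eta_le eta_z1]].
set z := mode_z _ _ _ _ _ _; set dz := mode_dz _ _ _ _ _ _ _ _ _; set dp := mode_dp _ _ _ _.
have zl0 : 0 <= (1 + zt) * lam by rewrite (le_trans _ zl10).
have b0 : 0 <= zt * b * lam by rewrite !mulr_ge0// ltW.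
have b1l0 : 0 <= b * lam by rewrite mulr_ge0// ltW.
have x1 := sqr_le_inv_sqr xi e0 e3.
move: (ltW a0) (ltW al0) (ltW e0) => a0' al0' e0'.
set X := eta^-1 * xi ^+ 2 in x1 *; set S := eta * s ^+ 2.
set D := zt * a * lam * h ^+ 2 in h1 h2 h3 D0 *; set Dp := a * lam * p ^+ 2.
set YY := zt * a * lam * Y ^+ 2 in y1 y2 y3 Y0 *.
set Z := (1 + zt) * lam * (eta^-1 * ze ^+ 2).
set De := (1 + zt) * lam * (eta^-1 * de ^+ 2).
have iv (x : R) : 0 <= eta^-1 * x ^+ 2.
  by apply: mulr_ge0 (sqr_ge0 _); rewrite invr_ge0 ltW.
have X0 : 0 <= X := iv xi.
have Z0 : 0 <= Z := mulr_ge0 zl0 (iv ze).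
have De0 : 0 <= De := mulr_ge0 zl0 (iv de).
have S0 : 0 <= S := mulr_ge0 e0' (sqr_ge0 s).
have P0 : 0 <= Dp := mulr_ge0 al0' (sqr_ge0 p).
have p3 : 29 * (eta * p ^+ 2) <= Dp.
  by rewrite /Dp mulrA ler_wpM2r ?sqr_ge0// (le_trans eta_le aal).
set G := zt * a * lam + a * (b * lam) in kg *.
have G0 : 0 <= G by rewrite addr_ge0// mulr_ge0.
have Gh : G * h ^+ 2 <= 101 / 100 * D by exact: atom_le.
have GY : G * Y ^+ 2 <= 101 / 100 * YY by exact: atom_le.
have Gx : G * xi ^+ 2 <= 101 / 100 * (1 / 36 * xi ^+ 2).
  by rewrite mulrA ler_wpM2r ?sqr_ge0//; move: kg step; clear; lra.
have t1 : D <= G * (1 + zt * b * lam) * h ^+ 2.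
  rewrite /D ler_wpM2r ?sqr_ge0// -[leLHS]mulr1 ler_pM ?lerDl//.
  by rewrite mulr_ge0.
have t2Y : - (G * (h * Y)) <= 1 / 10 * (G * h ^+ 2) + 5 / 2 * (G * Y ^+ 2).
  by apply: young_weightedN => //; num.
have t2x : G * (h * xi) <= 1 / 50 * (G * h ^+ 2) + 25 / 2 * (G * xi ^+ 2).
  by apply: young_weighted => //; num.
have t3h : - (a * lam * (p * (zt * b * lam * h))) <=
    1 / 20 * Dp + 5 * (a * lam * (zt * b * lam * h) ^+ 2).
  by apply: young_weightedN => //; num.
have t3h' : a * lam * (zt * b * lam * h) ^+ 2 <= 25 / 576 * (a * lam * h ^+ 2).
  have B2 : (zt * b * lam) ^+ 2 <= (5 / 24) ^+ 2.
    by apply: lerXn2r; rewrite ?nnegrE//; num.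
  rewrite exprMn mulrA; apply: atom_le.
  by move: (ler_wpM2l al0' B2); clear; lra.
have t3Y : - (a * lam * (p * Y)) <= 1 / 20 * Dp + 5 * (a * lam * Y ^+ 2).
  by apply: young_weightedN => //; num.
have t3x : a * lam * (p * xi) <= 1 / 50 * Dp + 25 / 2 * (a * lam * xi ^+ 2).
  by apply: young_weighted => //; num.
have t3x' : a * lam * xi ^+ 2 <= 1 / 378 * xi ^+ 2.
  by rewrite ler_wpM2r ?sqr_ge0.
have t5 : - (a * lam * (p * (b * h))) <= 1 / 20 * Dp + 5 * (a * lam * (b * h) ^+ 2).
  by apply: young_weightedN => //; num.
have t5' : a * lam * (b * h) ^+ 2 <= 1 / 2500 * (a * lam * h ^+ 2).
  have b2 : b ^+ 2 <= (1 / 50) ^+ 2 by apply: lerXn2r; rewrite ?nnegrE//; num.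
  by rewrite exprMn mulrA; apply: atom_le; move: (ler_wpM2l al0' b2); clear; lra.
have t6 : a * (1 + zt * b * lam) * h ^+ 2 <= 29 / 24 * (a * h ^+ 2).
  by apply: atom_le; move: (ler_wpM2l a0' b1_le); clear; lra.
have t7Y : a * (h * Y) <= 1 / 10 * (a * h ^+ 2) + 5 / 2 * (a * Y ^+ 2).
  by apply: young_weighted => //; num.
have t7x : - (a * (h * xi)) <= 1 / 10 * (a * h ^+ 2) + 5 / 2 * (a * xi ^+ 2).
  by apply: young_weightedN => //; num.
have t7x' : a * xi ^+ 2 <= 1 / 378 * xi ^+ 2.
  by rewrite ler_wpM2r ?sqr_ge0// (le_trans aal).
(* The coefficient of [h] in [z] is at most 1 + 5/24 = 29/24, whose square is below 3/2. *)
have z2 : eta * z ^+ 2 <= 3 * (3 / 2 * (eta * h ^+ 2) + eta * Y ^+ 2 + eta * xi ^+ 2).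
  have B2 : (1 + zt * b * lam) ^+ 2 <= (29 / 24) ^+ 2.
    apply: lerXn2r; rewrite ?nnegrE; [exact: addr_ge0|num|].
    by move: b1_le; clear; lra.
  move: (ler_wpM2r (mulr_ge0 e0' (sqr_ge0 h)) B2).
  rewrite (_ : z = (1 + zt * b * lam) * h + Y - xi); last first.
    by rewrite /z /mode_z; ring.
  have eh := mulr_ge0 e0' (sqr_ge0 h).
  set B := 1 + _.
  move: eh (mulr_ge0 e0' (sqr_ge0 (B * h - Y))) (mulr_ge0 e0' (sqr_ge0 (B * h + xi))).
  by move: (mulr_ge0 e0' (sqr_ge0 (Y + xi))); clearbody B; clear; lra.
have ex : eta * xi ^+ 2 <= xi ^+ 2.
  by rewrite ler_piMl ?sqr_ge0//; move: e3; clear; lra.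
have t8 : z * xi <= 2 * (eta * z ^+ 2) + 1 / 8 * X.
  by apply: young_inv => //; num.
have t9 : - (eta * (z * s)) <= 1 / 2 * (eta * z ^+ 2) + 1 / 2 * S.
  by apply: young_weightedN => //; num.
have t10 : p * ze <= 4 / 5 * (eta * p ^+ 2) + 5 / 16 * (eta^-1 * ze ^+ 2).
  by apply: young_inv => //; num.
have t11 : p * de <= 2 / 5 * (eta * p ^+ 2) + 5 / 8 * (eta^-1 * de ^+ 2).
  by apply: young_inv => //; num.
have t10' : (1 + zt) * lam * (eta * p ^+ 2) <= 1 / 2 * Dp.
  rewrite /Dp mulrA; apply: atom_le.
  by move: (ler_wpM2l (ltW l0) eta_z1); clear; lra.
have t10l : (1 + zt) * lam * (p * ze) <=
    4 / 5 * ((1 + zt) * lam * (eta * p ^+ 2)) + 5 / 16 * Z.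
  by rewrite /Z; move: (ler_wpM2l zl0 t10); clear; lra.
have t11l : (1 + zt) * lam * (p * de) <=
    2 / 5 * ((1 + zt) * lam * (eta * p ^+ 2)) + 5 / 8 * De.
  by rewrite /De; move: (ler_wpM2l zl0 t11); clear; lra.
have t12x : xi * p <= 1 / 4 * X + 1 * (eta * p ^+ 2).
  by rewrite mulrC addrC; apply: young_inv => //; num.
have t12s : - (eta * (s * p)) <= 1 / 2 * S + 1 / 2 * (eta * p ^+ 2).
  by apply: young_weightedN => //; num.
have zeZ : 10 * (eta^-1 * ze ^+ 2) <= Z by rewrite /Z ler_wpM2r.
have deDe : 10 * (eta^-1 * de ^+ 2) <= De by rewrite /De ler_wpM2r.
have t13z : z * ze <= 1 * (eta * z ^+ 2) + 1 / 4 * (eta^-1 * ze ^+ 2).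
  by apply: young_inv => //; num.
have t13d : z * de <= 1 * (eta * z ^+ 2) + 1 / 4 * (eta^-1 * de ^+ 2).
  by apply: young_inv => //; num.
have -> : z * dz + (1 + zt) * lam * (p * dp) + dz * p + z * dp =
  - (G * (1 + zt * b * lam) * h ^+ 2) - G * (h * Y) + G * (h * xi)
  - a * lam * (p * (zt * b * lam * h)) - a * lam * (p * Y) + a * lam * (p * xi)
  - Dp - a * lam * (p * (b * h)) + a * (1 + zt * b * lam) * h ^+ 2
  + a * (h * Y) - a * (h * xi) + z * xi - eta * (z * s)
  + (1 + zt) * lam * (p * ze) + (1 + zt) * lam * (p * de)
  + xi * p - eta * (s * p) + z * ze + z * de.
  by rewrite /z /dz /dp /mode_z /mode_dz /mode_dp /mode_u /G /Dp; ring.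
clearbody z dz dp G X S D Dp YY Z De.
move: h1 h2 h3 D0 y1 y2 y3 Y0 x1 X0 Z0 De0 S0 P0 p3 Gh GY Gx t1 t2Y t2x t3h t3h'
  t3Y t3x t3x' t5 t5' t6 t7Y t7x t7x' z2 ex t8 t9 t10' t10l t11l t12x t12s zeZ
  deDe t13z t13d.
by clear; lra.
Qed.

(** The condition amounts to 1/c + 1/d = 1, which characterizes the sharp pairs of weights. *)
Lemma sqr_add_split (c d x y : R) : 1 <= c -> (c - 1) * (d - 1) = 1 ->
  (x + y) ^+ 2 <= c * x ^+ 2 + d * y ^+ 2.
Proof.
rewrite le_eqVlt => /predU1P[<-|c1 cd]; first by rewrite subrr mul0r => /eqP;
  rewrite eq_sym oner_eq0.
have c0 : 0 < c - 1 by rewrite subr_gt0.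
rewrite -subr_ge0 -(pmulr_rge0 _ c0).
have -> : (c - 1) * (c * x ^+ 2 + d * y ^+ 2 - (x + y) ^+ 2) =
    ((c - 1) * x - y) ^+ 2 + ((c - 1) * (d - 1) - 1) * y ^+ 2 by ring.
by rewrite cd subrr mul0r addr0 sqr_ge0.
Qed.

(** The reciprocals of the six weights add up to 1. The compression gap [e] gets the smallest
    weight, because its coefficient is the one that has to fit into the quadratic step size
    condition. *)
Lemma sqr_add_weights6 (e h y p s x : R) :
  (e + (h + (y + p + (s + x)))) ^+ 2 <=
  5 / 2 * e ^+ 2 + 10 / 3 * h ^+ 2 + 10 * y ^+ 2 + 10 * p ^+ 2 + 20 * s ^+ 2
    + 20 * x ^+ 2.
Proof.
have h1 : (e + (h + (y + p + (s + x)))) ^+ 2 <=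
    5 / 2 * e ^+ 2 + 5 / 3 * (h + (y + p + (s + x))) ^+ 2.
  by apply: sqr_add_split; lra.
have h2 : (h + (y + p + (s + x))) ^+ 2 <= 2 * h ^+ 2 + 2 * (y + p + (s + x)) ^+ 2.
  by apply: sqr_add_split; lra.
have h3 : (y + p + (s + x)) ^+ 2 <= 3 / 2 * (y + p) ^+ 2 + 3 * (s + x) ^+ 2.
  by apply: sqr_add_split; lra.
have h4 : (y + p) ^+ 2 <= 2 * y ^+ 2 + 2 * p ^+ 2 by apply: sqr_add_split; lra.
have h5 : (s + x) ^+ 2 <= 2 * s ^+ 2 + 2 * x ^+ 2 by apply: sqr_add_split; lra.
by lra.
Qed.

(** The weight conjugate to [1 + Phi / 2] in [sqr_add_split]; it equals the factor (2 + phi2) / phi2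
    of [kappa2]. *)
Definition contraction_weight (Phi : R) : R := 1 + 2 / Phi.

Lemma sqr_add_contraction (Phi x y : R) : 0 < Phi ->
  (x + y) ^+ 2 <= (1 + Phi / 2) * x ^+ 2 + contraction_weight Phi * y ^+ 2.
Proof.
move=> P0; apply: sqr_add_split; first by rewrite lerDl divr_ge0// ltW.
by rewrite /contraction_weight; field; rewrite gt_eqF.
Qed.

(** Coordinate of the next residual: [A] is that of Y - alpha C(Y) and [e] that of C(Y) - Y, so
    [h + Y + e] is the coordinate of xhat. *)
Definition mode_Y eta a zt lam b h p Y s A e xi' : R :=
  A - zt * a * lam * (h + Y + e) - a * mode_u lam b h p - eta * s + xi'.

(** Every term besides [A] and the new noise carries a factor of the order of the step. One such
    factor compensates the large [contraction_weight], which leaves a dissipation-sized term. Only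
    the term in [e] keeps its full square, for the quadratic step size condition to handle. *)
Lemma mode_compression eta a zt lam b Phi h p Y s A e xi' :
  mode_params eta a zt lam b -> 0 < Phi ->
  contraction_weight Phi * (zt * a * lam) <= 1 / 12 ->
  mode_Y eta a zt lam b h p Y s A e xi' ^+ 2 <=
  (1 + Phi / 2) * A ^+ 2
  + 5 / 2 * (contraction_weight Phi * (zt * a * lam * e) ^+ 2)
  + 29 / 100 * (zt * a * lam * h ^+ 2) + 5 / 6 * (zt * a * lam * Y ^+ 2)
  + 8 / 100 * (a * lam * p ^+ 2) + 1 / 100 * (eta * s ^+ 2)
  + 1 / 100 * (eta^-1 * xi' ^+ 2).
Proof.
move=> params P0; set Pi := contraction_weight Phi => Pi_le.
have [[a0 l0 z0 al0 g0] [_ [kg _ ag alg eg]]] := mode_facts params.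
case: params => -[e0 zt_ge _] [bge0 _].
have Pi0 : 0 <= Pi by rewrite addr_ge0// divr_ge0// ltW.
set g := zt * a * lam in Pi_le g0 kg ag alg eg *.
have al0' := ltW al0; have e0' := ltW e0.
set q := g + a * (b * lam) in kg.
have -> : mode_Y eta a zt lam b h p Y s A e xi' =
    A + (- (g * e) + (- (q * h) + (- (g * Y) - (a * lam * p) + (- (eta * s) + xi')))).
  by rewrite /mode_Y /mode_u /q /g; ring.
have h1 := sqr_add_contraction A
  (- (g * e) + (- (q * h) + (- (g * Y) - (a * lam * p) + (- (eta * s) + xi')))) P0.
have h2 := ler_wpM2l Pi0 (sqr_add_weights6 (- (g * e)) (- (q * h)) (- (g * Y))
  (- (a * lam * p)) (- (eta * s)) xi').
apply: le_trans h1 _; rewrite -/Pi -/(contraction_weight Phi).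
move: h2; rewrite !sqrrN => h2.
have q0 : 0 <= q by rewrite addr_ge0// !mulr_ge0// ltW.
have kq : Pi * (q * h) ^+ 2 <= 171 / 2000 * (g * h ^+ 2).
  rewrite exprMn mulrA; apply: atom_le.
  have q2 : q ^+ 2 <= (101 / 100 * g) ^+ 2.
    by apply: lerXn2r; rewrite ?nnegrE// (le_trans q0).
  have g2 : Pi * g * g <= 1 / 12 * g by rewrite ler_wpM2r.
  by move: g0 (ler_wpM2l Pi0 q2) g2; clear; lra.
have kY : Pi * (g * Y) ^+ 2 <= 1 / 12 * (g * Y ^+ 2).
  rewrite exprMn mulrA; apply: atom_le.
  by rewrite expr2 mulrA ler_wpM2r.
have kp : Pi * (a * lam * p) ^+ 2 <= 2 / 252 * (a * lam * p ^+ 2).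
  rewrite exprMn mulrA; apply: atom_le.
  rewrite expr2 mulrA ler_wpM2r//.
  by move: Pi_le (ler_wpM2l Pi0 alg); clear; lra.
have Pe : 3648 / 12 * (Pi * eta) <= 1 / 12.
  by move: Pi_le (ler_wpM2l Pi0 eg); clear; lra.
have ks : Pi * (eta * s) ^+ 2 <= 1 / 2000 * (eta * s ^+ 2).
  rewrite exprMn mulrA; apply: atom_le.
  rewrite expr2 mulrA ler_wpM2r//.
  have : 0 <= Pi * eta by rewrite mulr_ge0.
  by move: Pe; clear; lra.
have kx : Pi * xi' ^+ 2 <= 1 / 2000 * (eta^-1 * xi' ^+ 2).
  apply: atom_le; rewrite -(ler_pM2r e0) -mulrA mulVf ?gt_eqF//.
  have : 0 <= Pi * eta by rewrite mulr_ge0.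
  by move: Pe; clear; lra.
have S0 : 0 <= eta * s ^+ 2 := mulr_ge0 e0' (sqr_ge0 s).
have D0 : 0 <= g * h ^+ 2 := mulr_ge0 g0 (sqr_ge0 h).
have P00 : 0 <= a * lam * p ^+ 2 := mulr_ge0 al0' (sqr_ge0 p).
clearbody q g Pi.
move: h2 kq kY kp ks kx S0 D0 P00; clear.
set B := (- (g * e) + _); clearbody B.
by lra.
Qed.

(** The budget closes: [zt a lam h^2] has coefficient -64 + 15 + 29 + 10 and [a lam p^2] has -17 + 2
    + 8, in hundredths, both negative. As [h + Y - xi] is the coordinate of x, the term in [kx]
    extracts from the dissipation in [h] the decrease measured in x. *)
Lemma mode_step eta a zt lam b Phi kx h p Y xi ze s de A e xi' :
  mode_params eta a zt lam b -> 0 < Phi ->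
  contraction_weight Phi * (zt * a * lam) <= 1 / 12 -> kx <= zt * a / 30 ->
  mode_Q zt lam (mode_z zt lam b h Y xi + mode_dz eta a zt lam b h p xi s)
      (p + mode_dp a h ze de)
    + mode_Y eta a zt lam b h p Y s A e xi' ^+ 2 + kx * (h + Y - xi) ^+ 2
  <= mode_Q zt lam (mode_z zt lam b h Y xi) p + (1 + Phi / 2) * A ^+ 2
     + 5 / 2 * (contraction_weight Phi * (zt * a * lam * e) ^+ 2)
     + 5 * (zt * a * lam * Y ^+ 2)
     + 11 / 10 * (eta^-1 * xi ^+ 2) + 3 * (eta * s ^+ 2)
     + 2 / 5 * ((1 + zt) * lam * (eta^-1 * ze ^+ 2))
     + 7 / 10 * ((1 + zt) * lam * (eta^-1 * de ^+ 2))
     + 1 / 100 * (eta^-1 * xi' ^+ 2).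
Proof.
move=> params P0 Pi_le kx_le.
have h1 := mode_first_order h p Y xi ze s de params.
have h2 := mode_second_order h p xi ze s de params.
have h3 := mode_compression h p Y s A e xi' params P0 Pi_le.
have [_ _ _ D0] := mode_atoms h params.
have [_ _ _ Y0] := mode_atoms Y params.
have [[a0 l0 z0 al0 g0] [[_ _ e3 _ _] [_ zl10 _ _ _]]] := mode_facts params.
case: params => -[e0 zt_ge l1] [bge0 [step _ _ _]].
have x1 := sqr_le_inv_sqr xi e0 e3.
have iv (x : R) : 0 <= eta^-1 * x ^+ 2.
  by apply: mulr_ge0 (sqr_ge0 _); rewrite invr_ge0 ltW.
have zl0 : 0 <= (1 + zt) * lam by rewrite (le_trans _ zl10).
have X0 := iv xi.
have Z0 := mulr_ge0 zl0 (iv ze).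
have De0 := mulr_ge0 zl0 (iv de).
have S0 : 0 <= eta * s ^+ 2 := mulr_ge0 (ltW e0) (sqr_ge0 s).
have Dp0 : 0 <= a * lam * p ^+ 2 := mulr_ge0 (ltW al0) (sqr_ge0 p).
have x2 : (h + Y - xi) ^+ 2 <= 3 * (h ^+ 2 + Y ^+ 2 + xi ^+ 2).
  move: (sqr_ge0 (h - Y)) (sqr_ge0 (h + xi)) (sqr_ge0 (Y + xi)); clear; lra.
have zag : zt * a <= zt * a * lam by rewrite ler_peMr// mulr_ge0// ltW.
have x3 : kx * (h + Y - xi) ^+ 2 <= 1 / 10 * (zt * a * lam * h ^+ 2)
    + 1 / 10 * (zt * a * lam * Y ^+ 2) + 1 / 10 * (zt * a * lam * xi ^+ 2).
  have k1 : kx <= 1 / 30 * (zt * a * lam) by move: kx_le zag; clear; lra.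
  apply: le_trans (ler_wpM2r (sqr_ge0 _) k1) _.
  have k2 : 0 <= 1 / 30 * (zt * a * lam) by apply: mulr_ge0 g0; num.
  by move: (ler_wpM2l k2 x2); clear; lra.
have x4 : zt * a * lam * xi ^+ 2 <= 1 / 36 * xi ^+ 2.
  by rewrite ler_wpM2r ?sqr_ge0.
set z := mode_z _ _ _ _ _ _ in h1 *; set dz := mode_dz _ _ _ _ _ _ _ _ _ in h1 h2 *.
set dp := mode_dp _ _ _ _ in h1 h2 *; set Yn := mode_Y _ _ _ _ _ _ _ _ _ _ _ _ in h3 *.
have -> : mode_Q zt lam (z + dz) (p + dp) = mode_Q zt lam z p
    + (z * dz + (1 + zt) * lam * (p * dp) + dz * p + z * dp)
    + (1 / 2 * dz ^+ 2 + 1 / 2 * (1 + zt) * lam * dp ^+ 2 + dz * dp).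
  by rewrite /mode_Q; field.
move: (mode_Q zt lam z p) => Q0; clearbody z dz dp Yn.
move: h1 h2; set F := (z * dz + _ + _ + _); set G := (_ + dz * dp).
clearbody F G => h1 h2.
move: (contraction_weight _ * (_ * e) ^+ 2) h3 => E h3.
move: h1 h2 h3 D0 Y0 x1 X0 Z0 De0 S0 Dp0 x3 x4; clear.
move: (kx * _) => K; lra.
Qed.

End consensus_mode.

(** * Descent along the average *)

Section average_mode.
Context {R : realFieldType}.

(** The terms in [G] and [Cm] bound the increment of the objective, and the decrease is the
    [-eta G^2] contained in [G (xi - eta g)]. A quarter of it is kept and the rest absorbs the cross
    terms. The mean of v is undamped and acts as a forcing, which leaves [2 eta (om v)^2] on the
    right. *)
Lemma average_step (eta om c0 Cm Phi v G s g xi ze de A xi' : R) :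
  0 < eta -> eta <= 1 / 1000 -> 29 <= om -> 0 <= c0 -> 2 * c0 <= om ->
  0 <= Cm -> 100 * (Cm * eta) <= 1 -> 0 < Phi ->
  300 * (contraction_weight Phi * eta) <= 1 ->
  g = om * v + G + s ->
  1 / 2 * c0 * (v + om^-1 * G + ze + de) ^+ 2
    + (G * (xi - eta * g) + Cm * (xi - eta * g) ^+ 2)
    + (A - eta * g + xi') ^+ 2 + eta / 4 * G ^+ 2
  <= 1 / 2 * c0 * (v + om^-1 * G) ^+ 2 + (1 + Phi / 2) * A ^+ 2
     + 6 * (eta * s ^+ 2) + 7 / 10 * (c0 * (eta^-1 * de ^+ 2))
     + 2 / 5 * (c0 * (eta^-1 * ze ^+ 2)) + 3 / 2 * (eta^-1 * xi ^+ 2)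
     + 1 / 50 * (eta^-1 * xi' ^+ 2) + 2 * (eta * (om * v) ^+ 2).
Proof.
move=> e0 e3 om29 c00 c0_le Cm0 Cm_le P0 Pi_le g_def.
have om0 : 0 < om by lra.
have e0' := ltW e0.
set V := om * v; set u := v + om^-1 * G.
have iv (x : R) : 0 <= eta^-1 * x ^+ 2.
  by apply: mulr_ge0 (sqr_ge0 _); rewrite invr_ge0.
have ev (x : R) : 0 <= eta * x ^+ 2 := mulr_ge0 e0' (sqr_ge0 x).
have omu : om * u = V + G by rewrite /u mulrDr mulrA mulfV ?gt_eqF// mul1r.
have omu2 : (om * u) ^+ 2 <= 2 * V ^+ 2 + 2 * G ^+ 2.
  by rewrite omu; apply: sqr_add_split; num.
have cu : 29 * (c0 * (eta * u ^+ 2)) <= eta * V ^+ 2 + eta * G ^+ 2.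
  have h1 : 29 * c0 <= 1 / 2 * om ^+ 2.
    have : om * 29 <= om * om by rewrite ler_wpM2l// ltW.
    by move: c0_le; clear; lra.
  have := ler_wpM2r (ev u) h1; have := ler_wpM2l e0' omu2.
  by clear; lra.
have ud : u * de <= 5 / 7 * (eta * u ^+ 2) + 7 / 20 * (eta^-1 * de ^+ 2).
  by apply: young_inv => //; num.
have uz : u * ze <= 5 / 7 * (eta * u ^+ 2) + 7 / 20 * (eta^-1 * ze ^+ 2).
  by apply: young_inv => //; num.
have zd : (ze + de) ^+ 2 <= 2 * ze ^+ 2 + 2 * de ^+ 2.
  by apply: sqr_add_split; num.
have z1 := sqr_le_inv_sqr ze e0 e3.
have d1 := sqr_le_inv_sqr de e0 e3.
have q1 : c0 * (u * de) + c0 * (u * ze) + 1 / 2 * (c0 * (ze + de) ^+ 2) <=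
    1 / 20 * (eta * V ^+ 2 + eta * G ^+ 2)
    + 352 / 1000 * (c0 * (eta^-1 * de ^+ 2)) + 352 / 1000 * (c0 * (eta^-1 * ze ^+ 2)).
  have h1 := ler_wpM2l c00 ud.
  have h2 := ler_wpM2l c00 uz.
  have h3 := ler_wpM2l c00 zd.
  have h4 := ler_wpM2l c00 z1.
  have h5 := ler_wpM2l c00 d1.
  move: (mulr_ge0 c00 (iv ze)) (mulr_ge0 c00 (iv de)) (ev V) (ev G) h1 h2 h3 h4 h5 cu.
  by clear; lra.
have Gx : G * xi <= 1 / 5 * (eta * G ^+ 2) + 5 / 4 * (eta^-1 * xi ^+ 2).
  by apply: young_inv => //; num.
have GV : - (eta * (G * V)) <= 1 / 5 * (eta * G ^+ 2) + 5 / 4 * (eta * V ^+ 2).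
  by apply: young_weightedN => //; num.
have Gs : - (eta * (G * s)) <= 1 / 20 * (eta * G ^+ 2) + 5 * (eta * s ^+ 2).
  by apply: young_weightedN => //; num.
have gg : g ^+ 2 <= 3 * (V ^+ 2 + G ^+ 2 + s ^+ 2).
  rewrite g_def -/V; move: (sqr_ge0 (V - G)) (sqr_ge0 (V - s)) (sqr_ge0 (G - s)).
  by clear; lra.
have eg : eta * g ^+ 2 <= 3 * (eta * V ^+ 2 + eta * G ^+ 2 + eta * s ^+ 2).
  by move: (ler_wpM2l e0' gg); clear; lra.
have Ce : Cm <= 1 / 100 * eta^-1.
  by rewrite ler_pdivlMr//; move: Cm_le; clear; lra.
have Pe : contraction_weight Phi <= 1 / 300 * eta^-1.
  by rewrite ler_pdivlMr//; move: Pi_le; clear; lra.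
have ege : eta^-1 * (eta * g) ^+ 2 = eta * g ^+ 2.
  by field; rewrite gt_eqF.
have m2 : (xi - eta * g) ^+ 2 <= 2 * xi ^+ 2 + 2 * (eta * g) ^+ 2.
  by rewrite -(sqrrN (eta * g)); apply: sqr_add_split; num.
have Cm2 : Cm * (xi - eta * g) ^+ 2 <=
    1 / 50 * (eta^-1 * xi ^+ 2) + 1 / 50 * (eta * g ^+ 2).
  apply: le_trans (ler_wpM2r (sqr_ge0 _) Ce) _.
  have := ler_wpM2l (_ : 0 <= 1 / 100 * eta^-1) m2.
  rewrite mulr_ge0 ?invr_ge0 ?divr_ge0// => /(_ isT).
  by move: ege; clear; lra.
have b2 : (xi' - eta * g) ^+ 2 <= 2 * xi' ^+ 2 + 2 * (eta * g) ^+ 2.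
  by rewrite -(sqrrN (eta * g)); apply: sqr_add_split; num.
have Pb2 : contraction_weight Phi * (xi' - eta * g) ^+ 2 <=
    1 / 150 * (eta^-1 * xi' ^+ 2) + 1 / 150 * (eta * g ^+ 2).
  apply: le_trans (ler_wpM2r (sqr_ge0 _) Pe) _.
  have := ler_wpM2l (_ : 0 <= 1 / 300 * eta^-1) b2.
  rewrite mulr_ge0 ?invr_ge0 ?divr_ge0// => /(_ isT).
  by move: ege; clear; lra.
have AB := sqr_add_contraction A (xi' - eta * g) P0.
have -> : A - eta * g + xi' = A + (xi' - eta * g) by ring.
have -> : G * (xi - eta * g) =
    G * xi - eta * G ^+ 2 - eta * (G * V) - eta * (G * s) by rewrite g_def /V; ring.
have -> : 1 / 2 * c0 * (u + ze + de) ^+ 2 = 1 / 2 * c0 * u ^+ 2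
    + (c0 * (u * de) + c0 * (u * ze) + 1 / 2 * (c0 * (ze + de) ^+ 2)) by field.
move: (iv xi) (iv xi') (ev V) (ev G) (ev s) (mulr_ge0 c00 (iv ze)) (mulr_ge0 c00 (iv de)).
move: q1 Gx GV Gs eg Cm2 Pb2 AB.
clear g_def; clearbody u V.
set q := (_ + _ + 1 / 2 * (c0 * _)).
move: ((A + _) ^+ 2) (contraction_weight Phi * _) => b B.
move: (Cm * _) => C; clearbody q; clear.
lra.
Qed.

End average_mode.

(** * Spectrum of the Laplacian *)

Section network_spectrum.
Context {R : realType} {n : nat}.
Variables (e : rel 'I_n) (W : 'M[R]_n) (lam : nat -> R) (Rm : 'M[R]_(n, n.-1)).
Hypotheses (n_gt0 : (0 < n)%N) (W_adj : weighted_adjacency e W).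
Hypotheses (W_stoch : doubly_stochastic W).
Hypotheses (L_eigen : nonzero_eigenbasis (laplacian W) lam Rm).

Definition mode (a : 'I_n -> R) (j : 'I_n.-1) : R := \sum_i Rm i j * a i.
Definition avg (a : 'I_n -> R) : R := n%:R^-1 * \sum_i a i.
Definition lam_mode (j : 'I_n.-1) : R := lam (j + 2)%N.

Let nR0 : n%:R != 0 :> R. Proof. by rewrite pnatr_eq0 -lt0n. Qed.

Lemma laplacianE : laplacian W = 1%:M - W.
Proof.
have [_ W1 _] := W_stoch.
by apply/matrixP => i j; rewrite !mxE W1 mulrb; case: eqP.
Qed.

(** For a single agent the zero diagonal would make [W] vanish, against its unit row sum. *)
Lemma network_size_gt1 : (1 < n)%N.
Proof.
rewrite ltn_neqAle n_gt0 andbT; apply/eqP => n1.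
have [_ W1 _] := W_stoch; have [_ _ _ W0] := W_adj.
have := W1 (Ordinal n_gt0); rewrite big1 => [/eqP|i _].
  by rewrite eq_sym oner_eq0.
have -> : i = Ordinal n_gt0 by apply: val_inj; case: i => -[|k] //= kn; move: kn; rewrite -n1.
by rewrite W0.
Qed.

Lemma laplacian_sym : (laplacian W)^T = laplacian W.
Proof.
by rewrite laplacianE linearB /= trmx1; have [-> _ _ _] := W_adj.
Qed.

Lemma laplacian_row_sum i : \sum_k laplacian W i k = 0.
Proof.
have [_ W1 _] := W_stoch; rewrite laplacianE.
under eq_bigr do rewrite !mxE.
rewrite sumrB W1 (bigD1 i)//= eqxx big1 ?addr0 ?subrr// => j.
by rewrite eq_sym => /negbTE ->.
Qed.

Lemma laplacian_eigenvectorE i j :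
  \sum_k laplacian W i k * Rm k j = lam_mode j * Rm i j.
Proof.
have [_ _ LR _] := L_eigen; have /matrixP/(_ i 0) := LR j.
by rewrite !mxE /lam_mode => <-; apply: eq_bigr => k _; rewrite !mxE.
Qed.

Lemma lam_mode_neq0 j : lam_mode j != 0.
Proof.
have [_ l0 _ _] := L_eigen; apply: l0.
by rewrite addn2 /= -ltn_predRL ltn_ord.
Qed.

Lemma laplacian_symE i k : laplacian W i k = laplacian W k i.
Proof. by rewrite -[in LHS]laplacian_sym mxE. Qed.

Lemma mode_laplacian a j :
  mode (fun i => \sum_k laplacian W i k * a k) j = lam_mode j * mode a j.
Proof.
rewrite /mode; under eq_bigr do rewrite mulr_sumr.
rewrite exchange_big /= mulr_sumr; apply: eq_bigr => k _.
rewrite mulrA -laplacian_eigenvectorE mulr_suml; apply: eq_bigr => i _.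
by rewrite laplacian_symE; ring.
Qed.

Lemma avg_laplacian a : avg (fun i => \sum_k laplacian W i k * a k) = 0.
Proof.
rewrite /avg exchange_big big1 ?mulr0// => k _.
by rewrite -mulr_suml; under eq_bigr do rewrite laplacian_symE; rewrite laplacian_row_sum mul0r.
Qed.

(** Constants lie in the kernel of the symmetric matrix [L], hence are orthogonal to eigenvectors
    with nonzero eigenvalue. *)
Lemma mode_cst (c : R) j : mode (fun=> c) j = 0.
Proof.
apply/eqP; rewrite -(inj_eq (mulfI (lam_mode_neq0 j))) mulr0 -mode_laplacian.
rewrite /mode big1// => i _; by rewrite -mulr_suml laplacian_row_sum mul0r mulr0.
Qed.

Lemma modes_orthonormal j l : \sum_i Rm i j * Rm i l = (j == l)%:R.
Proof.
have [_ _ _ /matrixP/(_ j l)] := L_eigen; rewrite !mxE => <-.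
by apply: eq_bigr => i _; rewrite !mxE.
Qed.

(** The matrix [r_1 R] is square with orthonormal columns, hence its rows are orthonormal as
    well. *)
Lemma modes_complete i k : \sum_j Rm i j * Rm k j = (i == k)%:R - n%:R^-1.
Proof.
have Rm0 j : \sum_i Rm i j = 0.
  by have := mode_cst 1 j; rewrite /mode; under eq_bigr do rewrite mulr1.
have oR := modes_orthonormal.
(* Writing n as m + 1 makes [r_1 R] square up to conversion. *)
move: nR0 i k; clear -Rm0 oR n_gt0; case: n n_gt0 Rm Rm0 oR => // m _ Q Q0 oQ mR0 i k.
pose r1 : 'cV[R]_m.+1 := const_mx (Num.sqrt m.+1%:R)^-1.
pose B : 'M[R]_(m.+1, 1 + m) := row_mx r1 Q.
have s2 : (Num.sqrt m.+1%:R)^-1 * (Num.sqrt m.+1%:R)^-1 = m.+1%:R^-1 :> R.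
  by rewrite -invfM -expr2 sqr_sqrtr.
have BB : B^T *m B = 1%:M.
  rewrite tr_row_mx mul_col_row [RHS]scalar_mx_block; congr block_mx.
  - apply/matrixP => a b; rewrite !mxE !ord1 eqxx; under eq_bigr do rewrite !mxE s2.
    by rewrite sumr_const card_ord -(mulr_natr _^-1) mulVf.
  - apply/matrixP => a b; rewrite !mxE; under eq_bigr do rewrite !mxE.
    by rewrite -mulr_sumr Q0 mulr0.
  - apply/matrixP => a b; rewrite !mxE; under eq_bigr do rewrite !mxE.
    by rewrite -mulr_suml Q0 mul0r.
  - apply/matrixP => a b; rewrite !mxE -oQ; apply: eq_bigr => c _.
    by rewrite !mxE.
have /matrixP/(_ i k) : B *m B^T = 1%:M by exact: (@mulmx1C _ m.+1 B^T B BB).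
rewrite tr_row_mx mul_row_col !mxE big_ord1 !mxE s2 => <-.
rewrite addrAC subrr add0r; apply: eq_bigr => c _; by rewrite !mxE.
Qed.

Lemma parseval a b :
  \sum_i a i * b i = \sum_j mode a j * mode b j + n%:R * (avg a * avg b).
Proof.
rewrite /mode; under [X in _ = X + _]eq_bigr do rewrite mulr_suml.
rewrite exchange_big /=.
transitivity (\sum_i (a i * b i - a i * avg b) + n%:R * (avg a * avg b)).
  by rewrite sumrB -mulr_suml /avg; field.
congr (_ + _); apply: eq_bigr => i _.
under eq_bigr do rewrite mulr_sumr.
rewrite exchange_big /=.
transitivity (\sum_k a i * b k * \sum_j Rm i j * Rm k j).
  under [RHS]eq_bigr do rewrite modes_complete mulrBr.
  rewrite sumrB (bigD1 i)//= eqxx mulr1 big1 ?addr0 => [|k].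
    by rewrite /avg mulr_sumr mulr_sumr; congr (_ - _); apply: eq_bigr => k _; ring.
  by rewrite eq_sym => /negbTE ->; rewrite mulr0.
apply: eq_bigr => k _; rewrite mulr_sumr; apply: eq_bigr => j _; ring.
Qed.

(** The form is the Dirichlet energy, half the sum of the w_ik (a_i - a_k)^2. *)
Lemma laplacian_form_ge0 (a : 'I_n -> R) :
  0 <= \sum_i a i * \sum_k laplacian W i k * a k.
Proof.
have [W0 W1 W1'] := W_stoch.
have -> : \sum_i a i * (\sum_k laplacian W i k * a k) =
    2^-1 * \sum_i \sum_k W i k * (a i - a k) ^+ 2.
  have -> : \sum_i \sum_k W i k * (a i - a k) ^+ 2 =
      \sum_i a i ^+ 2 + \sum_k a k ^+ 2 - 2 * \sum_i \sum_k a i * (W i k * a k).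
    transitivity (\sum_i \sum_k W i k * a i ^+ 2 + \sum_i \sum_k W i k * a k ^+ 2
        - 2 * \sum_i \sum_k a i * (W i k * a k)).
      rewrite mulr_sumr -big_split -sumrB /=; apply: eq_bigr => i _.
      rewrite mulr_sumr -big_split -sumrB /=; apply: eq_bigr => k _; ring.
    congr (_ + _ - _).
      by apply: eq_bigr => i _; rewrite -mulr_suml W1 mul1r.
    by rewrite exchange_big; apply: eq_bigr => k _; rewrite -mulr_suml W1' mul1r.
  transitivity (\sum_i a i ^+ 2 - \sum_i \sum_k a i * (W i k * a k)); last by field.
  rewrite -sumrB; apply: eq_bigr => i _; rewrite laplacianE.
  under eq_bigr do rewrite !mxE mulrBl.
  rewrite sumrB mulrBr mulr_sumr; congr (_ - _).
    rewrite (bigD1 i)//= eqxx mul1r big1 ?addr0 ?expr2// => k.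
    by rewrite eq_sym => /negbTE ->; rewrite mul0r mulr0.
  by rewrite mulr_sumr.
rewrite mulr_ge0 ?invr_ge0// sumr_ge0// => i _; rewrite sumr_ge0// => k _.
by rewrite mulr_ge0 ?sqr_ge0.
Qed.

Lemma lam_mode_gt0 j : 0 < lam_mode j.
Proof.
rewrite lt_def lam_mode_neq0/=; have := laplacian_form_ge0 (Rm^~ j).
rewrite (_ : \sum_i _ = lam_mode j)//.
under eq_bigr do rewrite laplacian_eigenvectorE mulrCA.
by rewrite -mulr_sumr modes_orthonormal eqxx mulr1.
Qed.

Lemma laplacian_eigenvalue_mode j : eigenvalue (laplacian W) (lam_mode j).
Proof.
apply/eigenvalueP; exists (\row_i Rm i j).
  apply/rowP => i; rewrite !mxE -laplacian_eigenvectorE; apply: eq_bigr => k _.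
  by rewrite [X in X * _]mxE laplacian_symE mulrC.
apply/eqP => /rowP Rj0; have := modes_orthonormal j j.
rewrite eqxx big1 => [/eqP|i _]; first by rewrite eq_sym oner_eq0.
by have := Rj0 i; rewrite !mxE => ->; rewrite mul0r.
Qed.

(** A left eigenvector for any other value would be orthogonal to all columns of [Rm] and to the
    constants, so completeness makes it vanish. The field is arbitrary because [min_pos_eigenvalue]
    is about real eigenvalues and [spectral_radius] about complex ones. *)
Lemma laplacian_eigenvalueE (F : fieldType) (g : {rmorphism R -> F}) (a : F) :
  eigenvalue (map_mx g (laplacian W)) a ->
  a = 0 \/ exists j, a = g (lam_mode j).
Proof.
move=> /eigenvalueP[v vL v0]; have [->|a0] := eqVneq a 0; first by left.
right; apply: contrapT => /forallNP aN.
have vLE i : \sum_k v 0 k * g (laplacian W k i) = a * v 0 i.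
  have /rowP/(_ i) := vL; rewrite [LHS]mxE [RHS]mxE => <-.
  by apply: eq_bigr => k _; rewrite [in RHS]mxE.
have c0 j : \sum_i v 0 i * g (Rm i j) = 0.
  have : a * \sum_i v 0 i * g (Rm i j) = g (lam_mode j) * \sum_i v 0 i * g (Rm i j).
    rewrite mulr_sumr; under eq_bigr do rewrite mulrA -vLE mulr_suml.
    rewrite exchange_big mulr_sumr; apply: eq_bigr => k _ /=.
    rewrite mulrCA -rmorphM -laplacian_eigenvectorE rmorph_sum mulr_sumr.
    by apply: eq_bigr => i _; rewrite rmorphM mulrA.
  move/eqP; rewrite -subr_eq0 -mulrBl mulf_eq0 subr_eq0 => /orP[/eqP /aN//|/eqP//].
have s0 : \sum_i v 0 i = 0.
  apply/eqP; rewrite -(inj_eq (mulfI a0)) mulr0 mulr_sumr.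
  under eq_bigr do rewrite -vLE.
  rewrite exchange_big big1// => k _; rewrite -mulr_sumr -rmorph_sum.
  by rewrite laplacian_row_sum rmorph0 mulr0.
case/eqP: v0; apply/rowP => k; rewrite mxE.
transitivity (\sum_i v 0 i * (g (\sum_j Rm i j * Rm k j) + g n%:R^-1)).
  under [RHS]eq_bigr do rewrite modes_complete -rmorphD subrK.
  rewrite (bigD1 k)//= eqxx rmorph1 mulr1 big1 ?addr0// => i /negbTE ->.
  by rewrite rmorph0 mulr0.
under eq_bigr do rewrite mulrDr.
rewrite big_split /= -mulr_suml s0 mul0r addr0.
under eq_bigr do rewrite rmorph_sum mulr_sumr.
rewrite exchange_big big1// => j _.
under eq_bigr do rewrite rmorphM mulrA.
by rewrite -mulr_suml c0 mul0r.
Qed.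

Lemma mode_index : exists j : 'I_n.-1, lam_mode j = lam 2.
Proof.
have n1 := network_size_gt1.
have j0 : (0 < n.-1)%N by rewrite -subn1 subn_gt0.
by exists (Ordinal j0).
Qed.

(** The infimum of an empty set would be 0; positivity uses that n > 1 provides at least one
    mode. *)
Lemma min_pos_eigenvalue_bounds :
  0 < min_pos_eigenvalue (laplacian W) /\
  forall j, min_pos_eigenvalue (laplacian W) <= lam_mode j.
Proof.
have [lam_mono _ _ _] := L_eigen.
have [j0 j0E] := mode_index.
have lb0 : lbound [set a : R | (0 < a) && eigenvalue (laplacian W) a] (lam 2).
  move=> a /andP[a0 La].
  have /laplacian_eigenvalueE : eigenvalue (map_mx idfun (laplacian W)) a.
    by rewrite map_mx_id.
  case=> [a00|[j ->]]; first by rewrite a00 ltxx in a0.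
  by apply: lam_mono; rewrite ?leq_addl// addn2 -ltn_predRL ltn_ord.
have in_set j : [set a : R | (0 < a) && eigenvalue (laplacian W) a] (lam_mode j).
  by rewrite /= lam_mode_gt0 laplacian_eigenvalue_mode.
split.
  apply: lt_le_trans (lb_le_inf _ lb0); first by rewrite -j0E lam_mode_gt0.
  by exists (lam_mode j0).
by move=> j; apply: ge_inf (in_set j); exists (lam 2).
Qed.

Lemma spectral_radius_bound j : lam_mode j <= spectral_radius (laplacian W).
Proof.
have nE (x : R) : ComplexField.Normc.normc (real_complex R x) = `|x|.
  by rewrite /= expr0n addr0 sqrtr_sqr.
apply: ub_le_sup.
  exists (\sum_j `|lam_mode j|) => _ [a /= /laplacian_eigenvalueE aE <-].
  case: aE => [->|[l ->]].
    by rewrite ComplexField.Normc.normc0 sumr_ge0.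
  by rewrite nE (bigD1 l)//= lerDl sumr_ge0.
exists (real_complex R (lam_mode j)).
  by rewrite /= eigenvalue_map laplacian_eigenvalue_mode.
by rewrite nE gtr0_norm// lam_mode_gt0.
Qed.

(** Both sides are the trace of [L], whose diagonal entries are 1 because [W] has zero diagonal. *)
Lemma laplacian_trace : \sum_j lam_mode j = n%:R.
Proof.
have [_ _ _ Wii] := W_adj.
transitivity (\sum_j \sum_i Rm i j * \sum_k laplacian W i k * Rm k j).
  apply: eq_bigr => j _; under eq_bigr do rewrite laplacian_eigenvectorE mulrCA.
  by rewrite -mulr_sumr modes_orthonormal eqxx mulr1.
rewrite exchange_big /=.
transitivity (\sum_(i < n) (1 : R)); last by rewrite sumr_const card_ord.
apply: eq_bigr => i _; under eq_bigr do rewrite mulr_sumr.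
rewrite exchange_big /=.
transitivity (\sum_k laplacian W i k * \sum_j Rm i j * Rm k j).
  by apply: eq_bigr => k _; rewrite mulr_sumr; apply: eq_bigr => j _; ring.
under eq_bigr do rewrite modes_complete mulrBr.
rewrite sumrB -mulr_suml laplacian_row_sum mul0r subr0.
rewrite (bigD1 i)//= eqxx mulr1 big1 => [|k]; last first.
  by rewrite eq_sym => /negbTE ->; rewrite mulr0.
by rewrite laplacianE !mxE eqxx Wii subr0 addr0.
Qed.

(** The least of n - 1 numbers is at most their average. This is the upper bound on [lmin] that,
    against the condition on zeta1, makes zeta1 large. *)
Lemma min_pos_eigenvalue_le :
  (n%:R - 1) * min_pos_eigenvalue (laplacian W) <= n%:R.
Proof.
have [_ lm] := min_pos_eigenvalue_bounds.
rewrite -[leRHS]laplacian_trace.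
have -> : n%:R - 1 = (n.-1)%:R :> R by rewrite -subn1 natrB.
rewrite mulr_natl -[X in _ *+ X](card_ord n.-1) -sumr_const.
by apply: ler_sum => j _.
Qed.

End network_spectrum.

(** * Spectral form of the Lyapunov function *)

Section stacked_forms.
Context {R : realType}.

Lemma l2norm_sqr m (x : 'cV[R]_m) : l2norm x ^+ 2 = \sum_i x i 0 ^+ 2.
Proof. by rewrite sqr_sqrtr// sumr_ge0// => i _; exact: sqr_ge0. Qed.

Lemma sum_mxtens (n d : nat) (F : 'I_n -> 'I_d -> R) :
  \sum_(p < n * d) F (mxtens_unindex p).1 (mxtens_unindex p).2 =
  \sum_i \sum_c F i c.
Proof.
rewrite pair_big (reindex (@mxtens_index n d)); last first.
  exists (@mxtens_unindex n d) => p _; [exact: mxtens_indexK|exact: mxtens_unindexK].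
by apply: eq_bigr => p _; congr F; rewrite mxtens_indexK.
Qed.

Lemma stack_normE (n d : nat) (x : 'I_n -> 'cV[R]_d) :
  l2norm (stack x) ^+ 2 = \sum_i \sum_c x i c 0 ^+ 2.
Proof.
rewrite l2norm_sqr -sum_mxtens; by apply: eq_bigr => p _; rewrite mxE.
Qed.

Lemma bform_kron (n d : nat) (A : 'M[R]_n) (x y : 'I_n -> 'cV[R]_d) :
  bform (kron_id A) (stack x) (stack y) =
  \sum_c \sum_i \sum_k x i c 0 * A i k * y k c 0.
Proof.
rewrite /bform mxE.
transitivity (\sum_(q < n * d) \sum_(p < n * d)
    x (mxtens_unindex p).1 (mxtens_unindex p).2 0
    * A (mxtens_unindex p).1 (mxtens_unindex q).1
    * ((mxtens_unindex p).2 == (mxtens_unindex q).2)%:R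
    * y (mxtens_unindex q).1 (mxtens_unindex q).2 0).
  apply: eq_bigr => q _; rewrite !mxE mulr_suml; apply: eq_bigr => p _.
  by rewrite !mxE mulrA.
rewrite (sum_mxtens (fun k c => \sum_(p < n * d)
    x (mxtens_unindex p).1 (mxtens_unindex p).2 0 * A (mxtens_unindex p).1 k
    * ((mxtens_unindex p).2 == c)%:R * y k c 0)).
rewrite exchange_big; apply: eq_bigr => c _ /=.
rewrite [RHS]exchange_big; apply: eq_bigr => k _ /=.
rewrite (sum_mxtens (fun i c' => x i c' 0 * A i k * (c' == c)%:R * y k c 0)).
apply: eq_bigr => i _; rewrite (bigD1 c)//= eqxx mulr1 big1 ?addr0// => c' /negbTE ->.
by rewrite mulr0 mul0r.
Qed.

Lemma stackD (n d : nat) (x y : 'I_n -> 'cV[R]_d) :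
  stack x + stack y = stack (fun i => x i + y i).
Proof. by apply/matrixP => i j; rewrite !mxE. Qed.

Lemma stackB (n d : nat) (x y : 'I_n -> 'cV[R]_d) :
  stack x - stack y = stack (fun i => x i - y i).
Proof. by apply/matrixP => i j; rewrite !mxE. Qed.

Lemma stackZ (n d : nat) a (x : 'I_n -> 'cV[R]_d) :
  a *: stack x = stack (fun i => a *: x i).
Proof. by apply/matrixP => i j; rewrite !mxE. Qed.

Lemma mean_stackE (n d : nat) (x : 'I_n -> 'cV[R]_d) :
  mean_stack x = stack (fun=> mean x).
Proof.
apply/matrixP => p j; rewrite [LHS]mxE [RHS]mxE mxE mul1r.
by congr (mean x _ _); rewrite !ord1.
Qed.

End stacked_forms.

Section stacked_modes.
Context {R : realType} {n d : nat}.
Variables (e : rel 'I_n) (W : 'M[R]_n) (lam : nat -> R) (Rm : 'M[R]_(n, n.-1)).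
Hypotheses (n_gt0 : (0 < n)%N) (W_adj : weighted_adjacency e W).
Hypotheses (W_stoch : doubly_stochastic W).
Hypotheses (L_eigen : nonzero_eigenbasis (laplacian W) lam Rm).

Definition component (x : 'I_n -> 'cV[R]_d) (c : 'I_d) (i : 'I_n) : R := x i c 0.
Definition vmode (x : 'I_n -> 'cV[R]_d) (c : 'I_d) (j : 'I_n.-1) : R :=
  mode Rm (component x c) j.

Lemma mean_component (x : 'I_n -> 'cV[R]_d) c : mean x c 0 = avg (component x c).
Proof. by rewrite mxE summxE. Qed.

(** The hypothesis says that [A] is diagonal in the orthonormal basis formed by r_1 and the columns
    of [Rm], with entries [h0] and [h j]. *)
Lemma bform_spectral (h : 'I_n.-1 -> R) h0 (A : 'M[R]_n) (x y : 'I_n -> 'cV[R]_d) :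
  (forall i k, A i k = n%:R^-1 * h0 + \sum_j h j * (Rm i j * Rm k j)) ->
  bform (kron_id A) (stack x) (stack y) =
  \sum_c (\sum_j h j * (vmode x c j * vmode y c j)
          + n%:R * h0 * (mean x c 0 * mean y c 0)).
Proof.
move=> AE; rewrite bform_kron; apply: eq_bigr => c _.
have nR0 : n%:R != 0 :> R by rewrite pnatr_eq0 -lt0n.
transitivity (\sum_i \sum_k (n%:R^-1 * h0 * (x i c 0 * y k c 0)
   + \sum_j h j * (Rm i j * x i c 0 * (Rm k j * y k c 0)))).
  apply: eq_bigr => i _; apply: eq_bigr => k _.
  rewrite AE mulrDr mulrDl; congr (_ + _); first by ring.
  rewrite mulr_sumr mulr_suml; apply: eq_bigr => j _; ring.
under eq_bigr do rewrite big_split /=.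
rewrite big_split /= addrC; congr (_ + _).
  under eq_bigr do rewrite exchange_big /=.
  rewrite exchange_big /=; apply: eq_bigr => j _.
  rewrite /vmode /mode mulr_suml mulr_sumr; apply: eq_bigr => i _.
  by rewrite !mulr_sumr.
rewrite !mean_component /avg.
transitivity (n%:R^-1 * h0 * ((\sum_i x i c 0) * \sum_k y k c 0)); last by field.
rewrite mulr_suml mulr_sumr; apply: eq_bigr => i _.
by rewrite !mulr_sumr; apply: eq_bigr => k _; rewrite mulrA.
Qed.

Let complete := modes_complete n_gt0 W_adj W_stoch L_eigen.

Lemma P_mxE i k : P_mx lam Rm i k =
  n%:R^-1 * (lam n)^-1 + \sum_j (lam_mode lam j)^-1 * (Rm i j * Rm k j).
Proof.
have s2 : (Num.sqrt n%:R)^-1 * (Num.sqrt n%:R)^-1 = n%:R^-1 :> R.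
  by rewrite -invfM -expr2 sqr_sqrtr.
rewrite /P_mx mul_mx_diag mxE.
under eq_bigr do rewrite [(\matrix_(_, _) _) _ _]mxE [(_^T) _ _]mxE.
rewrite big_split_ord /= big_ord1 !row_mxEl; congr (_ + _).
  by rewrite !mxE !mulr1 mulrAC s2.
apply: eq_bigr => j _; rewrite !row_mxEr !mxE /lam_mode; ring.
Qed.

Lemma centering_mxE i k :
  (1%:M - n%:R^-1 *: ((const_mx 1 : 'cV[R]_n) *m (const_mx 1)^T)) i k =
  n%:R^-1 * 0 + \sum_j 1 * (Rm i j * Rm k j).
Proof.
rewrite mulr0 add0r; under eq_bigr do rewrite mul1r.
by rewrite complete !mxE big_ord1 !mxE !mulr1.
Qed.

Lemma centered_P_mxE i k :
  ((1%:M - n%:R^-1 *: ((const_mx 1 : 'cV[R]_n) *m (const_mx 1)^T)) *m P_mx lam Rm) i k =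
  n%:R^-1 * 0 + \sum_j (lam_mode lam j)^-1 * (Rm i j * Rm k j).
Proof.
have Rm0 j : \sum_i Rm i j = 0.
  have := mode_cst W_adj W_stoch L_eigen 1 j; rewrite /mode.
  by under eq_bigr do rewrite mulr1.
rewrite mulr0 add0r mxE; under eq_bigr do rewrite centering_mxE P_mxE mulr0 add0r mulrDr.
rewrite big_split /= -mulr_suml (_ : \sum_(_ < n) _ = 0) ?mul0r ?add0r; last first.
  rewrite exchange_big big1// => j _.
  by under eq_bigr do rewrite mul1r; rewrite -mulr_sumr Rm0 mulr0.
under eq_bigr do rewrite mulr_sumr.
rewrite exchange_big; apply: eq_bigr => j _ /=.
under eq_bigr do rewrite mulr_suml.
rewrite exchange_big /= (bigD1 j)//= [X in _ + X]big1 ?addr0 => [|l lj].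
  transitivity ((\sum_i0 Rm i0 j * Rm i0 j) * ((lam_mode lam j)^-1 * (Rm i j * Rm k j))).
    by rewrite mulr_suml; apply: eq_bigr => q _; ring.
  by rewrite (modes_orthonormal L_eigen) eqxx mul1r.
transitivity ((\sum_i0 Rm i0 l * Rm i0 j) * ((lam_mode lam j)^-1 * (Rm i l * Rm k j))).
  by rewrite mulr_suml; apply: eq_bigr => q _; ring.
by rewrite (modes_orthonormal L_eigen) (negbTE lj) mul0r.
Qed.

Lemma sum_sqr_modes (x : 'I_n -> 'cV[R]_d) :
  \sum_i \sum_c x i c 0 ^+ 2 =
  \sum_c (\sum_j vmode x c j ^+ 2 + n%:R * mean x c 0 ^+ 2).
Proof.
rewrite exchange_big; apply: eq_bigr => c _ /=.
rewrite mean_component -(parseval n_gt0 W_adj W_stoch L_eigen (component x c) (component x c)).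
by apply: eq_bigr => i _; rewrite expr2.
Qed.

Lemma centered_norm (x : 'I_n -> 'cV[R]_d) :
  l2norm (stack x - mean_stack x) ^+ 2 = \sum_c \sum_j vmode x c j ^+ 2.
Proof.
rewrite mean_stackE stackB stack_normE sum_sqr_modes; apply: eq_bigr => c _.
have -> : mean (fun i => x i - mean x) c 0 = 0.
  rewrite mean_component /avg /component.
  under eq_bigr do rewrite mxE [X in _ + X]mxE.
  rewrite sumrB sumr_const card_ord -mulr_natl mean_component /avg /component.
  by field; rewrite pnatr_eq0 -lt0n.
rewrite expr0n mulr0 addr0; apply: eq_bigr => j _; congr (_ ^+ 2).
rewrite /vmode /mode /component.
under eq_bigr do rewrite mxE [X in _ + X]mxE mulrBr.
rewrite sumrB -[RHS]subr0; congr (_ - _).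
exact: (mode_cst W_adj W_stoch L_eigen (mean x c 0) j).
Qed.

(** [K] and [K P] kill the average, on which [P] equals [lam_n^-1]. Hence the mean of [z] is absent,
    and [c0] is meant to be (1 + zt) / lam_n. *)
Definition lyapunov_modes (zt c0 : R) (z w : 'I_n -> 'cV[R]_d) : R :=
  \sum_c (\sum_j mode_Q zt (lam_mode lam j) (vmode z c j) ((lam_mode lam j)^-1 * vmode w c j)
   + n%:R * (1 / 2 * c0 * mean w c 0 ^+ 2)).

Lemma lyapunovE (p : setting R n) (f : 'I_n -> 'cV[R]_d -> R)
    (x v xc xi : 'I_n -> 'cV[R]_d) :
  lyapunov p f lam Rm x v xc xi =
  lyapunov_modes (p_gamma p / p_omega p)
    ((1 + p_gamma p / p_omega p) * (lam n)^-1) x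
    (fun i => v i + (p_omega p)^-1 *: grad (f i) (mean x))
  + \sum_i \sum_c (x i + xi i - xc i) c 0 ^+ 2
  + n%:R * (average f (mean x) - fine (min_value (average f))).
Proof.
rewrite /lyapunov stackZ !stackD stackB stack_normE; congr (_ + _ + _).
set w := fun i => v i + _; set zt := p_gamma p / p_omega p.
rewrite (_ : K_mx *m kron_id (P_mx lam Rm) = kron_id ((1%:M - n%:R^-1 *:
    ((const_mx 1 : 'cV[R]_n) *m (const_mx 1)^T)) *m P_mx lam Rm)); last first.
  by rewrite /K_mx /kron_id tensmx_mul mulmx1.
rewrite (_ : _ + zt *: _ = kron_id ((1 + zt) *: P_mx lam Rm)); last first.
  by apply/matrixP => i j; rewrite !mxE; ring.
rewrite /K_mx (bform_spectral (h := fun=> 1) (h0 := 0) (A := 1%:M - _)); last exact: centering_mxE.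
rewrite (bform_spectral (A := (1 + zt) *: _) (h := fun j => (1 + zt) * (lam_mode lam j)^-1)
  (h0 := (1 + zt) * (lam n)^-1)); last first.
  move=> i k; rewrite mxE P_mxE mulrDr mulr_sumr; congr (_ + _); first by ring.
  by apply: eq_bigr => j _; ring.
rewrite (bform_spectral (h := fun j => (lam_mode lam j)^-1) (h0 := 0)); last exact: centered_P_mxE.
rewrite !mulr_sumr -!big_split; apply: eq_bigr => c _ /=.
rewrite !mulr0 !mul0r !addr0 mulrDr addrA addrAC; congr (_ + _); last by move: (lam n)^-1 => il;
  field.
rewrite !mulr_sumr -!big_split; apply: eq_bigr => j _ /=.
by rewrite /mode_Q; field; exact: lam_mode_neq0 L_eigen j.
Qed.

End stacked_modes.

(** * Smooth functions *)

Section smooth_functions.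
Context {R : realType} {d : nat}.
Implicit Types (f : 'cV[R]_d -> R) (x y h : 'cV[R]_d).

Let quotient_along f x h (t : R) :
  (fun s : R => s^-1 *: (((fun u : R => f (x + u *: h)) \o shift t) (s *: 1)
      - f (x + t *: h))) =
  (fun s => s^-1 *: ((f \o shift (x + t *: h)) (s *: h) - f (x + t *: h))).
Proof. by apply/funext => s /=; rewrite [_%:A]mulr1 scalerDl addrCA. Qed.

Lemma derive_along f x h (t : R) :
  'D_1 (fun s : R => f (x + s *: h)) t = 'D_h f (x + t *: h).
Proof. by rewrite /derive quotient_along. Qed.

Lemma derivable_along f x h (t : R) : derivable f (x + t *: h) h ->
  derivable (fun s : R => f (x + s *: h)) t 1.
Proof. by rewrite /derivable quotient_along. Qed.

Lemma derive_grad f x h : differentiable f x ->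
  'D_h f x = \sum_c grad f x c 0 * h c 0.
Proof.
move=> dfx; rewrite deriveE// {1}(matrix_sum_delta h) linear_sum /=.
apply: eq_bigr => c _; rewrite big_ord1 linearZ /= -deriveE//.
by rewrite /grad mxE [RHS]mulrC.
Qed.

(** The mean value theorem provides a single intermediate gradient, whose deviation is bounded by
    [L] times the displacement. This gives the constant [L] instead of the optimal [L / 2]. *)
Lemma smooth_descent L f x y : 0 < L -> smooth L f ->
  f y <= f x + \sum_c grad f x c 0 * (y c 0 - x c 0)
    + L * \sum_c (y c 0 - x c 0) ^+ 2.
Proof.
move=> L0 [df Lf]; set h := y - x.
have hE c : y c 0 - x c 0 = h c 0 by rewrite !mxE.
under eq_bigr do rewrite hE.
under [X in L * X]eq_bigr do rewrite hE.
pose phi (t : R) : R := f (x + t *: h).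
have dphi t : derivable phi t 1.
  by apply: derivable_along; apply: diff_derivable.
have [t t01] : exists2 t, t \in `]0, 1[%R & phi 1 - phi 0 = 'D_1 phi t * (1 - 0).
  apply: (MVT ltr01) => [t _|]; first exact: DeriveDef.
  apply: derivable_within_continuous => t _; exact: dphi.
rewrite subr0 mulr1 /phi scale1r scale0r addr0 derive_along derive_grad//.
rewrite subrKC => fyx.
have {fyx}-> : f y = f x + \sum_c grad f (x + t *: h) c 0 * h c 0.
  by rewrite -fyx addrC subrK.
rewrite -addrA lerD2l.
have gL : \sum_c (grad f (x + t *: h) c 0 - grad f x c 0) ^+ 2 <= L ^+ 2 * \sum_c h c 0 ^+ 2.
  have := Lf (x + t *: h) x; rewrite -(ler_pXn2r (_ : (0 < 2)%N)) ?nnegrE ?sqrtr_ge0//; last first.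
    by rewrite mulr_ge0 ?sqrtr_ge0// ltW.
  rewrite exprMn !l2norm_sqr; under eq_bigr do rewrite mxE [X in _ + X]mxE.
  move=> /le_trans; apply; rewrite ler_wpM2l ?sqr_ge0//.
  apply: ler_sum => c _; rewrite addrAC subrr add0r mxE exprMn ler_piMl ?sqr_ge0//.
  move: t01; rewrite in_itv /= => /andP[t0 t1].
  by rewrite expr_le1// ltW.
rewrite -lerBlDl -sumrB.
apply: (@le_trans _ _ (\sum_c ((2 * L)^-1 * (grad f (x + t *: h) c 0 - grad f x c 0) ^+ 2
   + L / 2 * h c 0 ^+ 2))).
  apply: ler_sum => c _.
  rewrite [leLHS](_ : _ = (grad f (x + t *: h) c 0 - grad f x c 0) * h c 0); last by ring.
  apply: young; first by rewrite invr_gt0 mulr_gt0.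
  by rewrite (_ : 4 * _ * _ = 1)//; field; rewrite gt_eqF.
rewrite big_split /= -!mulr_sumr.
have := ler_wpM2l (_ : 0 <= (2 * L)^-1) gL; rewrite invr_ge0 mulr_ge0 ?(ltW L0)// => /(_ isT).
rewrite (_ : _^-1 * (_ * _) = L / 2 * \sum_c h c 0 ^+ 2); last by field; rewrite gt_eqF.
by lra.
Qed.

Lemma smooth_grad_sqr L f x y : 0 < L -> smooth L f ->
  \sum_c (grad f x c 0 - grad f y c 0) ^+ 2 <= L ^+ 2 * \sum_c (x c 0 - y c 0) ^+ 2.
Proof.
move=> L0 [_ /(_ x y)]; rewrite -(ler_pXn2r (_ : (0 < 2)%N)) ?nnegrE ?sqrtr_ge0//; last first.
  by rewrite mulr_ge0 ?sqrtr_ge0// ltW.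
rewrite exprMn !l2norm_sqr; under eq_bigr do rewrite mxE [X in _ + X]mxE.
by under [X in _ <= _ * X]eq_bigr do rewrite mxE [X in _ + X]mxE.
Qed.

Lemma smooth_continuous L f : smooth L f -> continuous f.
Proof. by move=> [df _] x; apply: differentiable_continuous. Qed.

(** Smoothness is Euclidean while the topology is that of the sup norm; the continuous function [g],
    which vanishes at [x], mediates between them. *)
Lemma grad_continuous L f c : 0 < L -> smooth L f -> continuous (fun x => grad f x c 0).
Proof.
move=> L0 Lf x; apply/(@cvgrPdist_lt _ _ _ (nbhs x) (nbhs_filter x)) => eps eps0.
pose g y := L ^+ 2 * \sum_b (x b 0 - y b 0) ^+ 2.
have cg : continuous g.
  move=> y; apply: (@continuousM _ _ (cst (L ^+ 2))
    (fun y => \sum_b (x b 0 - y b 0) ^+ 2)); first exact: cst_continuous.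
  apply: continuous_big; first exact: add_continuous.
  move=> b _ {}y.
  have cb : {for y, continuous (fun y : 'cV[R]_d => x b 0 - y b 0)}.
    apply: (@continuousB _ _ _ (cst (x b 0)) (fun y : 'cV[R]_d => y b 0)).
      exact: cst_continuous.
    exact: coord_continuous.
  exact: (continuousM cb cb).
have gx : g x = 0 by rewrite /g big1 ?mulr0// => b _; rewrite subrr expr0n.
have /(@cvgrPdist_lt _ _ _ (nbhs x) (nbhs_filter x))/(_ (eps ^+ 2)) := cg x;
  rewrite gx exprn_gt0// => /(_ isT).
apply: filterS => y; rewrite sub0r normrN => gy.
rewrite -(ltr_pXn2r (_ : (0 < 2)%N)) ?nnegrE ?(ltW eps0)//.
apply: le_lt_trans gy; rewrite [leRHS]ger0_norm /g; last first.
  by rewrite mulr_ge0 ?sqr_ge0// sumr_ge0// => b _; rewrite sqr_ge0.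
apply: le_trans (smooth_grad_sqr x y L0 Lf).
rewrite real_normK ?num_real// (bigD1 c)//= lerDl sumr_ge0// => b _.
exact: sqr_ge0.
Qed.

Lemma grad_average n (f : 'I_n -> 'cV[R]_d -> R) x :
  (forall i, differentiable (f i) x) ->
  grad (average f) x = mean (fun i => grad (f i) x).
Proof.
move=> df; apply/matrixP => c j; rewrite ord1 mxE mean_component /avg /component.
rewrite (_ : average f = n%:R^-1 \*: \sum_i f i); last first.
  by apply/funext => y; rewrite /average /= fct_sumE.
have ds : derivable (\sum_i f i) x (delta_mx c 0).
  by apply: derivable_sum => i; apply: diff_derivable.
rewrite deriveZ// derive_sum => [|i]; last by apply: diff_derivable.
by congr (_ * _); apply: eq_bigr => i _; rewrite [RHS]mxE.
Qed.

Lemma min_value_le f x : (-oo < min_value f)%E -> fine (min_value f) <= f x.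
Proof.
move=> f0; have le_fx : (min_value f <= (f x)%:E)%E.
  by apply: ereal_inf_lbound; exists x.
rewrite -lee_fin fineK// fin_numE -ltNye f0 -ltey.
by rewrite (le_lt_trans le_fx) ?ltry.
Qed.

End smooth_functions.

(** * One-step descent *)

Section mode_linearity.
Context {R : realType} {n d : nat}.
Variables (Rm : 'M[R]_(n, n.-1)).
Implicit Types x y : 'I_n -> 'cV[R]_d.

Lemma vmodeD x y c j : vmode Rm (fun i => x i + y i) c j = vmode Rm x c j + vmode Rm y c j.
Proof.
rewrite /vmode /mode /component -big_split; apply: eq_bigr => i _.
by rewrite mxE mulrDr.
Qed.

Lemma vmodeN x c j : vmode Rm (fun i => - x i) c j = - vmode Rm x c j.
Proof.
rewrite /vmode /mode /component -sumrN; apply: eq_bigr => i _.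
by rewrite mxE mulrN.
Qed.

Lemma vmodeZ k x c j : vmode Rm (fun i => k *: x i) c j = k * vmode Rm x c j.
Proof.
rewrite /vmode /mode /component mulr_sumr; apply: eq_bigr => i _.
by rewrite mxE mulrCA.
Qed.

Lemma meanD x y : mean (fun i => x i + y i) = mean x + mean y.
Proof. by rewrite /mean big_split scalerDr. Qed.

Lemma meanN x : mean (fun i => - x i) = - mean x.
Proof. by rewrite /mean sumrN scalerN. Qed.

Lemma meanZ k x : mean (fun i => k *: x i) = k *: mean x.
Proof. by rewrite /mean -scaler_sumr !scalerA mulrC. Qed.

Variables (e : rel 'I_n) (W : 'M[R]_n) (lam : nat -> R).
Hypotheses (W_adj : weighted_adjacency e W) (W_stoch : doubly_stochastic W).
Hypotheses (L_eigen : nonzero_eigenbasis (laplacian W) lam Rm).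

Lemma vmode_laplacian x c j :
  vmode Rm (fun i => \sum_k laplacian W i k *: x k) c j = lam_mode lam j * vmode Rm x c j.
Proof.
rewrite /vmode -(mode_laplacian W_adj W_stoch L_eigen); apply: eq_bigr => i _.
congr (_ * _); rewrite /component summxE; apply: eq_bigr => k _; by rewrite mxE.
Qed.

Lemma mean_laplacian x : mean (fun i => \sum_k laplacian W i k *: x k) = 0.
Proof.
apply/matrixP => c j; rewrite ord1 mean_component [RHS]mxE.
rewrite -(avg_laplacian W_adj W_stoch (component x c)) /avg; congr (_ * _).
apply: eq_bigr => i _; rewrite /component summxE; apply: eq_bigr => k _; by rewrite mxE.
Qed.

End mode_linearity.

(** * Mode estimates with constants uniform over the spectrum *)

Section consensus_step.
Context {R : realFieldType}.

(** Returns from [p] to [w = lam p]: [lam (lam^-1 x)^2 = lam^-1 x^2] is at most [lmin^-1 x^2], while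
    increasing functions of [lam] are bounded at [lmax]. With the same coefficients on all modes,
    the sums become squared norms. *)
Lemma consensus_step (eta a zt lam lmin lmax b Phi kx h w Y xi ze s de A e xi' : R) :
  mode_params eta a zt lam b -> 0 < Phi -> 0 < lmin -> lmin <= lam -> lam <= lmax ->
  contraction_weight Phi * (zt * a * lmax) <= 1 / 12 -> kx <= zt * a / 30 ->
  mode_Q zt lam (mode_z zt lam b h Y xi + mode_dz eta a zt lam b h (lam^-1 * w) xi s)
      (lam^-1 * (w + ze + a * lam * h + de))
    + mode_Y eta a zt lam b h (lam^-1 * w) Y s A e xi' ^+ 2 + kx * (h + Y - xi) ^+ 2
  <= mode_Q zt lam (mode_z zt lam b h Y xi) (lam^-1 * w) + (1 + Phi / 2) * A ^+ 2
     + 5 / 2 * (contraction_weight Phi * (zt * a * lmax) ^+ 2) * e ^+ 2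
     + 5 * (zt * a * lmax) * Y ^+ 2
     + 3 / 2 * eta^-1 * xi ^+ 2 + 6 * eta * s ^+ 2
     + 2 / 5 * ((1 + zt) / lmin * eta^-1) * ze ^+ 2
     + 7 / 10 * ((1 + zt) / lmin * eta^-1) * de ^+ 2
     + 1 / 50 * eta^-1 * xi' ^+ 2.
Proof.
move=> params P0 lmin0 lmin_le lmax_ge Pi_le kx_le.
have [[a0 l0 z0 al0 g0] _] := mode_facts params.
have [[e0 _ l1] _] := params.
have za0 : 0 <= zt * a by rewrite mulr_ge0// ltW.
have gle : zt * a * lam <= zt * a * lmax by rewrite ler_wpM2l.
have Pi0 : 0 <= contraction_weight Phi by rewrite addr_ge0// divr_ge0// ltW.
have Pi_le' : contraction_weight Phi * (zt * a * lam) <= 1 / 12.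
  by apply: le_trans Pi_le; rewrite ler_wpM2l.
have -> : lam^-1 * (w + ze + a * lam * h + de) =
    lam^-1 * w + mode_dp a h (lam^-1 * ze) (lam^-1 * de).
  by rewrite /mode_dp; field; rewrite gt_eqF.
apply: le_trans (mode_step h (lam^-1 * w) Y xi (lam^-1 * ze) s (lam^-1 * de) A e xi'
  params P0 Pi_le' kx_le) _.
have ei0 : 0 <= eta^-1 by rewrite invr_ge0 ltW.
have eE : contraction_weight Phi * (zt * a * lam * e) ^+ 2 <=
    contraction_weight Phi * (zt * a * lmax) ^+ 2 * e ^+ 2.
  rewrite exprMn mulrA ler_wpM2r ?sqr_ge0// ler_wpM2l//.
  by apply: lerXn2r; rewrite ?nnegrE// (le_trans g0).
have YE : zt * a * lam * Y ^+ 2 <= zt * a * lmax * Y ^+ 2 by rewrite ler_wpM2r ?sqr_ge0.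
have scaled k x : 0 <= k ->
    k * ((1 + zt) * lam * (eta^-1 * (lam^-1 * x) ^+ 2)) <=
    k * ((1 + zt) / lmin * eta^-1) * x ^+ 2.
  move=> k0; have -> : k * ((1 + zt) * lam * (eta^-1 * (lam^-1 * x) ^+ 2)) =
     k * ((1 + zt) * lam^-1 * eta^-1) * x ^+ 2 by field; rewrite !gt_eqF.
  rewrite ler_wpM2r ?sqr_ge0// ler_wpM2l// ler_wpM2r// ler_wpM2l//.
    by rewrite addr_ge0// ltW.
  by rewrite lef_pV2.
have zE := @scaled (2 / 5) ze (divr_ge0 (ler0n _ 2) (ler0n _ 5)).
have dE := @scaled (7 / 10) de (divr_ge0 (ler0n _ 7) (ler0n _ 10)).
have sE : 0 <= eta * s ^+ 2 by rewrite mulr_ge0 ?sqr_ge0// ltW.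
have xE : 0 <= eta^-1 * xi ^+ 2 by rewrite mulr_ge0 ?sqr_ge0.
have xE' : 0 <= eta^-1 * xi' ^+ 2 by rewrite mulr_ge0 ?sqr_ge0.
move: eE YE sE xE xE' zE dE.
move: (contraction_weight _ * (_ * e) ^+ 2) => E.
move: ((1 + zt) * lam * (eta^-1 * (lam^-1 * ze) ^+ 2)) => Z1.
move: ((1 + zt) * lam * (eta^-1 * (lam^-1 * de) ^+ 2)) => De1.
move: ((1 + zt) / lmin * eta^-1) => c1.
move: (mode_Q _ _ _ _) (zt * a * lam) (zt * a * lmax) (contraction_weight Phi) => Q g gm Pi.
by clear; lra.
Qed.

End consensus_step.

Section average_bound.
Context {R : realFieldType}.

(** Aligns the coefficients with those of [consensus_step], so that modes and average add up to full
    norms. *)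
Lemma average_bound (eta om c0 c1 Cm Phi v G s g xi ze de A xi' : R) :
  0 < eta -> eta <= 1 / 1000 -> 29 <= om -> 0 <= c0 -> c0 <= c1 -> 2 * c1 <= om ->
  0 <= Cm -> 100 * (Cm * eta) <= 1 -> 0 < Phi ->
  300 * (contraction_weight Phi * eta) <= 1 ->
  g = om * v + G + s ->
  1 / 2 * c0 * (v + om^-1 * G + ze + de) ^+ 2
    + (G * (xi - eta * g) + Cm * (xi - eta * g) ^+ 2)
    + (A - eta * g + xi') ^+ 2 + eta / 4 * G ^+ 2
  <= 1 / 2 * c0 * (v + om^-1 * G) ^+ 2 + (1 + Phi / 2) * A ^+ 2
     + 3 / 2 * eta^-1 * xi ^+ 2 + 6 * eta * s ^+ 2
     + 2 / 5 * (c1 * eta^-1) * ze ^+ 2 + 7 / 10 * (c1 * eta^-1) * de ^+ 2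
     + 1 / 50 * eta^-1 * xi' ^+ 2 + 2 * (eta * om ^+ 2) * v ^+ 2.
Proof.
move=> e0 e3 om29 c00 c01 c1_le Cm0 Cm_le P0 Pi_le gE.
have c0_le : 2 * c0 <= om by apply: le_trans c1_le; rewrite ler_wpM2l.
apply: le_trans (average_step xi ze de A xi' e0 e3 om29 c00 c0_le Cm0 Cm_le P0 Pi_le gE) _.
have iv (x : R) : 0 <= eta^-1 * x ^+ 2.
  by apply: mulr_ge0 (sqr_ge0 _); rewrite invr_ge0 ltW.
have := ler_wpM2r (iv ze) c01; have := ler_wpM2r (iv de) c01.
rewrite exprMn; move: (eta^-1) => ie.
by clear; lra.
Qed.

End average_bound.

(** * Numerical conditions on the parameters *)

Section tuning.
Context {R : realFieldType}.

(** The interface between the parameter conditions and the descent estimates. In the application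
    [Phi] is alpha r phi and [b] is eta omega / alpha. *)
Record tuned (n : nat) (eta om zt b Lf lmin lmax Phi : R) : Prop := Tuned {
  tuned_eta : 0 < eta;
  tuned_zt : 21 / 2 <= zt;
  tuned_om : 29 <= om;
  tuned_zt_om : 2 * (1 + zt) <= om;
  tuned_lmin : 1 <= lmin <= 2;
  tuned_lmax : lmin <= lmax;
  tuned_Lf : 0 < Lf;
  tuned_Lf_om : 4 * ((1 + zt) * Lf ^+ 2) <= om * lmin;
  tuned_n : 150 * n%:R <= zt * om;
  tuned_Phi : 0 < Phi;
  tuned_step : contraction_weight Phi * (eta * (zt * om) * lmax) <= 1 / 12;
  tuned_b : 0 <= b;
  tuned_b_lmax : zt * b * lmax <= 5 / 24;
  tuned_Phi_le : Phi <= 1 }.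

(** [Cm] is the coefficient of the squared displacement of the mean: [Lf] comes from the descent
    lemma and the rest from the change of the gradients inside v + omega^-1 grad. In the bound on
    [zt (eta om) / 30], [6 eta Lf^2] pays for the gradient gap between agents and [eta n / 4] is the
    decrease to be retained. *)
Lemma tuned_consequences n eta om zt b Lf lmin lmax Phi :
  tuned n eta om zt b Lf lmin lmax Phi ->
  let c1 := (1 + zt) / lmin in
  let Cm := Lf + 7 / 10 * (c1 * eta^-1) * (Lf / om) ^+ 2 in
  [/\ forall lam, lmin <= lam -> lam <= lmax -> mode_params eta (eta * om) zt lam b,
      contraction_weight Phi * (zt * (eta * om) * lmax) <= 1 / 12,
      6 * eta * Lf ^+ 2 + eta / 4 * n%:R <= zt * (eta * om) / 30,
      eta <= 1 / 1000 & 2 * c1 <= om]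
  /\ [/\ 0 <= Cm, 100 * (Cm * eta) <= 1 & 300 * (contraction_weight Phi * eta) <= 1].
Proof.
move=> [e0 zt1 om29 zo /andP[l1 l2] lm L0 Lo nz P0 st b0 bl P1] c1 Cm.
have om0 : 0 < om by lra.
have z0 : 0 < zt by lra.
have lmin0 : 0 < lmin by lra.
have lmax1 : 1 <= lmax by lra.
have a0 : 0 < eta * om by rewrite mulr_gt0.
(* As [Phi <= 1], the weight is at least 3, so the step condition yields eta gamma lmax <= 1/36. *)
have Pi3 : 3 <= contraction_weight Phi.
  have := ler_pM _ _ P1 (lexx (2 / Phi)); rewrite divr_ge0 ?(ltW P0)// => /(_ isT isT).
  by rewrite mul1r mulrC divfK ?gt_eqF// /contraction_weight; lra.
have G0 : 0 <= eta * (zt * om) * lmax.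
  by rewrite !mulr_ge0 ?(ltW z0) ?(ltW om0) ?(ltW e0)//; lra.
have Gle : eta * (zt * om) * lmax <= 1 / 36.
  by have := ler_wpM2r G0 Pi3; lra.
have zal : 0 <= eta * (zt * om) by rewrite !mulr_ge0// ltW.
have al_le : eta * (zt * om) <= eta * (zt * om) * lmax by rewrite ler_peMr.
have ez : 21 / 2 * (eta * om) <= eta * (zt * om).
  by move: (ler_wpM2r (ltW a0) zt1); clear; lra.
have e29 : 29 * eta <= eta * om by rewrite mulrC ler_wpM2l// ltW.
(* The product 29 (21/2) eta is already at most 1/36. *)
have e3 : eta <= 1 / 1000 by move: e29 ez al_le Gle; clear; lra.
have Lom : 23 * Lf ^+ 2 <= om.
  have h1 : 23 / 2 * Lf ^+ 2 <= (1 + zt) * Lf ^+ 2.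
    by rewrite ler_wpM2r ?sqr_ge0//; lra.
  have h2 : om * lmin <= om * 2 by rewrite ler_wpM2l// ltW.
  by move: Lo h1 h2; clear; lra.
have Lf_le : 10 * Lf <= om.
  rewrite -(ler_pXn2r (_ : (0 < 2)%N)) ?nnegrE ?mulr_ge0 ?(ltW L0) ?(ltW om0)//.
  have := ler_wpM2l (ltW om0) om29; move: Lom (sqr_ge0 Lf); clear; lra.
have c1_le : 2 * c1 <= om.
  have : c1 <= 1 + zt by rewrite ler_pdivrMr// ler_peMr// addr_ge0// ltW.
  by move: zo; clear; lra.
have c10 : 0 <= c1 by apply: divr_ge0 (ltW lmin0); rewrite addr_ge0// ltW.
have c1L : 4 * (c1 * Lf ^+ 2) <= om.
  rewrite -(ler_pM2r lmin0); move: Lo; rewrite /c1.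
  by rewrite (_ : 4 * ((1 + zt) / lmin * _) * _ = 4 * ((1 + zt) * Lf ^+ 2))//; field;
    rewrite gt_eqF.
have Cm0 : 0 <= Cm.
  have k0 : 0 <= 7 / 10 * (c1 * eta^-1).
    by apply: mulr_ge0; [clear; lra|rewrite mulr_ge0// invr_ge0 ltW].
  exact: addr_ge0 (ltW L0) (mulr_ge0 k0 (sqr_ge0 _)).
split; split; [| | |exact: e3|exact: c1_le|exact: Cm0| |].
- move=> lam lam1 lam2; split; [split => //; lra|split => //; split].
  + have : eta * (zt * om) * lam <= eta * (zt * om) * lmax by rewrite ler_wpM2l.
    by move: Gle; clear; lra.
  + have zb0 : 0 <= zt * b by rewrite mulr_ge0// ltW.
    by apply: le_trans bl; rewrite ler_wpM2l.
  + exact: e29.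
  + by move: (ler_wpM2l (ltW e0) zo); clear; lra.
- by move: st; clear; lra.
- move: (ler_wpM2l (ltW e0) Lom) (ler_wpM2l (ltW e0) nz) ez a0; clear.
  by lra.
- have -> : Cm * eta = Lf * eta + 7 / 10 * (c1 * Lf ^+ 2 / om ^+ 2).
    by rewrite /Cm; field; rewrite !gt_eqF.
  have h1 : 4 * (c1 * Lf ^+ 2 / om ^+ 2) <= 1 / 29.
    rewrite mulrA ler_pdivrMr ?exprn_gt0//.
    by have := ler_wpM2l (ltW om0) om29; move: c1L; clear; lra.
  have h2 : 10 * (Lf * eta) <= eta * om.
    by move: (ler_wpM2r (ltW e0) Lf_le); clear; lra.
  by move: h1 h2 ez al_le Gle; clear; lra.
- have Pi0 : 0 <= contraction_weight Phi by lra.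
  have ze : 609 / 2 * eta <= eta * (zt * om) * lmax.
    by move: e29 ez al_le; clear; lra.
  by move: st (ler_wpM2l Pi0 ze) (mulr_ge0 Pi0 (ltW e0)); clear; lra.
Qed.

End tuning.

(** * Pathwise descent for the whole network *)

Section one_step.
Context {R : realType} {n d : nat}.
Variables (e : rel 'I_n) (W : 'M[R]_n) (lam : nat -> R) (Rm : 'M[R]_(n, n.-1)).
Hypotheses (n_gt0 : (0 < n)%N) (W_adj : weighted_adjacency e W).
Hypotheses (W_stoch : doubly_stochastic W).
Hypotheses (L_eigen : nonzero_eigenbasis (laplacian W) lam Rm).
Variables (eta om zt b alpha Lf Phi : R).
Local Notation L := (laplacian W).
Local Notation lmin := (min_pos_eigenvalue L).
Local Notation lmax := (spectral_radius L).
Hypothesis tuning : tuned n eta om zt b Lf lmin lmax Phi.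
Hypotheses (alpha_gt0 : 0 < alpha) (b_alpha : b * alpha = eta * om).
Variable f : 'I_n -> 'cV[R]_d -> R.
Hypothesis f_smooth : forall i, smooth Lf (f i).
Implicit Types x v xc xi ze Cv : 'I_n -> 'cV[R]_d.

Definition lap x : 'I_n -> 'cV[R]_d := fun i => \sum_k L i k *: x k.

Definition next_x x v xc xi Cv : 'I_n -> 'cV[R]_d := fun i =>
  x i + xi i - eta *: ((zt * om) *: lap (fun k => xc k + Cv k) i + om *: v i
                       + grad (f i) (x i)).
Definition next_v v xc ze Cv : 'I_n -> 'cV[R]_d := fun i =>
  v i + ze i + (eta * om) *: lap (fun k => xc k + Cv k) i.
Definition next_xc xc Cv : 'I_n -> 'cV[R]_d := fun i => xc i + alpha *: Cv i.

Definition residual x xc xi : 'I_n -> 'cV[R]_d := fun i => x i + xi i - xc i.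

(* Shifting x and v by multiples of L x^c removes the compression error from
   their dynamics, because C(Y_k) = (x^c_{k+1} - x^c_k) / alpha telescopes. *)
Definition shifted_x x xc : 'I_n -> 'cV[R]_d := fun i => x i + (zt * b) *: lap xc i.
Definition shifted_v x v xc : 'I_n -> 'cV[R]_d := fun i =>
  v i + om^-1 *: grad (f i) (mean x) - b *: lap xc i.

(** The Lyapunov function at the shifted variables, without its residual term. The objective is
    taken at the original mean of x, which the shift leaves unchanged because [L] has zero column
    sums. *)
Definition energy x v xc : R :=
  lyapunov_modes lam Rm zt ((1 + zt) * (lam n)^-1) (shifted_x x xc) (shifted_v x v xc)
  + n%:R * (average f (mean x) - fine (min_value (average f))).

Definition norm2 x : R := \sum_i \sum_c x i c 0 ^+ 2.

Let lam_neq0 (j : 'I_n.-1) : lam_mode lam j != 0.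
Proof. exact: lam_mode_neq0 L_eigen j. Qed.

Let zt_neq0 : zt != 0.
Proof. by have := tuned_zt tuning => zt1; rewrite gt_eqF//; lra. Qed.

Let om_gt0 : 0 < om.
Proof. by have := tuned_om tuning => om1; lra. Qed.

Lemma vmode_lap x c j : vmode Rm (fun i => lap x i) c j = lam_mode lam j * vmode Rm x c j.
Proof. exact: vmode_laplacian W_adj W_stoch L_eigen x c j. Qed.

Let vmode_linear := (@vmodeN R n d Rm, @vmodeD R n d Rm, @vmodeZ R n d Rm, vmode_lap).

Lemma shifted_x_mode x xc xi c j :
  vmode Rm (shifted_x x xc) c j =
  mode_z zt (lam_mode lam j) b (vmode Rm xc c j) (vmode Rm (residual x xc xi) c j)
    (vmode Rm xi c j).
Proof. by rewrite /shifted_x /residual !vmode_linear /mode_z; ring. Qed.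

Definition grad_gap x : 'I_n -> 'cV[R]_d := fun i => grad (f i) (x i) - grad (f i) (mean x).
Definition grad_move x x' : 'I_n -> 'cV[R]_d := fun i =>
  om^-1 *: (grad (f i) (mean x') - grad (f i) (mean x)).

(** With [b alpha = eta om] the increment of the shift cancels the contribution of C(Y), so [Cv]
    does not occur on the right. *)
Lemma next_x_mode x v xc xi Cv c j :
  let lamj := lam_mode lam j in
  vmode Rm (shifted_x (next_x x v xc xi Cv) (next_xc xc Cv)) c j =
  mode_z zt lamj b (vmode Rm xc c j) (vmode Rm (residual x xc xi) c j) (vmode Rm xi c j)
  + mode_dz eta (eta * om) zt lamj b (vmode Rm xc c j)
      (lamj^-1 * vmode Rm (shifted_v x v xc) c j) (vmode Rm xi c j)
      (vmode Rm (grad_gap x) c j).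
Proof.
move=> lamj; rewrite /shifted_x /next_xc /next_x /residual /shifted_v /grad_gap !vmode_linear
  -/lamj.
rewrite /mode_z /mode_dz /mode_u.
have -> : eta = b * alpha / om by rewrite b_alpha mulfK// gt_eqF.
by field; rewrite gt_eqF//= /lamj lam_neq0.
Qed.

Lemma next_v_mode x x' v xc ze Cv c j :
  let lamj := lam_mode lam j in
  vmode Rm (shifted_v x' (next_v v xc ze Cv) (next_xc xc Cv)) c j =
  vmode Rm (shifted_v x v xc) c j + vmode Rm ze c j
  + eta * om * lamj * vmode Rm xc c j + vmode Rm (grad_move x x') c j.
Proof.
move=> lamj; rewrite /shifted_v /next_xc /next_v /grad_move !vmode_linear -/lamj.
rewrite -b_alpha; by field; rewrite gt_eqF.
Qed.

Lemma next_residual_mode x v xc xi Cv xi' c j :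
  let lamj := lam_mode lam j in
  vmode Rm (residual (next_x x v xc xi Cv) (next_xc xc Cv) xi') c j =
  mode_Y eta (eta * om) zt lamj b (vmode Rm xc c j)
    (lamj^-1 * vmode Rm (shifted_v x v xc) c j) (vmode Rm (residual x xc xi) c j)
    (vmode Rm (grad_gap x) c j)
    (vmode Rm (fun i => residual x xc xi i - alpha *: Cv i) c j)
    (vmode Rm (fun i => Cv i - residual x xc xi i) c j) (vmode Rm xi' c j).
Proof.
move=> lamj; rewrite /shifted_v /next_xc /next_x /residual /grad_gap !vmode_linear -/lamj.
rewrite /mode_Y /mode_u.
by field; rewrite gt_eqF//= /lamj lam_neq0.
Qed.


Lemma mean_lap x : mean (fun i => lap x i) = 0.
Proof. exact: mean_laplacian W_adj W_stoch x. Qed.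

Let mean_linear := (@meanN R n d, @meanD R n d, @meanZ R n d, mean_lap).

Definition mean_grad x : 'cV[R]_d := mean (fun i => grad (f i) (mean x)).
Definition mean_move x v xi (c : 'I_d) : R :=
  mean xi c 0 - eta * (om * mean v c 0 + mean_grad x c 0 + mean (grad_gap x) c 0).

Lemma mean_next_x x v xc xi Cv c :
  mean (next_x x v xc xi Cv) c 0 = mean x c 0 + mean_move x v xi c.
Proof.
by rewrite /next_x /mean_move /mean_grad /grad_gap !mean_linear !mxE; ring.
Qed.

Lemma mean_shifted_v x v xc c :
  mean (shifted_v x v xc) c 0 = mean v c 0 + om^-1 * mean_grad x c 0.
Proof. by rewrite /shifted_v /mean_grad !mean_linear !mxE; ring. Qed.

Lemma mean_next_v x x' v xc ze Cv c :
  mean (shifted_v x' (next_v v xc ze Cv) (next_xc xc Cv)) c 0 =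
  mean v c 0 + om^-1 * mean_grad x c 0 + mean ze c 0 + mean (grad_move x x') c 0.
Proof.
rewrite mean_shifted_v /next_v /grad_move /mean_grad !mean_linear !mxE; ring.
Qed.

Lemma mean_next_residual x v xc xi Cv xi' c :
  mean (residual (next_x x v xc xi Cv) (next_xc xc Cv) xi') c 0 =
  mean (fun i => residual x xc xi i - alpha *: Cv i) c 0
  - eta * (om * mean v c 0 + mean_grad x c 0 + mean (grad_gap x) c 0) + mean xi' c 0.
Proof.
rewrite /residual /next_x /next_xc /mean_grad /grad_gap !mean_linear !mxE.
by ring.
Qed.

Definition dev2 x : R := \sum_c \sum_j vmode Rm x c j ^+ 2.
Definition mean2 x : R := \sum_c mean x c 0 ^+ 2.

Lemma norm2E x : norm2 x = dev2 x + n%:R * mean2 x.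
Proof.
rewrite /norm2 (sum_sqr_modes n_gt0 W_adj W_stoch L_eigen) /dev2 /mean2 mulr_sumr.
by rewrite -big_split.
Qed.

Lemma dev2E x : norm2 (fun i => x i - mean x) = dev2 x.
Proof.
rewrite /dev2 -(centered_norm n_gt0 W_adj W_stoch L_eigen) mean_stackE stackB.
by rewrite stack_normE.
Qed.

Let Lf_gt0 : 0 < Lf. Proof. exact: tuned_Lf tuning. Qed.

Lemma grad_gap_bound x : dev2 (grad_gap x) + n%:R * mean2 (grad_gap x) <= Lf ^+ 2 * dev2 x.
Proof.
rewrite -norm2E -dev2E /norm2 mulr_sumr; apply: ler_sum => i _.
have := smooth_grad_sqr (x i) (mean x) Lf_gt0 (f_smooth i).
have coordB (u w : 'cV[R]_d) c : (u - w) c 0 = u c 0 - w c 0 by rewrite !mxE.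
rewrite /grad_gap; under [X in _ -> X <= _]eq_bigr do rewrite coordB.
by under [X in _ -> _ <= _ * X]eq_bigr do rewrite coordB.
Qed.

Lemma grad_move_bound x x' :
  dev2 (grad_move x x') + n%:R * mean2 (grad_move x x') <=
  (Lf / om) ^+ 2 * (n%:R * \sum_c (mean x' c 0 - mean x c 0) ^+ 2).
Proof.
rewrite -norm2E /norm2 mulr_natl -[X in _ *+ X](card_ord n) -sumr_const mulr_sumr.
apply: ler_sum => i _.
rewrite exprMn mulrAC mulrC.
apply: le_trans (ler_wpM2l (sqr_ge0 om^-1)
  (smooth_grad_sqr (mean x') (mean x) Lf_gt0 (f_smooth i))).
by rewrite mulr_sumr; apply: ler_sum => c _; rewrite /grad_move !mxE exprMn.
Qed.

Lemma average_descent x x' :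
  average f (mean x') <= average f (mean x)
   + \sum_c (mean_grad x c 0 * (mean x' c 0 - mean x c 0)
             + Lf * (mean x' c 0 - mean x c 0) ^+ 2).
Proof.
have n0 : 0 < n%:R :> R by rewrite ltr0n.
rewrite -(ler_pM2l n0) mulrDr /average !mulrA mulfV ?gt_eqF// !mul1r.
rewrite big_split /= mulrDr.
have -> : n%:R * \sum_c mean_grad x c 0 * (mean x' c 0 - mean x c 0) =
   \sum_i \sum_c grad (f i) (mean x) c 0 * (mean x' c 0 - mean x c 0).
  rewrite exchange_big mulr_sumr; apply: eq_bigr => c _.
  by rewrite /mean_grad mean_component /avg /component !mulrA mulfV ?gt_eqF// mul1r mulr_suml.
rewrite mulr_natl -[X in _ *+ X](card_ord n) -sumr_const -!big_split /=.
apply: ler_sum => i _; rewrite -mulr_sumr ?addrA; exact: smooth_descent.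
Qed.


Let c0_le : 0 <= (1 + zt) * (lam n)^-1 <= (1 + zt) / lmin.
Proof.
have [lmin0 lminj] := min_pos_eigenvalue_bounds n_gt0 W_adj W_stoch L_eigen.
have n1 := network_size_gt1 n_gt0 W_adj W_stoch.
have ln : lmin <= lam n.
  (* Index n - 2 is the last mode, so [lam n] is one of the [lam_mode]. *)
  have jn : (n - 2 < n.-1)%N by rewrite -subn1 ltn_sub2l.
  by have := lminj (Ordinal jn); rewrite /lam_mode /= subnK.
have z0 : 0 <= 1 + zt by have := tuned_zt tuning; lra.
have ln0 := lt_le_trans lmin0 ln.
by rewrite mulr_ge0 ?invr_ge0 ?(ltW ln0)//= ler_wpM2l// lef_pV2.
Qed.

(** The mode bounds are summed over modes and coordinates, and the average bound over coordinates
    with factor n. Smoothness turns the gradient gap into a multiple of [dev2 x], paid by the [kx]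
    term, and the gradient move into a multiple of the squared displacement of the mean, paid by
    [Cm]. *)
Lemma one_step x v xc xi ze xi' Cv :
  energy (next_x x v xc xi Cv) (next_v v xc ze Cv) (next_xc xc Cv)
    + norm2 (residual (next_x x v xc xi Cv) (next_xc xc Cv) xi')
    + eta / 4 * (n%:R * dev2 x + n%:R * \sum_c mean_grad x c 0 ^+ 2) <=
  energy x v xc
    + (1 + Phi / 2) * norm2 (fun i => residual x xc xi i - alpha *: Cv i)
    + 5 / 2 * (contraction_weight Phi * (eta * (zt * om) * lmax) ^+ 2)
        * norm2 (fun i => Cv i - residual x xc xi i)
    + 5 * (eta * (zt * om) * lmax) * norm2 (residual x xc xi)
    + 3 / 2 * eta^-1 * norm2 xi + 2 / 5 * ((1 + zt) / lmin * eta^-1) * norm2 ze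
    + 1 / 50 * eta^-1 * norm2 xi' + 2 * (eta * om ^+ 2) * (n%:R * mean2 v).
Proof.
set Y := residual x xc xi; set c1 := (1 + zt) / lmin * eta^-1.
pose x' := next_x x v xc xi Cv; pose v' := next_v v xc ze Cv.
pose xc' := next_xc xc Cv; pose Y' := residual x' xc' xi'.
rewrite -/x' -/v' -/xc' -/Y'.
set A := fun i => Y i - _; set E := fun i => Cv i - Y i.
have [[mp Pst kx_le e3 c1_le] [Cm0 Cm_le Pe]] := tuned_consequences tuning.
have [lmin0 lminj] := min_pos_eigenvalue_bounds n_gt0 W_adj W_stoch L_eigen.
have lmaxj := spectral_radius_bound n_gt0 W_adj W_stoch L_eigen.
have e0 := tuned_eta tuning; have P0 := tuned_Phi tuning; have om29 := tuned_om tuning.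
have /andP[c00 c01] := c0_le.
set Cm := Lf + _ in Cm0 Cm_le.
set kx := 6 * eta * Lf ^+ 2 + eta / 4 * n%:R in kx_le.
pose z := shifted_x x xc; pose w := shifted_v x v xc.
pose z' := shifted_x x' xc'; pose w' := shifted_v x' v' xc'.
pose Q (z w : 'I_n -> 'cV[R]_d) := \sum_c \sum_j mode_Q zt (lam_mode lam j) (vmode Rm z c j)
  ((lam_mode lam j)^-1 * vmode Rm w c j).
have H1 : Q z' w' + dev2 Y' + kx * dev2 x <= Q z w + (1 + Phi / 2) * dev2 A
     + 5 / 2 * (contraction_weight Phi * (zt * (eta * om) * lmax) ^+ 2) * dev2 E
     + 5 * (zt * (eta * om) * lmax) * dev2 Y
     + 3 / 2 * eta^-1 * dev2 xi + 6 * eta * dev2 (grad_gap x)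
     + 2 / 5 * c1 * dev2 ze + 7 / 10 * c1 * dev2 (grad_move x x')
     + 1 / 50 * eta^-1 * dev2 xi'.
  rewrite /Q /dev2 !mulr_sumr -!big_split; apply: ler_sum => c _ /=.
  rewrite !mulr_sumr -!big_split; apply: ler_sum => j _ /=.
  have := consensus_step (vmode Rm xc c j) (vmode Rm w c j) (vmode Rm Y c j)
    (vmode Rm xi c j) (vmode Rm ze c j) (vmode Rm (grad_gap x) c j)
    (vmode Rm (grad_move x x') c j) (vmode Rm A c j) (vmode Rm E c j) (vmode Rm xi' c j)
    (mp _ (lminj j) (lmaxj j)) P0 lmin0 (lminj j) (lmaxj j) Pst kx_le.
  have -> : vmode Rm z' c j = _ := next_x_mode x v xc xi Cv c j.
  have -> : vmode Rm w' c j = _ := next_v_mode x x' v xc ze Cv c j.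
  have -> : vmode Rm Y' c j = _ := next_residual_mode x v xc xi Cv xi' c j.
  rewrite -/w -/Y -/A -/E /z (shifted_x_mode x xc xi) -/Y.
  have -> : vmode Rm x c j = vmode Rm xc c j + vmode Rm Y c j - vmode Rm xi c j.
    by rewrite /Y /residual !vmode_linear; ring.
  by [].
have H2 : 1 / 2 * ((1 + zt) * (lam n)^-1) * mean2 w'
    + \sum_c (mean_grad x c 0 * (mean x' c 0 - mean x c 0)
       + Cm * (mean x' c 0 - mean x c 0) ^+ 2)
    + mean2 Y' + eta / 4 * (\sum_c mean_grad x c 0 ^+ 2)
  <= 1 / 2 * ((1 + zt) * (lam n)^-1) * mean2 w + (1 + Phi / 2) * mean2 A
    + 3 / 2 * eta^-1 * mean2 xi + 6 * eta * mean2 (grad_gap x)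
    + 2 / 5 * c1 * mean2 ze + 7 / 10 * c1 * mean2 (grad_move x x')
    + 1 / 50 * eta^-1 * mean2 xi' + 2 * (eta * om ^+ 2) * mean2 v.
  rewrite /mean2 !mulr_sumr -!big_split; apply: ler_sum => c _ /=.
  have := average_bound (mean xi c 0) (mean ze c 0) (mean (grad_move x x') c 0)
    (mean A c 0) (mean xi' c 0) e0 e3 om29 c00 c01 c1_le Cm0 Cm_le P0 Pe
    (erefl (om * mean v c 0 + mean_grad x c 0 + mean (grad_gap x) c 0)).
  have -> : mean w' c 0 = _ := mean_next_v x x' v xc ze Cv c.
  have -> : mean x' c 0 = _ := mean_next_x x v xc xi Cv c.
  have -> : mean Y' c 0 = _ := mean_next_residual x v xc xi Cv xi' c.
  by rewrite (addrC (mean x c 0)) addrK /w mean_shifted_v /mean_move.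
have gap := grad_gap_bound x; have mv := grad_move_bound x x'.
have fx := average_descent x x'.
have n0 : 0 <= n%:R :> R by [].
have ei0 : 0 <= eta^-1 by rewrite invr_ge0 ltW.
have c10 : 0 <= c1.
  by rewrite mulr_ge0// (le_trans c00 c01).
rewrite /energy /lyapunov_modes -/z' -/w' -/z -/w !norm2E.
have QE (z0 w0 : 'I_n -> 'cV[R]_d) : \sum_c (\sum_j mode_Q zt (lam_mode lam j) (vmode Rm z0 c j)
     ((lam_mode lam j)^-1 * vmode Rm w0 c j)
     + n%:R * (1 / 2 * ((1 + zt) * (lam n)^-1) * mean w0 c 0 ^+ 2)) =
   Q z0 w0 + n%:R * (1 / 2 * ((1 + zt) * (lam n)^-1) * mean2 w0).
  by rewrite big_split /= /mean2 !mulr_sumr.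
rewrite !QE.
have {}H2 := ler_wpM2l n0 H2.
have {}fx := ler_wpM2l n0 fx.
set Sg := \sum_c mean_grad x c 0 ^+ 2 in H2 *.
move: fx H2; rewrite !big_split /= -!mulr_sumr.
set Sm := \sum_c (mean x' c 0 - mean x c 0) ^+ 2 in mv *.
set Sd := \sum_c mean_grad x c 0 * _ => fx H2.
have g1 := ler_wpM2l (_ : 0 <= 6 * eta) gap.
have g2 := ler_wpM2l (_ : 0 <= 7 / 10 * c1) mv.
have {}g1 : 6 * eta * (dev2 (grad_gap x) + n%:R * mean2 (grad_gap x)) <=
    6 * eta * (Lf ^+ 2 * dev2 x) by apply: g1; rewrite mulr_ge0// ltW.
have {}g2 : 7 / 10 * c1 * (dev2 (grad_move x x') + n%:R * mean2 (grad_move x x')) <=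
    7 / 10 * c1 * ((Lf / om) ^+ 2 * (n%:R * Sm)).
  by apply: g2; apply: mulr_ge0 c10; lra.
(* The average bound has no terms in [E] and [Y]; adding these nonnegative ones completes [dev2] to
   [norm2]. *)
have E2 : 0 <= 5 / 2 * (contraction_weight Phi * (eta * (zt * om) * lmax) ^+ 2) * (n%:R * mean2 E).
  have Pi0 : 0 <= contraction_weight Phi by rewrite addr_ge0// divr_ge0// ltW.
  have m0 : 0 <= mean2 E by rewrite sumr_ge0// => c _; rewrite sqr_ge0.
  apply: mulr_ge0 (mulr_ge0 n0 m0); apply: mulr_ge0 (mulr_ge0 Pi0 (sqr_ge0 _)).
  by rewrite divr_ge0.
have Y2 : 0 <= 5 * (eta * (zt * om) * lmax) * (n%:R * mean2 Y).
  have m0 : 0 <= mean2 Y by rewrite sumr_ge0// => c _; rewrite sqr_ge0.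
  have l0 : 0 <= lmax by rewrite (le_trans (ltW lmin0))// (tuned_lmax tuning).
  have z0 : 0 <= zt by have := tuned_zt tuning; lra.
  by rewrite !mulr_ge0// ltW.
have -> : eta * (zt * om) * lmax = zt * (eta * om) * lmax by ring.
move: E2 Y2; have -> : eta * (zt * om) * lmax = zt * (eta * om) * lmax by ring.
move: H1 H2 g1 g2 fx; rewrite /kx /Cm -/c1.
clear gap mv c10 n0 ei0.
move: (zt * (eta * om) * lmax) (contraction_weight Phi) => T Pi.
move: (Q z' w') (Q z w) (average f (mean x')) (average f (mean x)) (fine _) => Q1 Q0 f1 f0 fs.
move: (dev2 Y') (dev2 x) (dev2 A) (dev2 E) (dev2 Y) (dev2 xi) (dev2 (grad_gap x)) (dev2 ze) =>
  DY' Dx DA DE DY Dxi Dg Dze.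
move: (dev2 (grad_move x x')) (dev2 xi') => Dm Dxi'.
move: (mean2 w') (mean2 Y') (mean2 w) (mean2 A) (mean2 xi) (mean2 (grad_gap x)) => Mw' MY' Mw MA
  Mxi Mg.
move: (mean2 ze) (mean2 (grad_move x x')) (mean2 xi') (mean2 v) (mean2 E) (mean2 Y) => Mze Mm
  Mxi' Mv ME MY.
move: Sg Sm Sd (eta^-1) c1 ((Lf / om) ^+ 2) (Lf ^+ 2) ((1 + zt) * _) (n%:R) => Sg Sm Sd ie c1 Lo
  L2 c0 nn.
move: (om ^+ 2) => om2.
by lra.
Qed.

End one_step.

(** * Independence of the sources of randomness *)

Section borel_columns.
Context {R : realType} {d : nat}.

Lemma continuous_measurable_column (g : 'cV[R]_d -> R) : continuous g ->
  measurable_fun setT (g : g_sigma_algebraType (@open 'cV[R]_d) -> R).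
Proof.
move=> /continuousP cg; apply: (measurability _ (measurable_realfun.RGenOpens.measurableE R)).
move=> _ [_ [a [b ->] <-]]; rewrite setTI; apply: sub_sigma_algebra.
by apply: cg; exact: interval_open.
Qed.

(** An open set is the union of the rational boxes it contains, and there are countably many of
    these; boxes are measurable coordinate by coordinate. *)
Lemma measurable_column dT (T : measurableType dT) (h : T -> 'cV[R]_d) :
  (forall c, measurable_fun setT (fun t => h t c 0)) ->
  measurable_fun setT (h : T -> g_sigma_algebraType (@open 'cV[R]_d)).
Proof.
move=> mh; apply: (@measurability _ _ T (g_sigma_algebraType (@open 'cV[R]_d)) setT h
  (@open 'cV[R]_d)) => //.
move=> _ [A oA <-].
rewrite setTI.
pose box (q : {ffun 'I_d -> rat * rat}) : set 'cV[R]_d :=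
  [set y | forall c, ratr (q c).1 < y c 0 < ratr (q c).2].
have -> : h @^-1` A = \bigcup_q (if `[< box q `<=` A >] then h @^-1` box q else set0).
  apply/seteqP; split => t /=; last first.
    by move=> [q _]; case: asboolP => // + htq; apply.
  move=> /oA /nbhs_ballP[eps /= eps0 epsO].
  have qP (c : 'I_d) : exists q : rat * rat,
     [/\ h t c 0 - eps < ratr q.1, ratr q.1 < h t c 0, h t c 0 < ratr q.2
       & ratr q.2 < h t c 0 + eps].
    have [q1] : exists q : rat, ratr q \in `]h t c 0 - eps, h t c 0[.
      by apply: rat_in_itvoo; rewrite ltrBlDr ltrDl.
    have [q2] : exists q : rat, ratr q \in `]h t c 0, h t c 0 + eps[.
      by apply: rat_in_itvoo; rewrite ltrDl.
    by rewrite !in_itv /= => /andP[? ?] /andP[? ?]; exists (q1, q2).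
  have [q qE] := choice qP.
  have boxO : box [ffun c => q c] `<=` A.
    move=> y yq; apply: epsO; split => // c j; rewrite ord1; have := yq c;
      rewrite ffunE => /andP[y1 y2].
    have [? ? ? ?] := qE c.
    by rewrite /ball /= ltr_norml; apply/andP; split; lra.
  exists [ffun c => q c] => //; case: asboolP => // _ c; rewrite ffunE.
  by have [_ -> -> _] := qE c.
apply: countable_bigcupT_measurable => // q; case: ifP => // _.
have -> : h @^-1` box q = \bigcap_(c in [set: 'I_d])
    ((fun t => h t c 0) @^-1` `]ratr (q c).1, ratr (q c).2[%classic).
  apply/seteqP; split => t /= ht c; first by move=> _; rewrite /= in_itv /=; exact: ht.
  by have := ht c I; rewrite /= in_itv.
apply: fin_bigcap_measurable => // c _.
by rewrite -[X in measurable X]setTI; apply: mh.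
Qed.

End borel_columns.

(** * Integrating out an independent variable *)

Section independent_pair.
Context {R : realType} {d d1 d2 : measure_display} {T : measurableType d}.
Context {T1 : measurableType d1} {T2 : measurableType d2}.
Variables (P : probability T R) (X : {RV P >-> T1}) (Y : {RV P >-> T2}).
Hypothesis XY_indep : forall A B, measurable A -> measurable B ->
  P (X @^-1` A `&` Y @^-1` B) = (P (X @^-1` A) * P (Y @^-1` B))%E.

Local Open Scope ereal_scope.

(** By independence the joint law is the product of the laws. Tonelli then integrates [X] out at a
    frozen value of [Y], a form of conditioning that requires no integrability. *)
Lemma tonelli_independent (f : T1 * T2 -> \bar R) :
  measurable_fun [set: T1 * T2] f -> (forall z, 0 <= f z) ->
  \int[P]_w f (X w, Y w) =
  \int[P]_w \int[distribution P X]_s f (s, Y w).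
Proof.
move=> mf f0.
have mXY : measurable_fun setT (fun w => (X w, Y w)) by exact: measurable_fun_pair.
pose XYm : {mfun T >-> (T1 * T2)%type} := HB.pack (fun w => (X w, Y w))
  (isMeasurableFun.Build _ _ _ _ _ mXY).
pose XY : {RV P >-> (T1 * T2)%type} := XYm.
have -> : \int[P]_w f (X w, Y w) = \int[distribution P XY]_z f z.
  by rewrite ge0_integral_distribution.
rewrite (eq_measure_integral (distribution P X \x distribution P Y)); last first.
  move=> A mA _; apply/esym; exact: product_measure_unique.
rewrite fubini_tonelli2//.
rewrite (@ge0_integral_distribution _ _ _ _ _ P Y)//.
  exact: measurable_fun_fubini_tonelli_G.
by move=> y; exact: integral_ge0.
Qed.

End independent_pair.

(** * Independence of one source from all the others *)

Section independence.
Context {R : realType} {d : measure_display} {Omega : measurableType d}.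
Variables (P : probability Omega R) (I : eqType) (F : I -> set (set Omega)).
Hypotheses (F_indep : mutually_independent P F).
Hypotheses (F_measurable : forall i, F i `<=` measurable).
Hypotheses (F_setT : forall i, F i setT) (F_setI : forall i, setI_closed (F i)).
Variable a0 : I.

(* A pi-system of events that do not involve the source [a0]. *)
Definition cylinders_away : set (set Omega) :=
  [set E | exists (s : seq I) (A : I -> set Omega),
     [/\ uniq s, a0 \notin s, forall i, i \in s -> F i (A i)
       & E = \bigcap_(i in [set` s]) A i]].

Lemma cylinders_away_single i A : i != a0 -> F i A -> cylinders_away A.
Proof.
move=> ia FA; exists [:: i], (fun=> A); split => //.
- by rewrite inE eq_sym.
- by move=> j; rewrite inE => /eqP ->.
- apply/seteqP; split => w; first by move=> Aw j _.
  by move=> /(_ i); apply; rewrite /= inE.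
Qed.

Lemma cylinders_away_setI : setI_closed cylinders_away.
Proof.
move=> _ _ [s [A [us as0 FA ->]]] [s' [A' [us' as0' FA' ->]]].
pose ext (s : seq I) (A : I -> set Omega) i := if i \in s then A i else setT.
have Fext t B i : (forall i, i \in t -> F i (B i)) -> F i (ext t B i).
  by rewrite /ext; case: ifPn => // it; apply.
exists (undup (s ++ s')), (fun i => ext s A i `&` ext s' A' i); split.
- exact: undup_uniq.
- by rewrite mem_undup mem_cat negb_or as0.
- by move=> i _; apply: F_setI; exact: Fext.
- apply/seteqP; split => w.
    by move=> [As As'] i _; split; rewrite /ext; case: ifPn => // ?; [exact: As|exact: As'].
  move=> Ew; split => i /= si.
    have := Ew i; rewrite /= mem_undup mem_cat si /ext => /(_ isT)[+ _].
    by rewrite si.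
  have := Ew i; rewrite /= mem_undup mem_cat si orbT /ext => /(_ isT)[_].
  by rewrite si.
Qed.

Lemma cylinders_away_measurable : cylinders_away `<=` measurable.
Proof.
move=> _ [s [A [_ _ FA ->]]]; apply: fin_bigcap_measurable => //.
by move=> i si; apply: F_measurable; exact: FA.
Qed.

(** Dynkin's argument: the product formula holds on the pi-system of cylinders, by mutual
    independence with [a0] added to the indices, and the events satisfying it form a Dynkin
    system. *)
Lemma independent_away B E : F a0 B -> <<s cylinders_away >> E ->
  P (B `&` E) = (P B * P E)%E.
Proof.
move=> FB; have mB := F_measurable FB.
have PBfin : P B \is a fin_num by exact: fin_num_measure.
rewrite -(setI_closed_g_dynkin_g_sigma_algebra cylinders_away_setI).
pose H := [set E | measurable E /\ P (B `&` E) = (P B * P E)%E].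
suff sH : <<d cylinders_away >> `<=` H by move=> /sH [].
apply: smallest_sub; last first.
  move=> E' cE'; split; first exact: cylinders_away_measurable.
  case: cE' => s [A [us as0 FA ->]].
  pose A' i := if i == a0 then B else A i.
  have e1 : P (\bigcap_(i in [set` a0 :: s]) A' i) = (\prod_(i <- a0 :: s) P (A' i))%E.
    apply: F_indep => [|i]; first by rewrite /= as0 us.
    rewrite inE /A'; case: eqP => [->//|_ /= si]; exact: FA.
  have -> : B `&` \bigcap_(i in [set` s]) A i = \bigcap_(i in [set` a0 :: s]) A' i.
    apply/seteqP; split => w.
      move=> [Bw Aw] i /=; rewrite inE /A'; case: eqP => //= _ si; exact: Aw.
    move=> A'w; split.
      by have := A'w a0; rewrite /A' eqxx; apply; rewrite /= inE eqxx.
    move=> i /= si; have := A'w i; rewrite /A' ifN; first by apply; rewrite /= inE si orbT.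
    by apply/eqP => ia; rewrite -ia si in as0.
  rewrite e1 (F_indep us FA) big_cons /A' eqxx; congr (_ * _)%E.
  rewrite !big_seq; apply: eq_bigr => i si; rewrite ifN//.
  by apply/eqP => ia; rewrite -ia si in as0.
split.
- by split; rewrite ?setIT ?probability_setT ?mule1.
- move=> E' [mE' PE']; split; first exact: measurableC.
  rewrite -setDE measureD//; last by rewrite ltey_eq PBfin.
  transitivity (P B - P B * P E')%E; first by congr (_ - _)%E; exact: PE'.
  have -> : P (~` E') = (1 - P E')%E by exact: probability_setC.
  have : P E' \is a fin_num by exact: fin_num_measure.
  case: (P B) PBfin => // x _; case: (P E') => // y _.
  have -> : (1 - y%:E)%E = (1 - y)%:E by [].
  by rewrite -!EFinM -EFinB mulrBr mulr1.
- move=> G tG HG; have mG i : measurable (G i) by have [] := HG i.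
  split; first exact: bigcupT_measurable.
  rewrite setI_bigcupr !measure_bigcup//; last 2 first.
  + by move=> i _; exact: measurableI.
  + exact: trivIset_setIl.
  rewrite -(fineK PBfin) -nneseriesZl//; apply: eq_eseriesr => i _.
  by rewrite fineK//; have [] := HG i.
Qed.

End independence.

(** * The Laplace law *)

Section densities.
Context {R : realType}.
Variables (nu : {measure set (measurableTypeR R) -> \bar R}) (p : R -> R).
Hypotheses (p_ge0 : forall x, 0 <= p x) (p_meas : measurable_fun setT p).
Local Notation leb := (@lebesgue_measure R).
Hypothesis nuE : forall A : set R, measurable A -> nu A = (\int[leb]_(x in A) (p x)%:E)%E.
Local Open Scope ereal_scope.

Let integral_indic_density (A : set R) : measurable A ->
  \int[nu]_x (\1_A x)%:E = \int[leb]_x ((\1_A x)%:E * (p x)%:E).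
Proof.
move=> mA; rewrite integral_indic// setIT nuE// integral_mkcond.
apply: eq_integral => x _; rewrite patchE indicE.
by case: (x \in A); rewrite ?mul1e ?mul0e.
Qed.

Import HBNNSimple.

Let integral_nnsfun_density (f : {nnsfun (measurableTypeR R) >-> R}) :
  \int[nu]_x (f x)%:E = \int[leb]_x ((f x)%:E * (p x)%:E).
Proof.
under [LHS]eq_integral do rewrite fimfunE -fsumEFin//.
rewrite [LHS]ge0_integral_fsum//; last 2 first.
  - by move=> r; exact/measurable_EFinP/measurableT_comp.
  - by move=> n x _; rewrite EFinM nnfun_muleindic_ge0.
under [RHS]eq_integral.
  move=> x xD; rewrite fimfunE -fsumEFin// muleC ge0_mule_fsumr; last first.
    by move=> r; rewrite EFinM nnfun_muleindic_ge0.
  over.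
rewrite [RHS]ge0_integral_fsum//; last 2 first.
  - move=> r; apply: emeasurable_funM; first exact/measurable_EFinP.
    by apply/measurable_EFinP; exact/measurableT_comp.
  - move=> n x _; rewrite mule_ge0 ?lee_fin//.
    by have := nnfun_muleindic_ge0 f n x; rewrite -EFinM lee_fin.
apply: eq_fsbigr => r _.
rewrite integralZl_indic_nnsfun//= integral_indic_density//.
have [r0|r0] := ltP r 0%R.
  rewrite preimage_nnfun0// !integral0_eq ?mule0// => x _; rewrite indicE in_set0.
    by rewrite mulr0 mule0.
  by rewrite mul0e.
rewrite -ge0_integralZl//; last 2 first.
- apply: emeasurable_funM; last exact/measurable_EFinP.
  exact/measurable_EFinP.
- by move=> x _; rewrite mule_ge0 ?lee_fin.
- by apply: eq_integral => x _; rewrite EFinM muleA muleC.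
- by rewrite -[X in measurable X]setTI;
  exact: (@measurable_funPT _ _ _ _ f measurableT _ (measurable_set1 r)).
Qed.

(** [laplace_law] prescribes only probabilities of Borel sets; simple functions and monotone
    convergence extend the formula to nonnegative functions. *)
Lemma integral_density (f : R -> \bar R) : measurable_fun setT f -> (forall x, 0 <= f x) ->
  \int[nu]_x f x = \int[leb]_x (f x * (p x)%:E).
Proof.
move=> mf f0.
pose f_ := nnsfun_approx (measurableT : measurable [set: measurableTypeR R]) mf.
have mfp n : measurable_fun setT (fun x => (f_ n x)%:E * (p x)%:E).
  apply: emeasurable_funM; last exact/measurable_EFinP.
  exact/measurable_EFinP.
transitivity (lim (\int[nu]_x (f_ n x)%:E @[n --> \oo])).
  rewrite -monotone_convergence//=.
  - apply: eq_integral => ? _; apply/esym/cvg_lim => //=.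
    exact: cvg_nnsfun_approx.
  - by move=> n; exact/measurable_EFinP/measurable_funTS.
  - by move=> n ? _; rewrite lee_fin.
  - by move=> ? _ ? ? mn; rewrite lee_fin; exact/lefP/nd_nnsfun_approx.
transitivity (lim (\int[leb]_x ((f_ n x)%:E * (p x)%:E) @[n --> \oo])).
  by apply: congr_lim; apply/funext => n /=; exact: integral_nnsfun_density.
rewrite -monotone_convergence//=.
- apply: eq_integral => x _; apply/cvg_lim => //=.
  by apply: cvgeZr => //; exact: cvg_nnsfun_approx.
- by move=> n x _; rewrite mule_ge0 ?lee_fin.
- move=> x _ m n mn; rewrite lee_wpmul2r ?lee_fin//.
  exact/lefP/nd_nnsfun_approx.
Qed.

End densities.

(** * Second moment and symmetry of the Laplace law *)

Section laplace.
Context {R : realType}.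
Variables (theta : R) (theta_gt0 : 0 < theta).
Local Notation pdf := (laplace_pdf theta).

Lemma laplace_pdf_ge0 x : 0 <= pdf x.
Proof. by rewrite mulr_ge0 ?expR_ge0// invr_ge0 mulr_ge0// ltW. Qed.

Lemma continuous_laplace_pdf : continuous pdf.
Proof.
move=> x; rewrite /laplace_pdf; apply: cvgM; first exact: cvg_cst.
apply: continuous_comp; last exact: continuous_expR.
apply: cvgN; apply: cvgM; last exact: cvg_cst.
exact: norm_continuous.
Qed.

Lemma measurable_laplace_pdf : measurable_fun setT pdf.
Proof. exact: continuous_measurable_fun continuous_laplace_pdf. Qed.

(** On x >= 0 this is a primitive of x^2 times the density. It tends to 0 at infinity and equals
    -theta^2 at 0, so the half-line contributes theta^2. *)
Let antider (x : R) := - ((x ^+ 2 / 2 + theta * x + theta ^+ 2) * expR (- theta^-1 * x)).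

Let is_derive_antider (x : R) : is_derive x 1 antider (x ^+ 2 * ((2 * theta)^-1 * expR (-
  theta^-1 * x))).
Proof.
have dl : is_derive x 1 ( *%R (- theta^-1)) (- theta^-1).
  by apply: is_derive_eq; rewrite /GRing.scale /= mulr1.
have de := is_derive1_comp (is_derive_expR (- theta^-1 * x)) dl.
have dq : is_derive x 1 (fun x => x ^+ 2 / 2 + theta * x + theta ^+ 2) (x + theta).
  by apply: is_derive_eq; rewrite /GRing.scale /=; field.
have d := is_deriveN (is_deriveM dq de).
apply: (is_derive_eq (df := _) d); rewrite /GRing.scale /=; field; exact: lt0r_neq0.
Qed.

Let antider_cvg : antider x @[x --> +oo] --> (0 : R).
Proof.
apply/cvgrPdist_le => e e0; near=> x.
have x1 : 1 <= x by near: x; apply: nbhs_pinfty_ge; exact: num_real.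
have x0 : 0 < x by rewrite (lt_le_trans _ x1).
(* For x >= 1 the polynomial is at most (1 + theta + theta^2) x^2 and the exponential at least (x /
   theta)^3 / 6, so the quotient is at most K / x. *)
set K := (1 + theta + theta ^+ 2) * (6 * theta ^+ 3).
have K0 : 0 < K by rewrite mulr_gt0 ?mulr_gt0 ?exprn_gt0// !addr_gt0 ?exprn_gt0.
have xK : K / e <= x by near: x; apply: nbhs_pinfty_ge; exact: num_real.
rewrite sub0r opprK ger0_norm; last first.
  apply: mulr_ge0 (expR_ge0 _); have := mulr_gt0 theta_gt0 x0.
  by have := sqr_ge0 x; have := sqr_ge0 theta; lra.
have xt0 : 0 <= theta^-1 * x by rewrite ltW// mulr_gt0 ?invr_gt0.
rewrite mulNr expRN.
have h1 : (theta^-1 * x) ^+ 3 / 6 <= expR (theta^-1 * x).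
  by apply: le_trans (expR_ge1Dxn 2 xt0); rewrite lerDr ?ler01.
have h2 : x ^+ 2 / 2 + theta * x + theta ^+ 2 <= (1 + theta + theta ^+ 2) * x ^+ 2.
  have a : x <= x ^+ 2 by rewrite expr2 ler_peMr// ltW.
  have b : 1 <= x ^+ 2 by rewrite (le_trans x1).
  have := ler_wpM2l (ltW theta_gt0) a; have := ler_wpM2l (sqr_ge0 theta) b.
  by move: b; lra.
rewrite ler_pdivrMr ?expR_gt0//; apply: (le_trans h2).
apply: le_trans (_ : e * ((theta^-1 * x) ^+ 3 / 6) <= _); last by rewrite ler_wpM2l// ltW.
rewrite ler_pdivrMr// in xK.
have -> : e * ((theta^-1 * x) ^+ 3 / 6) = x * e * (x ^+ 2 / (6 * theta ^+ 3)).
  by field; rewrite gt_eqF.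
have -> : (1 + theta + theta ^+ 2) * x ^+ 2 = K * (x ^+ 2 / (6 * theta ^+ 3)).
  by rewrite /K; field; rewrite gt_eqF.
by rewrite ler_wpM2r// divr_ge0 ?sqr_ge0// mulr_ge0 ?exprn_ge0// ltW.
Unshelve. all: end_near. Qed.

Lemma laplace_second_moment :
  (\int[lebesgue_measure]_x ((x ^+ 2)%:E * (pdf x)%:E) = (2 * theta ^+ 2)%:E)%E.
Proof.
under eq_integral do rewrite -EFinM.
have sqM : continuous (fun x : R => x ^+ 2 * pdf x).
  move=> x; apply: cvgM; last exact: continuous_laplace_pdf.
  exact: exprn_continuous.
rewrite ge0_symfun_integralT//; last 2 first.
- by move=> x; rewrite mulr_ge0 ?sqr_ge0 ?laplace_pdf_ge0.
- by move=> x; rewrite /= sqrrN /laplace_pdf normrN.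
have -> : [set x : R | 0 <= x] = `[0%R, +oo[%classic.
  by apply/seteqP; split => x /=; rewrite in_itv /= andbT.
rewrite (@ge0_continuous_FTC2y _ _ antider 0 0).
- have -> : antider 0 = - theta ^+ 2.
    by rewrite /antider !mulr0 expR0 expr0n /= mul0r !add0r mulr1.
  by rewrite EFinN oppeK add0e -EFinM.
- by move=> x _; rewrite mulr_ge0 ?sqr_ge0 ?laplace_pdf_ge0.
- exact: continuous_subspaceT.
- exact: antider_cvg.
- by move=> x _; exact: ex_derive.
- apply: cvg_at_right_filter; apply: differentiable_continuous.
  by apply/derivable1_diffP; exact: ex_derive.
- move=> x; rewrite in_itv /= andbT => x0;
  rewrite derive1E (@derive_val _ _ _ _ _ _ _ (is_derive_antider x)).
  by rewrite /laplace_pdf gtr0_norm// mulNr (mulrC theta^-1 x).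
Qed.

Context {dO : measure_display} {Omega : measurableType dO}.
Variables (P : probability Omega R) (X : {RV P >-> R}).
Hypothesis X_law : laplace_law X theta.

Lemma laplace_law_integral (f : R -> \bar R) : measurable_fun setT f ->
  (forall x, 0 <= f x)%E ->
  (\int[P]_w f (X w) = \int[lebesgue_measure]_x (f x * (pdf x)%:E))%E.
Proof.
move=> mf f0.
have mX : measurable_fun setT (X : Omega -> measurableTypeR R).
  by move=> mT A mA; exact: (@measurable_funPT _ _ _ _ X mT A mA).
pose X' : {RV P >-> measurableTypeR R} :=
  (HB.pack (X : Omega -> measurableTypeR R)
    (isMeasurableFun.Build _ _ _ _ _ mX) : {mfun Omega >-> measurableTypeR R}).
rewrite -(@integral_density _ (distribution P X') pdf laplace_pdf_ge0
  measurable_laplace_pdf X_law f)//.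
by rewrite ge0_integral_distribution.
Qed.

Lemma laplace_law_sqr : (\int[P]_w ((X w) ^+ 2)%:E = (2 * theta ^+ 2)%:E)%E.
Proof.
rewrite -laplace_second_moment.
apply: (@laplace_law_integral (fun x => (x ^+ 2)%:E)) => [|x]; last by rewrite lee_fin sqr_ge0.
by apply/measurable_EFinP; exact: exprn_measurable.
Qed.

(** The density is even and Lebesgue measure is invariant under reflection. *)
Lemma laplace_law_sym (f : R -> \bar R) : measurable_fun setT f -> (forall x, 0 <= f x)%E ->
  (\int[P]_w f (X w) = \int[P]_w f (- X w)%R)%E.
Proof.
move=> mf f0.
have mN : measurable_fun setT (fun x : R => f (- x)).
  by apply: (measurableT_comp mf); exact: oppr_measurable.
rewrite laplace_law_integral// (@laplace_law_integral (fun x : R => f (- x)))//.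
have mh : measurable_fun setT (fun x => f x * (pdf x)%:E)%E.
  apply: emeasurable_funM => //; apply/measurable_EFinP; exact: measurable_laplace_pdf.
have -> : (\int[lebesgue_measure]_x (f (- x)%R * (pdf x)%:E) =
    \int[lebesgue_measure]_x ((fun x => f x * (pdf x)%:E) \o -%R) x)%E.
  by apply: eq_integral => x _ /=; rewrite /laplace_pdf normrN.
rewrite -[setT in RHS](preimage_setT (-%R : R -> measurableTypeR R)).
rewrite -(@ge0_integral_pushforward _ _ (measurableTypeR R) (measurableTypeR R)) //=.
- by apply: eq_measure_integral => A mA _; exact/esym/lebesgue_measureN.
- by move=> x _; rewrite mule_ge0// lee_fin laplace_pdf_ge0.
Qed.

End laplace.

(** * Sums of symmetric variables *)

Lemma norm_le_l2norm {R : realType} m (y : 'cV[R]_m) : `|y| <= l2norm y.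
Proof.
rewrite /Num.norm /= mx_normrE; apply: bigmax_le => [|[i j] _ /=]; first exact: sqrtr_ge0.
rewrite -(@ler_pXn2r _ 2) ?nnegrE ?sqrtr_ge0// l2norm_sqr real_normK ?num_real// ord1.
by rewrite (bigD1 i)//= lerDl; apply: sumr_ge0 => p _; exact: sqr_ge0.
Qed.

Section integral_domination.
Context {R : realType} {d : measure_display} {T : measurableType d}.
Variable mu : {measure set T -> \bar R}.

(* The integral of a nonnegative function is a supremum over simple functions, so
   that no measurability is required. *)
Lemma ge0_le_integral_nonmeasurable (f g : T -> \bar R) : (forall x, 0 <= f x)%E ->
  (forall x, f x <= g x)%E -> (\int[mu]_x f x <= \int[mu]_x g x)%E.
Proof.
move=> f0 fg; have g0 x : (0 <= g x)%E by exact: le_trans (fg x).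
rewrite !ge0_integralTE//; apply: le_ereal_sup => _ [h hf <-].
by exists h => // x; exact: le_trans (fg x).
Qed.

End integral_domination.

(** * Second moments of the partial sums and of the infinite sum *)

Section second_moment_limit.
Context {R : realType} {dO : measure_display} {Omega : measurableType dO}.
Variables (P : probability Omega R) (m : nat) (s : nat -> Omega -> 'cV[R]_m).
Hypothesis s_meas : forall t p, measurable_fun setT (fun w => s t w p 0).
Variables (K rho : R).
Hypotheses (K_ge0 : 0 <= K) (rho_gt0 : 0 < rho) (rho_lt1 : rho < 1).
Hypothesis s_bound : forall t,
  (\int[P]_w ((l2norm (s t w)) ^+ 2)%:E <= (K * rho ^+ (2 * t))%:E)%E.
Let S N w := \sum_(0 <= t < N) s t w.
Variable k : nat.
Hypothesis S_mono : forall N, (k <= N)%N ->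
  (\int[P]_w ((l2norm (S k w)) ^+ 2)%:E <= \int[P]_w ((l2norm (S N w)) ^+ 2)%:E)%E.

(** The weight [rho^-t] spends half of the decay [rho^(2t)] of the second moments: the means of the
    [a t] remain summable, so that [G] is integrable. *)
Let a t w : \bar R := (rho ^- t * l2norm (s t w) ^+ 2)%:E.
Let G w : \bar R := (\sum_(0 <= t <oo) a t w)%E.

Let sqr_meas (y : Omega -> 'cV[R]_m) : (forall p, measurable_fun setT (fun w => y w p 0)) ->
  measurable_fun setT (fun w => l2norm (y w) ^+ 2).
Proof.
move=> my; under eq_fun do rewrite l2norm_sqr.
by apply: measurable_sum => p; exact: measurable_funX.
Qed.

Let a_ge0 t w : (0 <= a t w)%E.
Proof. by rewrite lee_fin mulr_ge0 ?sqr_ge0// invr_ge0 exprn_ge0// ltW. Qed.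

Let a_meas t : measurable_fun setT (a t).
Proof. by apply/measurable_EFinP; apply: measurable_funM => //; exact: sqr_meas. Qed.

Let G_ge0 w : (0 <= G w)%E.
Proof. exact: nneseries_ge0. Qed.

Let G_meas : measurable_fun setT G.
Proof. exact: ge0_emeasurable_sum. Qed.

Let geometric_le N : \sum_(0 <= t < N) rho ^+ t <= (1 - rho)^-1.
Proof.
have r1 : 0 < 1 - rho by rewrite subr_gt0.
rewrite -[leRHS]mul1r ler_pdivlMr//.
have -> : (\sum_(0 <= t < N) rho ^+ t) * (1 - rho) = 1 - rho ^+ N.
  elim: N => [|N IH]; first by rewrite big_geq// mul0r expr0 subrr.
  by rewrite big_nat_recr//= mulrDl IH exprS; ring.
by rewrite gerBl exprn_ge0// ltW.
Qed.

Let G_integrable : P.-integrable setT G.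
Proof.
apply/integrableP; split=> //.
under eq_integral do rewrite gee0_abs//.
rewrite /G integral_nneseries//.
apply: (@le_lt_trans _ _ (K / (1 - rho))%:E); last exact: ltry.
apply: (@lime_le _ _ _ _).
  by apply: is_cvg_nneseries => n _ _; exact: integral_ge0.
apply: nearW => N.
apply: (@le_trans _ _ (\sum_(0 <= t < N) (K * rho ^+ t)%:E)%E).
  apply: lee_sum => t _; rewrite /a.
  under eq_integral do rewrite EFinM.
  rewrite ge0_integralZl//; last 3 first.
  - by apply/measurable_EFinP; exact: sqr_meas.
  - by move=> w _; rewrite lee_fin sqr_ge0.
  - by rewrite lee_fin invr_ge0 exprn_ge0// ltW.
  apply: (@le_trans _ _ ((rho ^- t)%:E * (K * rho ^+ (2 * t))%:E)%E).
    by rewrite lee_wpmul2l// lee_fin invr_ge0 exprn_ge0// ltW.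
  rewrite -EFinM lee_fin mul2n -addnn exprD mulrCA (mulrA _^-1) mulVf ?mul1r//.
  by rewrite expf_neq0// gt_eqF.
rewrite sumEFin lee_fin -mulr_sumr ler_wpM2l//; exact: geometric_le.
Qed.

Let S_sqr_le N w : l2norm (S N w) ^+ 2 <=
  (\sum_(0 <= t < N) rho ^+ t) * \sum_(0 <= t < N) rho ^- t * l2norm (s t w) ^+ 2.
Proof.
have cs (q : 'I_m) : (S N w q 0) ^+ 2 <=
    (\sum_(0 <= t < N) rho ^+ t) * \sum_(0 <= t < N) rho ^- t * (s t w q 0) ^+ 2.
  rewrite /S; elim: N => [|N IH]; first by rewrite !big_geq// mxE expr0n mul0r.
  rewrite !big_nat_recr//= mxE; set A := _ q 0 in IH *; set x := s N w q 0.
  set c := \sum_(0 <= t < N) rho ^+ t in IH *.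
  set g := \sum_(0 <= t < N) _ in IH *.
  have c0 : 0 <= c by apply: sumr_ge0 => t _; rewrite exprn_ge0// ltW.
  have g0 : 0 <= g.
    by apply: sumr_ge0 => t _; rewrite mulr_ge0 ?sqr_ge0// invr_ge0 exprn_ge0// ltW.
  have r0 : 0 < rho ^+ N by rewrite exprn_gt0.
  have -> : (c + rho ^+ N) * (g + rho ^- N * x ^+ 2) =
      c * g + (rho ^+ N * g + rho ^- N * (c * x ^+ 2)) + x ^+ 2.
    by field; rewrite gt_eqF.
  (* Arithmetic-geometric mean inequality: the square of [A x] is at most the product of the two
     terms on the right. *)
  have : 2 * (A * x) <= rho ^+ N * g + rho ^- N * (c * x ^+ 2).
    have u0 : 0 <= rho ^+ N * g by rewrite mulr_ge0// ltW.
    have v0 : 0 <= rho ^- N * (c * x ^+ 2).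
      by rewrite mulr_ge0 ?invr_ge0 ?(ltW r0)// mulr_ge0 ?sqr_ge0.
    have uv : (rho ^+ N * g) * (rho ^- N * (c * x ^+ 2)) = c * g * x ^+ 2.
      by field; rewrite gt_eqF.
    have xA : (A * x) ^+ 2 <= c * g * x ^+ 2 by rewrite exprMn ler_wpM2r ?sqr_ge0.
    move: u0 v0 uv; move: (rho ^+ N * g) (rho ^- N * _) => u v u0 v0 uv.
    apply: le_trans (ler_norm _) _; rewrite -[leRHS]ger0_norm ?addr_ge0//.
    rewrite -ler_sqr ?nnegrE// !real_normK ?num_real//.
    by have := sqr_ge0 (u - v); move: xA; rewrite -uv; nra.
  by move: IH; nra.
rewrite l2norm_sqr; apply: le_trans (ler_sum _ (fun q _ => cs q)) _.
rewrite -mulr_sumr exchange_big /= le_eqVlt; apply/orP; left; apply/eqP.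
by congr (_ * _); apply: eq_bigr => t _; rewrite -mulr_sumr l2norm_sqr.
Qed.

(* Cauchy-Schwarz with the weights [rho ^+ t] gives an integrable bound that is
   uniform in [N], because the second moments decay like [rho ^+ (2 * t)]. *)
Let S_sqr_dominated N w : ((l2norm (S N w) ^+ 2)%:E <= (1 - rho)^-1%:E * G w)%E.
Proof.
have r1 : 0 <= (1 - rho)^-1 by rewrite invr_ge0 subr_ge0 ltW.
apply: (@le_trans _ _ ((1 - rho)^-1%:E * \sum_(0 <= t < N) a t w)%E); last first.
  by rewrite lee_wpmul2l//; exact: nneseries_lim_ge.
rewrite sumEFin -EFinM lee_fin; apply: le_trans (S_sqr_le N w) _.
apply: ler_wpM2r (geometric_le N).
by apply: sumr_ge0 => t _; rewrite mulr_ge0 ?sqr_ge0// invr_ge0 exprn_ge0// ltW.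
Qed.

(** Since rho^t + rho^-t l^2 >= 2 l, finiteness of [G w] gives absolute convergence of the
    series. *)
Let S_cvg w : (G w < +oo)%E -> cvgn (S ^~ w).
Proof.
move=> Gw; have -> : S ^~ w = series (s ^~ w) by [].
suff /cauchy_cvgP/cauchy_seriesP u_cvg : cvgn [normed series (s ^~ w)].
  apply/cauchy_cvgP/cauchy_seriesP => e /u_cvg; apply: filterS => N /=.
  by rewrite ger0_norm ?sumr_ge0//; apply: le_lt_trans; exact: ler_norm_sum.
apply: nondecreasing_is_cvgn; first by apply: nondecreasing_series => *; exact: normr_ge0.
exists ((1 - rho)^-1 + fine (G w)) => _ [N _ <-].
have Gfin : G w \is a fin_num by rewrite ge0_fin_numE.
apply: (@le_trans _ _ (\sum_(0 <= t < N) (rho ^+ t + rho ^- t * l2norm (s t w) ^+ 2))).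
  apply: ler_sum => t _; apply: le_trans (norm_le_l2norm _) _.
  have r0 : 0 < rho ^+ t by rewrite exprn_gt0.
  have l0 : 0 <= l2norm (s t w) by exact: sqrtr_ge0.
  have -> : rho ^+ t + rho ^- t * l2norm (s t w) ^+ 2 =
      rho ^- t * (rho ^+ t - l2norm (s t w)) ^+ 2 + 2 * l2norm (s t w).
    by field; rewrite gt_eqF.
  have i0 : 0 <= rho ^- t by rewrite invr_ge0 ltW.
  by have := mulr_ge0 i0 (sqr_ge0 (rho ^+ t - l2norm (s t w))); move: l0; lra.
rewrite big_split /=; apply: lerD; first exact: geometric_le.
rewrite -lee_fin fineK// -sumEFin; exact: (@nneseries_lim_ge _ (a ^~ w) xpredT).
Qed.

Let l2norm_sqr_continuous : continuous (fun y : 'cV[R]_m => l2norm y ^+ 2).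
Proof.
have -> : (fun y : 'cV[R]_m => l2norm y ^+ 2) = (fun y => \sum_i y i 0 ^+ 2).
  by apply/funext => y; rewrite l2norm_sqr.
apply: continuous_big; first exact: add_continuous.
move=> i _ y.
apply: (@continuous_comp _ _ _ (fun z : 'cV[R]_m => z i 0) (fun z => z ^+ 2)).
  exact: coord_continuous.
exact: exprn_continuous.
Qed.

Let D := [set w | (G w < +oo)%E].

Let D_meas : measurable D.
Proof.
have -> : D = G @^-1` [set y | (y < +oo)%E] by [].
rewrite -[X in measurable X]setTI; apply: G_meas => //.
have -> : [set y : \bar R | (y < +oo)%E] = ~` [set +oo%E].
  by apply/seteqP; split => y /=; rewrite ltey => /eqP.
exact: measurableC.
Qed.

Let S_meas N p : measurable_fun setT (fun w => S N w p 0).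
Proof. by under eq_fun do rewrite summxE; exact: measurable_sum. Qed.

Lemma second_moment_limit :
  (\int[P]_w (l2norm (S k w) ^+ 2)%:E <= \int[P]_w (l2norm (limn (S ^~ w)) ^+ 2)%:E)%E.
Proof.
(* Where [G] is infinite, the limit may not exist and [limn] may be a default value. The cut-off
   limit [h] is a pointwise limit of measurable functions and lies below the integrand on the right
   everywhere. *)
pose h w : \bar R := (l2norm (limn (S ^~ w)) ^+ 2 * \1_D w)%:E.
have hS w : D w -> (fun N => (l2norm (S N w) ^+ 2)%:E) @ \oo --> h w.
  move=> Dw; apply: cvg_EFin; first by apply: nearW.
  rewrite /h indicE mem_set//= mulr1.
  apply: (@continuous_cvg _ _ _ _ _ _ (fun y : 'cV[R]_m => l2norm y ^+ 2)).
    exact: l2norm_sqr_continuous.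
  exact: S_cvg.
have mS N : measurable_fun setT (fun w => (l2norm (S N w) ^+ 2)%:E).
  by apply/measurable_EFinP; apply: sqr_meas => p; exact: S_meas.
have mh : measurable_fun setT h.
  pose hN N w : \bar R := (l2norm (S N w) ^+ 2 * \1_D w)%:E.
  apply: (@emeasurable_fun_cvg _ _ _ _ hN) => [N|w _].
    apply/measurable_EFinP; apply: measurable_funM; last exact: measurable_indic.
    by apply: sqr_meas => p; exact: S_meas.
  have [Dw|Dw] := pselect (D w).
    rewrite (_ : hN ^~ w = fun N => (l2norm (S N w) ^+ 2)%:E); first exact: hS.
    by apply/funext => N; rewrite /hN indicE mem_set// mulr1.
  rewrite /hN /h indicE memNset//= mulr0 (_ : (fun=> _) = cst 0%E); first exact: cvg_cst.
  by apply/funext => N; rewrite mulr0.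
have DP : {ae P, forall w, D w}.
  apply: filterS (integrable_ae measurableT G_integrable) => w /(_ I).
  by rewrite /D /= ge0_fin_numE.
have [] := @dominated_convergence _ _ _ P setT measurableT _ h
  (fun w => ((1 - rho)^-1%:E * G w)%E) mS mh.
- by apply: filterS DP => w Dw _; exact: hS.
- by apply: integrableZl.
- by apply: aeW => w N _; rewrite gee0_abs ?lee_fin ?sqr_ge0//; exact: S_sqr_dominated.
move=> _ _ cS; apply: (@le_trans _ _ (\int[P]_w h w)%E).
  rewrite -(cvg_lim _ cS)//; apply: lime_ge; first by apply/cvg_ex; exists (\int[P]_w h w)%E.
  by exists k => // N /= kN; exact: S_mono.
apply: ge0_le_integral_nonmeasurable => w; first by rewrite lee_fin mulr_ge0 ?sqr_ge0.
by rewrite lee_fin ler_piMr ?sqr_ge0// indicE; case: (_ \in _).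
Qed.

End second_moment_limit.

(** * Second moments of sums of independent symmetric variables *)

Section symmetric_sums.
Context {R : realType} {d : measure_display} {Omega : measurableType d}.
Variables (P : probability Omega R) (I : eqType) (F : I -> set (set Omega)).
Hypotheses (F_indep : mutually_independent P F).
Hypotheses (F_measurable : forall i, F i `<=` measurable).
Hypotheses (F_setT : forall i, F i setT) (F_setI : forall i, setI_closed (F i)).

Local Notation away a := (g_sigma_algebraType (cylinders_away F a)).

Lemma measurable_away_measurable a dT (T : measurableType dT) (Y : Omega -> T) :
  measurable_fun setT (Y : away a -> T) -> measurable_fun setT Y.
Proof.
move=> mY _ B mB; have := mY measurableT B mB.
apply: smallest_sub; first exact: sigma_algebra_measurable.
exact: cylinders_away_measurable.
Qed.

Lemma independent_of_away a dT1 dT2 (T1 : measurableType dT1) (T2 : measurableType dT2)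
    (X : {RV P >-> T1}) (Y : {RV P >-> T2}) :
  (forall B, measurable B -> F a (X @^-1` B)) ->
  measurable_fun setT (Y : away a -> T2) ->
  forall A B, measurable A -> measurable B ->
  P (X @^-1` A `&` Y @^-1` B) = (P (X @^-1` A) * P (Y @^-1` B))%E.
Proof.
move=> FX mY A B mA mB; apply: (independent_away F_indep F_measurable F_setT F_setI).
  exact: FX.
by have := mY measurableT B mB; rewrite setTI.
Qed.

Variable X : I -> {RV P >-> R}.
Variable J : {pred I}.
Hypothesis X_F : forall a, a \in J -> forall B, measurable B -> F a (X a @^-1` B).
Hypothesis X_sym : forall a (f : R -> \bar R), a \in J ->
  measurable_fun setT f -> (forall x, 0 <= f x)%E ->
  (\int[P]_w f (X a w) = \int[P]_w f (- X a w)%R)%E.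

Let sum_away a s : {subset s <= J} -> a \notin s ->
  measurable_fun setT ((fun w => \sum_(b <- s) X b w) : away a -> R).
Proof.
move=> sJ as_; rewrite (_ : (fun _ => _) = fun w : away a => \sum_(b <- s | b \in s) X b w);
  last first.
  by apply/funext => w; rewrite big_seq.
rewrite (_ : (fun _ => _) = fun w : away a => \sum_(b <- s) (if b \in s then X b w else 0));
  last first.
  by apply/funext => w; rewrite big_mkcond.
apply: measurable_sum => b; have [bs|_] := boolP (b \in s); last exact: measurable_cst.
move=> _ B mB; rewrite setTI; apply: sub_sigma_algebra.
apply: (@cylinders_away_single _ _ _ F a b); last exact: X_F (sJ _ bs) _ mB.
by apply: contraNneq as_ => <-.
Qed.

(* [X a] may be replaced by [- X a], and the two squares average to at least the
   square of the remaining sum; no integrability is needed. *)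
Lemma symmetric_increment a s : a \in J -> {subset s <= J} -> a \notin s ->
  (\int[P]_w ((\sum_(b <- s) X b w) ^+ 2)%:E <=
   \int[P]_w ((\sum_(b <- a :: s) X b w) ^+ 2)%:E)%E.
Proof.
move=> aJ sJ as_; pose Y w := \sum_(b <- s) X b w.
have mYa := sum_away sJ as_; have mY := measurable_away_measurable mYa.
pose Yrv : {RV P >-> R} := (HB.pack Y (isMeasurableFun.Build _ _ _ _ _ mY) : {mfun Omega >-> R}).
have XY := @independent_of_away a _ _ _ _ (X a) Yrv (X_F aJ) mYa.
have sq_meas : measurable_fun [set: R * R] (fun z => ((z.1 + z.2) ^+ 2)%:E).
  apply/measurable_EFinP; apply: measurable_funX; apply: measurable_funD.
    exact: measurable_fst.
  exact: measurable_snd.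
have -> : (\int[P]_w ((\sum_(b <- a :: s) X b w) ^+ 2)%:E =
    \int[P]_w \int[distribution P (X a)]_x ((x + Y w) ^+ 2)%:E)%E.
  transitivity (\int[P]_w ((X a w + Yrv w) ^+ 2)%:E)%E.
    by apply: eq_integral => w _; rewrite big_cons.
  apply: (tonelli_independent XY sq_meas) => z; by rewrite lee_fin sqr_ge0.
apply: ge0_le_integral_nonmeasurable => w; first by rewrite lee_fin sqr_ge0.
rewrite -/(Y w) /=; move: (Y w) => y.
pose g e (x : R) : \bar R := ((e * x + y) ^+ 2)%:E.
have mg e : measurable_fun setT (g e).
  apply/measurable_EFinP; apply: measurable_funX; apply: measurable_funD => //.
have g0 e x : (0 <= g e x)%E by rewrite lee_fin sqr_ge0.
have gE : (\int[distribution P (X a)]_x ((x + y) ^+ 2)%:E = \int[P]_w g 1%R (X a w))%E.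
  rewrite -[RHS](@ge0_integral_distribution _ _ _ _ _ P (X a) (g 1%R))//.
  by apply: eq_integral => x _; rewrite /g mul1r.
rewrite gE.
have gN : (\int[P]_w g 1%R (X a w) = \int[P]_w g (-1)%R (X a w))%E.
  rewrite (X_sym aJ (mg 1) (g0 1)); apply: eq_integral => v _.
  by rewrite /g mul1r mulN1r.
have mgX e : measurable_fun setT (fun w => g e (X a w)) by exact: measurableT_comp (mg e) _.
have : (2%:E * (y ^+ 2)%:E <= \int[P]_w g 1%R (X a w) + \int[P]_w g (-1)%R (X a w))%E.
  rewrite -ge0_integralD//.
  have -> : (2%:E * (y ^+ 2)%:E = \int[P]_w (2 * y ^+ 2)%:E)%E.
    transitivity ((2 * y ^+ 2)%:E * P setT)%E; last exact/esym/integral_cst.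
    by rewrite probability_setT mule1 EFinM.
  apply: ge0_le_integral_nonmeasurable => v.
    by rewrite lee_fin mulr_ge0 ?sqr_ge0.
  by rewrite /g -EFinD lee_fin; have := sqr_ge0 (X a v); lra.
rewrite -gN; have : (0 <= \int[P]_w g 1%R (X a w))%E by exact: integral_ge0.
case: (integral _ _ _) => [i| |] //; first by rewrite -EFinM -EFinD !lee_fin; lra.
by move=> _ _; rewrite leey.
Qed.

Lemma symmetric_sum_mono s t : uniq (t ++ s) -> {subset t ++ s <= J} ->
  (\int[P]_w ((\sum_(b <- s) X b w) ^+ 2)%:E <=
   \int[P]_w ((\sum_(b <- t ++ s) X b w) ^+ 2)%:E)%E.
Proof.
elim: t => //= a t IH /andP[ats uts] tsJ.
have tsJ' : {subset t ++ s <= J} by move=> b bts; apply: tsJ; rewrite inE bts orbT.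
apply: le_trans (IH uts tsJ') _; apply: symmetric_increment => //.
by apply: tsJ; rewrite inE eqxx.
Qed.

End symmetric_sums.

(** * Measurability of the iterates *)

Section run_measurability.
Context {R : realType} {n d : nat} {dS dT : measure_display}.
Context {S : measurableType dS} {T : measurableType dT}.

Definition measurable_agents (g : T -> 'I_n -> 'cV[R]_d) : Prop :=
  forall i c, measurable_fun setT (fun w => g w i c 0).

Implicit Types g h : T -> 'I_n -> 'cV[R]_d.

Lemma measurable_agentsD g h : measurable_agents g -> measurable_agents h ->
  measurable_agents (fun w i => g w i + h w i).
Proof.
move=> mg mh i c; under eq_fun do rewrite mxE; exact: measurable_funD.
Qed.

Lemma measurable_agentsZ k g : measurable_agents g ->
  measurable_agents (fun w i => k *: g w i).
Proof.
by move=> mg i c; under eq_fun do rewrite mxE; exact: measurable_funM.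
Qed.

Lemma measurable_agentsB g h : measurable_agents g -> measurable_agents h ->
  measurable_agents (fun w i => g w i - h w i).
Proof.
move=> mg mh; have := measurable_agentsD mg (measurable_agentsZ (-1) mh).
by move=> m i c; have := m i c; under eq_fun do rewrite scaleN1r.
Qed.

Lemma measurable_agents_lap (W : 'M[R]_n) g : measurable_agents g ->
  measurable_agents (fun w => lap W (g w)).
Proof.
move=> mg i c; rewrite /lap; under eq_fun do rewrite summxE.
by apply: measurable_sum => k; under eq_fun do rewrite mxE; exact: measurable_funM.
Qed.

Lemma measurable_mean g c : measurable_agents g ->
  measurable_fun setT (fun w => mean (g w) c 0).
Proof.
move=> mg; under eq_fun do rewrite mean_component.
apply: measurable_funM => //; apply: measurable_sum => i; exact: mg.
Qed.

Lemma measurable_comp_column (F : 'cV[R]_d -> R) (y : T -> 'cV[R]_d) : continuous F ->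
  (forall c, measurable_fun setT (fun w => y w c 0)) ->
  measurable_fun setT (fun w => F (y w)).
Proof.
move=> cF my.
exact: (measurableT_comp (continuous_measurable_column cF) (measurable_column my)).
Qed.

Variables (W : 'M[R]_n) (eta om zt alpha Lf : R) (f : 'I_n -> 'cV[R]_d -> R).
Hypotheses (Lf_gt0 : 0 < Lf) (f_smooth : forall i, smooth Lf (f i)).

Lemma measurable_agents_grad g : measurable_agents g ->
  measurable_agents (fun w i => grad (f i) (g w i)).
Proof.
move=> mg i c; apply: (@measurable_comp_column (fun y => grad (f i) y c 0)).
  exact: grad_continuous (f_smooth i).
by move=> b; exact: mg.
Qed.

Variable (C : S -> 'cV[R]_d -> 'cV[R]_d).
Hypothesis C_meas : measurable_compressor C.

Lemma measurable_compressed (u : T -> S) (y : T -> 'cV[R]_d) c :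
  measurable_fun setT u -> (forall b, measurable_fun setT (fun w => y w b 0)) ->
  measurable_fun setT (fun w => C (u w) (y w) c 0).
Proof.
move=> mu my.
have m1 := measurable_fun_pair mu (measurable_column my).
have m2 := measurableT_comp C_meas m1.
have cc : continuous (fun z : 'cV[R]_d => z c 0) by exact: coord_continuous.
exact: measurableT_comp (continuous_measurable_column cc) m2.
Qed.

Variables (xi ze : nat -> T -> 'I_n -> 'cV[R]_d) (U : nat -> 'I_n -> T -> S).
Variables (x v xc : nat -> T -> 'I_n -> 'cV[R]_d) (x0 : 'I_n -> 'cV[R]_d).

Definition compressed k w : 'I_n -> 'cV[R]_d := fun i =>
  C (U k i w) (residual (x k w) (xc k w) (xi k w) i).

Hypothesis x_0 : forall w, x 0%N w = x0.
Hypothesis v_0 : forall w, v 0%N w = fun=> 0.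
Hypothesis xc_0 : forall w, xc 0%N w = fun=> 0.
Hypothesis x_S : forall k w,
  x k.+1 w = next_x W eta om zt f (x k w) (v k w) (xc k w) (xi k w) (compressed k w).
Hypothesis v_S : forall k w,
  v k.+1 w = next_v W eta om (v k w) (xc k w) (ze k w) (compressed k w).
Hypothesis xc_S : forall k w, xc k.+1 w = next_xc alpha (xc k w) (compressed k w).

Lemma measurable_residual k : measurable_agents (x k) -> measurable_agents (xc k) ->
  measurable_agents (xi k) -> measurable_agents (fun w => residual (x k w) (xc k w) (xi k w)).
Proof.
by move=> mx mxc mxi; apply: measurable_agentsB => //; exact: measurable_agentsD.
Qed.

Lemma measurable_agents_compressed k : measurable_agents (x k) ->
  measurable_agents (xc k) -> measurable_agents (xi k) ->
  (forall i, measurable_fun setT (U k i)) -> measurable_agents (compressed k).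
Proof.
move=> mx mxc mxi mU i c; apply: measurable_compressed => // b.
exact: measurable_residual.
Qed.

(** The sigma-algebra on [T] is arbitrary and only inputs before time k are assumed measurable.
    Hence the lemma applies both to the full sigma-algebra and to the one generated by all sources
    but one compressor use at time k. *)
Lemma measurable_run k :
  (forall t, (t < k)%N -> measurable_agents (xi t)) ->
  (forall t, (t < k)%N -> measurable_agents (ze t)) ->
  (forall t i, (t < k)%N -> measurable_fun setT (U t i)) ->
  [/\ measurable_agents (x k), measurable_agents (v k) & measurable_agents (xc k)].
Proof.
elim: k => [|k IHk] mxi mze mU.
  by split => i c; under eq_fun do rewrite ?x_0 ?v_0 ?xc_0; exact: measurable_cst.
have [|||mx mv mxc] := IHk.
- by move=> t tk; apply: mxi; exact: ltnW.
- by move=> t tk; apply: mze; exact: ltnW.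
- by move=> t i tk; apply: mU; exact: ltnW.
have mC : measurable_agents (compressed k).
  by apply: measurable_agents_compressed => // [|i]; [exact: mxi|exact: mU].
have mL := measurable_agents_lap W (measurable_agentsD mxc mC).
split.
- rewrite (_ : x k.+1 = fun w => next_x W eta om zt f (x k w) (v k w) (xc k w) (xi k w)
  (compressed k w)); last exact/funext.
  apply: measurable_agentsB.
    by apply: measurable_agentsD => //; exact: mxi.
  apply: measurable_agentsZ; apply: measurable_agentsD.
    by apply: measurable_agentsD; apply: measurable_agentsZ.
  exact: measurable_agents_grad.
- rewrite (_ : v k.+1 = fun w => next_v W eta om (v k w) (xc k w) (ze k w) (compressed k w));
  last exact/funext.
  apply: measurable_agentsD; last exact: measurable_agentsZ.
  by apply: measurable_agentsD => //; exact: mze.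
- rewrite (_ : xc k.+1 = fun w => next_xc alpha (xc k w) (compressed k w)); last exact/funext.
  by apply: measurable_agentsD => //; exact: measurable_agentsZ.
Qed.

End run_measurability.

(** * Noise and compression in expectation *)

Section noise.
Context {R : realType} {n d : nat} {dO dS : measure_display}.
Context {Omega : measurableType dO} {V : measurableType dS}.
Variables (P : probability Omega R) (s_x s_v q : 'I_n -> R).
Variables (xi_x xi_v : 'I_n -> nat -> 'I_d -> {RV P >-> R}) (U : 'I_n -> nat -> {RV P >-> V}).
Local Notation F := (source_sigma_algebra xi_x xi_v U).

Lemma source_measurable a : F a `<=` measurable.
Proof.
have pm dT (T : measurableType dT) (X : {RV P >-> T}) :
    preimage_set_system setT X measurable `<=` measurable.
  by move=> _ [B mB <-]; exact: measurable_funPT.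
by case: a => [[[[i k] c]|[[i k] c]]|[i k]]; exact: pm.
Qed.

Lemma source_setT a : F a setT.
Proof.
have pT dT (T : measurableType dT) (X : {RV P >-> T}) :
    preimage_set_system setT X measurable setT.
  by exists setT => //; rewrite preimage_setT setIT.
by case: a => [[[[i k] c]|[[i k] c]]|[i k]]; exact: pT.
Qed.

Lemma source_setI a : setI_closed (F a).
Proof.
have pI dT (T : measurableType dT) (X : {RV P >-> T}) :
    setI_closed (preimage_set_system setT X measurable).
  move=> _ _ [A mA <-] [B mB <-]; exists (A `&` B); first exact: measurableI.
  by rewrite !setTI preimage_setI.
by case: a => [[[[i k] c]|[[i k] c]]|[i k]]; exact: pI.
Qed.

Hypotheses (s_x_gt0 : forall i, 0 < s_x i) (s_v_gt0 : forall i, 0 < s_v i).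
Hypotheses (q_gt0 : forall i, 0 < q i) (q_lt1 : forall i, q i < 1).
Hypothesis xi_x_law : forall i k j, laplace_law (xi_x i k j) (s_x i * q i ^+ k).
Hypothesis xi_v_law : forall i k j, laplace_law (xi_v i k j) (s_v i * q i ^+ k).

Lemma q_bar_bounds : (0 < n)%N -> 0 < q_bar q < 1.
Proof.
move=> n0; have i0 := Ordinal n0; apply/andP; split.
  by apply: lt_le_trans (q_gt0 i0) _; rewrite /q_bar; exact: le_bigmax.
by apply: bigmax_lt => // i _; rewrite ltr01.
Qed.

Lemma noise_scale i k s : 0 < s -> s <= s_bar s_x s_v ->
  2 * (s * q i ^+ k) ^+ 2 <= 2 * q_bar q ^+ (2 * k) * s_bar s_x s_v ^+ 2.
Proof.
move=> s0 s_le; rewrite -mulrA ler_wpM2l// exprMn mulrC -exprM mulnC.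
have qi : q i <= q_bar q by exact: le_bigmax.
apply: ler_pM; rewrite ?sqr_ge0 ?exprn_ge0// ?(ltW (q_gt0 i))//.
  by apply: lerXn2r; rewrite ?nnegrE ?(ltW (q_gt0 i))// (le_trans (ltW (q_gt0 i))).
by apply: lerXn2r; rewrite ?nnegrE ?(ltW s0)// (le_trans (ltW s0)).
Qed.

Let noise_bound (xi : 'I_n -> nat -> 'I_d -> {RV P >-> R}) (s : 'I_n -> R) k :
  (forall i, 0 < s i) -> (forall i, s i <= s_bar s_x s_v) ->
  (forall i k j, laplace_law (xi i k j) (s i * q i ^+ k)) ->
  (\int[P]_w (norm2 (fun i => noise_vec (xi i k) w))%:E <=
   (n%:R * (2 * d%:R * q_bar q ^+ (2 * k) * s_bar s_x s_v ^+ 2))%:E)%E.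
Proof.
move=> s0 s_le law.
under eq_integral do rewrite /norm2 -sumEFin.
rewrite ge0_integral_sum//; last 2 first.
- move=> i; apply/measurable_EFinP; apply: measurable_sum => c.
  by under eq_fun do rewrite mxE; exact: measurable_funX.
- by move=> i w _; rewrite lee_fin; apply: sumr_ge0 => c _; exact: sqr_ge0.
apply: (@le_trans _ _ (\sum_(i < n) (d%:R * (2 * q_bar q ^+ (2 * k) * s_bar s_x s_v ^+ 2))%:E)%E).
  apply: lee_sum => i _; under eq_integral do rewrite -sumEFin.
  rewrite ge0_integral_sum//; last 2 first.
  - by move=> c; apply/measurable_EFinP; under eq_fun do rewrite mxE; exact: measurable_funX.
  - by move=> c w _; rewrite lee_fin sqr_ge0.
  apply: (@le_trans _ _ (\sum_(c < d) (2 * q_bar q ^+ (2 * k) * s_bar s_x s_v ^+ 2)%:E)%E).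
    apply: lee_sum => c _; under eq_integral do rewrite mxE.
    rewrite (laplace_law_sqr _ (law i k c)); first by rewrite lee_fin; apply: noise_scale.
    by rewrite mulr_gt0// exprn_gt0.
  by rewrite sumEFin sumr_const card_ord lee_fin -[leLHS]mulr_natl.
rewrite sumEFin sumr_const card_ord lee_fin -[leLHS]mulr_natl le_eqVlt; apply/orP; left;
  apply/eqP; ring.
Qed.

Lemma s_x_le i : s_x i <= s_bar s_x s_v.
Proof. by apply: le_trans (le_bigmax _ _ i); rewrite le_max lexx. Qed.

Lemma s_v_le i : s_v i <= s_bar s_x s_v.
Proof. by apply: le_trans (le_bigmax _ _ i); rewrite le_max lexx orbT. Qed.

Lemma noise_x_bound k : (\int[P]_w (norm2 (fun i => noise_vec (xi_x i k) w))%:E <=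
   (n%:R * (2 * d%:R * q_bar q ^+ (2 * k) * s_bar s_x s_v ^+ 2))%:E)%E.
Proof. exact: noise_bound s_x_gt0 s_x_le xi_x_law. Qed.

Lemma noise_v_bound k : (\int[P]_w (norm2 (fun i => noise_vec (xi_v i k) w))%:E <=
   (n%:R * (2 * d%:R * q_bar q ^+ (2 * k) * s_bar s_x s_v ^+ 2))%:E)%E.
Proof. exact: noise_bound s_v_gt0 s_v_le xi_v_law. Qed.

Hypothesis indep : mutually_independent P F.

Lemma mean_stack_norm (y : 'I_n -> 'cV[R]_d) :
  l2norm (mean_stack y) ^+ 2 = n%:R * \sum_c mean y c 0 ^+ 2.
Proof.
by rewrite mean_stackE stack_normE sumr_const card_ord mulr_natl.
Qed.

Let S N w : 'cV[R]_(n * d) := \sum_(0 <= t < N) mean_stack (fun i => noise_vec (xi_v i t) w).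

Let noise_sum c N w : R := \sum_(0 <= t < N) \sum_i xi_v i t c w.

Lemma mean_noise_sum N w : l2norm (S N w) ^+ 2 =
  n%:R * \sum_c (n%:R^-1 * noise_sum c N w) ^+ 2.
Proof.
rewrite l2norm_sqr.
transitivity (\sum_(i < n) \sum_c (n%:R^-1 * noise_sum c N w) ^+ 2); last first.
  by rewrite sumr_const card_ord mulr_natl.
rewrite -sum_mxtens; apply: eq_bigr => p _; congr (_ ^+ 2).
rewrite summxE /noise_sum mulr_sumr; apply: eq_bigr => t _.
rewrite mean_stackE mxE mean_component /avg; congr (_ * _).
by apply: eq_bigr => i _; rewrite /component mxE.
Qed.

Let indices (c : 'I_d) N : seq (@source n d) :=
  [seq inl (inr (i, t, c)) | t <- iota 0 N, i <- enum 'I_n].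

(** Compressor uses get the dummy value 0; the set [J] of noise indices excludes them below. *)
Definition noise_of (a : @source n d) : {RV P >-> R} :=
  match a with
  | inl (inl (i, k, j)) => xi_x i k j
  | inl (inr (i, k, j)) => xi_v i k j
  | inr _ => cst 0
  end.

Let noise_sumE c N w : noise_sum c N w = \sum_(a <- indices c N) noise_of a w.
Proof.
rewrite /indices big_allpairs_dep /noise_sum /index_iota subn0; apply: eq_bigr => t _.
by rewrite big_enum.
Qed.

Let indices_uniq c N : uniq (indices c N).
Proof.
apply: allpairs_uniq; rewrite ?iota_uniq ?enum_uniq//.
by move=> [t i] [t' i'] _ _ [-> ->].
Qed.

Lemma noise_sum_mono c k N : (k <= N)%N ->
  (\int[P]_w ((noise_sum c k w) ^+ 2)%:E <= \int[P]_w ((noise_sum c N w) ^+ 2)%:E)%E.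
Proof.
move=> kN; pose J : {pred @source n d} := fun a => if a is inl _ then true else false.
under eq_integral do rewrite noise_sumE; under [leRHS]eq_integral do rewrite noise_sumE.
(* The indices of times k to N - 1 are moved to the front, where they extend the sum up to time
   k. *)
have permN : perm_eq (indices c N)
    ([seq inl (inr (i, t, c)) | t <- iota k (N - k), i <- enum 'I_n] ++ indices c k).
  by rewrite perm_sym perm_catC -[in iota k _](add0n k) -allpairs_cat -iotaD subnKC.
under [leRHS]eq_integral do rewrite (perm_big _ permN).
apply: (@symmetric_sum_mono _ _ _ P _ F indep source_measurable source_setT source_setI noise_of J).
- move=> [[[[i t] j]|[[i t] j]]|[i t]]//= _ B mB; first by exists B => //; rewrite setTI.
  by exists B => //; rewrite setTI.
- have th i t s : 0 < s -> 0 < s * q i ^+ t by move=> s0; rewrite mulr_gt0// exprn_gt0.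
  move=> [[[[i t] j]|[[i t] j]]|[i t]]//= f _ mf f0.
    exact (laplace_law_sym (th i t _ (s_x_gt0 i)) (xi_x_law i t j) mf f0).
  exact (laplace_law_sym (th i t _ (s_v_gt0 i)) (xi_v_law i t j) mf f0).
- by rewrite -(perm_uniq permN) indices_uniq.
- by move=> a; rewrite -(perm_mem permN) => /allpairsP[[t i] [_ _ ->]].
Qed.

Lemma noise_v_meas t (p : 'I_(n * d)) :
  measurable_fun setT (fun w => mean_stack (fun i => noise_vec (xi_v i t) w) p 0).
Proof.
rewrite (_ : (fun _ => _) = fun w => n%:R^-1 * \sum_i xi_v i t (mxtens_unindex p).2 w).
  by apply: measurable_funM => //; exact: measurable_sum.
apply/funext => w; rewrite mean_stackE mxE mean_component /avg; congr (_ * _).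
by apply: eq_bigr => i _; rewrite /component mxE.
Qed.

(** The difference of the two sides is the sum over the agents of the squared deviations from the
    mean. *)
Lemma mean_sqr_le (y : 'I_n -> 'cV[R]_d) : (0 < n)%N ->
  n%:R * \sum_c mean y c 0 ^+ 2 <= norm2 y.
Proof.
move=> n0; rewrite /norm2 exchange_big mulr_sumr; apply: ler_sum => c _ /=.
set m := mean y c 0; have mE : \sum_i y i c 0 = n%:R * m.
  by rewrite /m mean_component /avg mulrA mulfV ?mul1r// pnatr_eq0 -lt0n.
have : 0 <= \sum_i (y i c 0 - m) ^+ 2 by apply: sumr_ge0 => i _; exact: sqr_ge0.
have -> : \sum_i (y i c 0 - m) ^+ 2 = \sum_i y i c 0 ^+ 2 - 2 * m * (\sum_i y i c 0) + n%:R * m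
  ^+ 2.
  rewrite (_ : n%:R * m ^+ 2 = \sum_(i < n) m ^+ 2); last by rewrite sumr_const card_ord mulr_natl.
  rewrite mulr_sumr -sumrB -big_split /=.
  by apply: eq_bigr => i _; ring.
by rewrite mE; lra.
Qed.

Lemma noise_sum_limit k : (0 < n)%N ->
  (\int[P]_w (n%:R * \sum_c mean (fun i => \sum_(0 <= t < k) noise_vec (xi_v i t) w) c 0 ^+ 2)%:E <=
   \int[P]_w (l2norm (limn (S ^~ w)) ^+ 2)%:E)%E.
Proof.
move=> n0; have /andP[q0 q1] := q_bar_bounds n0.
have sums w : n%:R * \sum_c mean (fun i => \sum_(0 <= t < k) noise_vec (xi_v i t) w) c 0 ^+ 2
    = l2norm (S k w) ^+ 2.
  rewrite mean_noise_sum; congr (_ * _); apply: eq_bigr => c _; congr (_ ^+ 2).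
  rewrite mean_component /avg; congr (_ * _); rewrite /noise_sum exchange_big /=.
  apply: eq_bigr => i _; rewrite /component summxE; apply: eq_bigr => t _; by rewrite mxE.
under eq_integral do rewrite sums.
(* The noise variance at time t is of order q_bar^(2t), hence [rho = q_bar]. *)
apply: (second_moment_limit noise_v_meas
  (K := n%:R * (2 * d%:R * s_bar s_x s_v ^+ 2)) (rho := q_bar q)) => //.
- by apply: mulr_ge0 => //; apply: mulr_ge0 (sqr_ge0 _); rewrite mulr_ge0.
- move=> t; apply: (@le_trans _ _ (\int[P]_w (norm2 (fun i => noise_vec (xi_v i t) w))%:E)%E).
    apply: ge0_le_integral_nonmeasurable => w; rewrite lee_fin ?sqr_ge0//.
    by rewrite mean_stack_norm mean_sqr_le.
  apply: le_trans (noise_v_bound t) _; rewrite lee_fin le_eqVlt; apply/orP; left; apply/eqP; ring.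
- move=> N kN; under eq_integral do rewrite mean_noise_sum.
  under [leRHS]eq_integral do rewrite mean_noise_sum.
  have EE M : (\int[P]_w (n%:R * \sum_c (n%:R^-1 * noise_sum c M w) ^+ 2)%:E =
      (n%:R^-1)%:E * \sum_c \int[P]_w ((noise_sum c M w) ^+ 2)%:E)%E.
    have msum c : measurable_fun setT (fun w => ((noise_sum c M w) ^+ 2)%:E).
      apply/measurable_EFinP; apply: measurable_funX; apply: measurable_sum => t.
      by apply: measurable_sum => i.
    rewrite -ge0_integral_sum//; last by move=> c w _; rewrite lee_fin sqr_ge0.
    rewrite -ge0_integralZl//; last 2 first.
    + by apply: emeasurable_sum => c; exact: msum.
    + by move=> w _; rewrite sumEFin lee_fin; apply: sumr_ge0 => c _; exact: sqr_ge0.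
    apply: eq_integral => w _; rewrite sumEFin -EFinM; congr (_%:E).
    rewrite !mulr_sumr; apply: eq_bigr => c _; rewrite exprMn mulrA; congr (_ * _).
    by rewrite expr2 mulrA mulfV ?mul1r// pnatr_eq0 -lt0n.
  rewrite !EE lee_wpmul2l ?lee_fin ?invr_ge0//.
  by apply: lee_sum => c _; exact: noise_sum_mono.
Qed.

End noise.

(** * Expectation of the compression error *)

Section compression_error.
Context {R : realType} {n d : nat} {dO dS : measure_display}.
Context {Omega : measurableType dO} {V : measurableType dS}.
Variables (P : probability Omega R) (mu : probability V R) (C : V -> 'cV[R]_d -> 'cV[R]_d).
Variables (phi r : R).
Hypotheses (phi_le1 : phi <= 1) (C_meas : measurable_compressor C) (C_bound : compressor_bound mu
  C phi r).
Variables (xi_x xi_v : 'I_n -> nat -> 'I_d -> {RV P >-> R}) (U : 'I_n -> nat -> {RV P >-> V}).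
Local Notation F := (source_sigma_algebra xi_x xi_v U).
Hypothesis U_law : forall i k (B : set V), measurable B -> P (U i k @^-1` B) = mu B.
Hypothesis indep : mutually_independent P F.

Local Notation column := (g_sigma_algebraType (@open 'cV[R]_d)).

Let coordinate_meas c : measurable_fun setT (fun y : column => (y : 'cV[R]_d) c 0).
Proof. exact: continuous_measurable_column (@coord_continuous _ _ _ c 0). Qed.

Let error (z : V * column) : \bar R := (l2norm (r^-1 *: C z.1 z.2 - z.2) ^+ 2)%:E.

Let error_meas : measurable_fun setT error.
Proof.
apply/measurable_EFinP; under eq_fun do rewrite l2norm_sqr.
apply: measurable_sum => c; under eq_fun do rewrite !mxE.
apply: measurable_funX; apply: measurable_funB; last first.
  exact: measurableT_comp (coordinate_meas c) measurable_snd.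
by apply: measurable_funM => //; exact: measurableT_comp (coordinate_meas c) C_meas.
Qed.

(** The input [y] depends only on sources other than [U i k]. So [U i k] is integrated out with its
    law [mu] at a fixed input, where the compressor bound applies. *)
Lemma compression_error_single i k (y : Omega -> 'cV[R]_d) :
  (forall c, measurable_fun setT
     ((fun w => y w c 0) : g_sigma_algebraType (cylinders_away F (inr (i, k))) -> R)) ->
  (\int[P]_w (l2norm (r^-1 *: C (U i k w) (y w) - y w) ^+ 2)%:E <=
   \int[P]_w ((1 - phi) * l2norm (y w) ^+ 2)%:E)%E.
Proof.
move=> my_away.
have mya := measurable_column my_away.
have my := measurable_away_measurable (@source_measurable _ _ _ _ _ _ _ P xi_x xi_v U) mya.
pose Y : {RV P >-> column} :=
  (HB.pack (y : Omega -> column) (isMeasurableFun.Build _ _ _ _ _ my) : {mfun Omega >-> column}).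
have UY := @independent_of_away _ _ _ P _ F indep
  (@source_measurable _ _ _ _ _ _ _ P xi_x xi_v U) (@source_setT _ _ _ _ _ _ _ P xi_x xi_v U)
  (@source_setI _ _ _ _ _ _ _ P xi_x xi_v U)
  (inr (i, k)) _ _ _ _ (U i k) Y.
have {}UY := UY (fun B mB => ex_intro2 _ _ B mB (setTI _)) mya.
have -> : (\int[P]_w (l2norm (r^-1 *: C (U i k w) (y w) - y w) ^+ 2)%:E =
   \int[P]_w \int[distribution P (U i k)]_s error (s, Y w))%E.
  by apply: (tonelli_independent UY error_meas) => z; rewrite lee_fin sqr_ge0.
apply: ge0_le_integral_nonmeasurable => w.
  by apply: integral_ge0 => s _; rewrite lee_fin sqr_ge0.
rewrite (eq_measure_integral mu) => [|B mB _]; last exact: U_law.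
exact: C_bound.
Qed.

Variables (W : 'M[R]_n) (eta om zt alpha Lf : R) (f : 'I_n -> 'cV[R]_d -> R).
Hypotheses (Lf_gt0 : 0 < Lf) (f_smooth : forall i, smooth Lf (f i)).
Variables (x v xc : nat -> Omega -> 'I_n -> 'cV[R]_d) (x0 : 'I_n -> 'cV[R]_d).
Let xi k w : 'I_n -> 'cV[R]_d := fun i => noise_vec (xi_x i k) w.
Let ze k w : 'I_n -> 'cV[R]_d := fun i => noise_vec (xi_v i k) w.
Let Cv := compressed C xi (fun k i w => U i k w) x xc.
Hypothesis x_0 : forall w, x 0%N w = x0.
Hypothesis v_0 : forall w, v 0%N w = fun=> 0.
Hypothesis xc_0 : forall w, xc 0%N w = fun=> 0.
Hypothesis x_S : forall k w,
  x k.+1 w = next_x W eta om zt f (x k w) (v k w) (xc k w) (xi k w) (Cv k w).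
Hypothesis v_S : forall k w,
  v k.+1 w = next_v W eta om (v k w) (xc k w) (ze k w) (Cv k w).
Hypothesis xc_S : forall k w, xc k.+1 w = next_xc alpha (xc k w) (Cv k w).
Let Y k w := residual (x k w) (xc k w) (xi k w).

Let away a := g_sigma_algebraType (cylinders_away F a).

Let source_away a b dT (T : measurableType dT) (X : {RV P >-> T}) :
  (forall B, measurable B -> F b (X @^-1` B)) -> b != a ->
  measurable_fun setT (X : away a -> T).
Proof.
move=> FX ba _ B mB; rewrite setTI; apply: sub_sigma_algebra.
exact: cylinders_away_single ba (FX _ mB).
Qed.

Lemma compression_error_bound k :
  (\int[P]_w (norm2 (fun i => r^-1 *: Cv k w i - Y k w i))%:E <=
   \int[P]_w ((1 - phi) * norm2 (Y k w))%:E)%E.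
Proof.
have norm2S (y : Omega -> 'I_n -> 'cV[R]_d) a : 0 <= a -> measurable_agents y ->
   (\int[P]_w (a * norm2 (y w))%:E = \sum_i \int[P]_w (a * l2norm (y w i) ^+ 2)%:E)%E.
  move=> a0 my; rewrite -ge0_integral_sum//; last 2 first.
  - move=> i; apply/measurable_EFinP; apply: measurable_funM => //.
    under eq_fun do rewrite l2norm_sqr; apply: measurable_sum => c.
    exact: measurable_funX (my i c).
  - by move=> i w _; rewrite lee_fin mulr_ge0 ?sqr_ge0.
  apply: eq_integral => w _; rewrite sumEFin; congr (_%:E).
  by rewrite /norm2 mulr_sumr; apply: eq_bigr => i _; rewrite l2norm_sqr.
have phi1 : 0 <= 1 - phi by rewrite subr_ge0.
have mxi t : measurable_agents (xi t) by move=> i c; under eq_fun do rewrite mxE;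
  exact: measurable_funPT.
have mze t : measurable_agents (ze t) by move=> i c; under eq_fun do rewrite mxE;
  exact: measurable_funPT.
have mU t i : measurable_fun setT (fun w => U i t w) by exact: measurable_funPT.
have [mx mv mxc] := measurable_run Lf_gt0 f_smooth C_meas x_0 v_0 xc_0 x_S v_S xc_S
  (fun t (_ : (t < k)%N) => mxi t) (fun t _ => mze t) (fun t i _ => mU t i).
have mY : measurable_agents (Y k) by exact: measurable_residual.
have mC : measurable_agents (Cv k).
  exact: (measurable_agents_compressed C_meas mx mxc (mxi k) (mU k)).
rewrite (norm2S (Y k))//.
under eq_integral do rewrite -[norm2 _]mul1r.
rewrite norm2S//; last exact: measurable_agentsB (measurable_agentsZ _ mC) mY.
apply: lee_sum => i _; under eq_integral do rewrite mul1r.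
apply: compression_error_single => c.
have pre dT (T : measurableType dT) (X : {RV P >-> T}) B : measurable B ->
    preimage_set_system setT X measurable (X @^-1` B).
  by move=> mB; exists B => //; rewrite setTI.
(* The residual at time k involves the noise and the compressor uses at times t < k only, besides
   the noise at time k; the use (i, k) is not among its sources. *)
pose a : @source n d := inr (i, k).
have mxi' t : @measurable_agents _ _ _ _ (away a) (xi t).
  by move=> j b; under eq_fun do rewrite mxE;
    exact: (@source_away a (inl (inl (j, t, b))) _ _ (xi_x j t b) (pre _ _ _)).
have mze' t : @measurable_agents _ _ _ _ (away a) (ze t).
  by move=> j b; under eq_fun do rewrite mxE;
    exact: (@source_away a (inl (inr (j, t, b))) _ _ (xi_v j t b) (pre _ _ _)).
have mU' t j : (t < k)%N -> measurable_fun setT ((fun w => U j t w) : away a -> V).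
  move=> tk; apply: (@source_away a (inr (j, t)) _ _ (U j t) (pre _ _ _)).
  by apply: contraTneq tk => -[_ ->]; rewrite ltnn.
have [mx' _ mxc'] := @measurable_run R n d _ _ V (away a) W eta om zt alpha Lf f Lf_gt0 f_smooth
  C C_meas xi ze (fun k i w => U i k w) x v xc x0 x_0 v_0 xc_0 x_S v_S xc_S k
  (fun t _ => mxi' t) (fun t _ => mze' t) (fun t i => mU' t i).
exact: (@measurable_residual R n d _ (away a) xi x xc k mx' mxc' (mxi' k)).
Qed.

End compression_error.

(** * Parameters *)

Section parameters.
Context {R : realType} {n : nat}.
Variable p : setting R n.
Local Notation Lf := (p_Lf p).
Local Notation phi := (p_phi p).
Local Notation r := (p_r p).
Local Notation eta := (p_eta p).
Local Notation gamma := (p_gamma p).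
Local Notation omega := (p_omega p).
Local Notation alpha := (p_alpha p).
Local Notation lmin := (lmin p).
Local Notation lmax := (lmax p).
Local Notation tau := (eta * gamma * lmax).
Local Notation Pi := (contraction_weight (phi2 p)).

Hypotheses (n_gt1 : (1 < n)%N) (lmin_gt0 : 0 < lmin) (lmin_le : (n%:R - 1) * lmin <= n%:R).
Hypothesis lmax_ge : lmin <= lmax.
Hypothesis Lf_gt0 : 0 < Lf.
Hypotheses (phi_gt0 : 0 < phi) (phi_le1 : phi <= 1) (r_gt0 : 0 < r).
Variable zeta1 : R.
Hypothesis zeta1_ge : Num.max ((13 + zeta4 p zeta1) / (2 * lmin)) 1 <= zeta1.
Hypotheses (gamma_gt0 : 0 < gamma) (gamma_eq : gamma = zeta1 * omega).
Hypotheses (omega_gt0 : 0 < omega) (omega_gt : zeta2 p zeta1 < omega).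
Hypotheses (alpha_gt0 : 0 < alpha) (alpha_lt : alpha < 1 / r).
Hypotheses (eta_gt0 : 0 < eta) (eta_lt : eta < zeta3 p).

Let lmax_gt0 : 0 < lmax. Proof. exact: lt_le_trans lmax_ge. Qed.

Let zeta1_ge1 : 1 <= zeta1.
Proof. by move: zeta1_ge; rewrite ge_max => /andP[]. Qed.

Let zeta1_ge0 : 0 <= zeta1. Proof. exact: le_trans zeta1_ge1. Qed.

Let sqrt_ge (x y : R) : 0 <= x -> 0 <= y -> x <= Num.sqrt (x ^+ 2 + y).
Proof.
move=> x0 y0; rewrite -{1}[x]ger0_norm// -sqrtr_sqr ler_wsqrtr// lerDl//.
Qed.

(** Dropping the second summand under the root leaves a perfect square; the same is done for
    zeta5. *)
Let zeta4_ge : 12 / lmin + 2 * (1 + zeta1) <= zeta4 p zeta1.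
Proof.
have z0 : 0 <= 1 + zeta1 by rewrite addr_ge0// (le_trans _ zeta1_ge1).
have x0 : 0 <= 3 / lmin + 1 / 2 * (1 + zeta1).
  by rewrite addr_ge0// ?mulr_ge0 ?invr_ge0 ?(ltW lmin_gt0).
have y0 : 0 <= 1 / (2 * omega) * (1 + zeta1).
  by rewrite mulr_ge0// divr_ge0// mulr_ge0// ltW.
by rewrite /zeta4; have := sqrt_ge x0 y0; lra.
Qed.

Let zeta5_ge : 4 * ((1 + zeta1) * Lf ^+ 2 / lmin) <= zeta5 p zeta1.
Proof.
have z0 : 0 <= 1 + zeta1 by rewrite addr_ge0// (le_trans _ zeta1_ge1).
have x0 : 0 <= (Lf ^+ 2 + zeta1 * Lf ^+ 2) / lmin.
  apply: divr_ge0 (ltW lmin_gt0); apply: addr_ge0 (sqr_ge0 _) _.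
  exact: mulr_ge0 zeta1_ge0 (sqr_ge0 _).
have y0 : 0 <= Lf ^+ 2 / (omega ^+ 2 * lmin ^+ 2).
  exact: divr_ge0 (sqr_ge0 _) (mulr_ge0 (sqr_ge0 _) (sqr_ge0 _)).
by rewrite /zeta5; have := sqrt_ge x0 y0; lra.
Qed.

(* With [(n - 1) * lmin <= n] this confines [lmin] to ]1, n / (n - 1)] and makes
   [zeta1] and [omega] large. *)
Let lmin_gap : 15 + 12 / lmin <= 2 * (lmin - 1) * zeta1.
Proof.
have : (13 + zeta4 p zeta1) / (2 * lmin) <= zeta1.
  by move: zeta1_ge; rewrite ge_max => /andP[].
by rewrite ler_pdivrMr ?mulr_gt0//; have := zeta4_ge; lra.
Qed.

Let lmin_inv_gt0 : 0 < lmin^-1. Proof. by rewrite invr_gt0. Qed.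

Let lmin_gt1 : 1 < lmin.
Proof.
rewrite -subr_gt0 -(pmulr_lgt0 _ (lt_le_trans ltr01 zeta1_ge1)).
by have := lmin_gap; have := lmin_inv_gt0; lra.
Qed.

Let n1_ge1 : 1 <= n%:R - 1 :> R.
Proof. by rewrite lerBrDr -(natrD _ 1 1) ler_nat. Qed.

Let lmin_le2 : lmin <= 2.
Proof.
rewrite -(ler_pM2l (lt_le_trans ltr01 n1_ge1)).
by move: lmin_le n1_ge1; lra.
Qed.

Let lmin_inv_ge : 1 / 2 <= lmin^-1.
Proof. by rewrite ler_pdivrMr// mulrC -ler_pdivrMr// invrK mul1r. Qed.

(** As 1 / lmin >= 1/2, the gap inequality gives 21 <= 2 (lmin - 1) zeta1, while (n - 1)(lmin - 1)
    <= 1. *)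
Let zeta1_large : 21 / 2 * (n%:R - 1) <= zeta1.
Proof.
have h : (n%:R - 1) * 21 <= (n%:R - 1) * (2 * (lmin - 1) * zeta1).
  rewrite ler_wpM2l//; first by rewrite (le_trans _ n1_ge1).
  by have := lmin_gap; have := lmin_inv_ge; lra.
have : (n%:R - 1) * (lmin - 1) * zeta1 <= 1 * zeta1.
  by rewrite ler_wpM2r// ?(le_trans _ zeta1_ge1)//; move: lmin_le; lra.
by move: h; lra.
Qed.

Let phi2_gt0 : 0 < phi2 p.
Proof. by rewrite /phi2 !mulr_gt0. Qed.

Let alpha_r : alpha * r < 1.
Proof. by rewrite -ltr_pdivlMr. Qed.

Let phi2_le_ar : phi2 p <= alpha * r.
Proof. by rewrite /phi2 ler_piMr// mulr_ge0 ?ltW. Qed.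

Let phi2_le1 : phi2 p <= 1.
Proof. exact: le_trans phi2_le_ar (ltW alpha_r). Qed.

Let Pi_ge0 : 0 <= Pi.
Proof. by rewrite addr_ge0// divr_ge0// ltW. Qed.

Let Pi_phi2 : Pi * phi2 p = 2 + phi2 p.
Proof. by rewrite /contraction_weight mulrDl mul1r divfK ?gt_eqF// addrC. Qed.

Let tau_gt0 : 0 < tau.
Proof. by rewrite !mulr_gt0. Qed.

(** From eta < kappa1 / kappa2: [kappa1] is at most gamma lmax / 2, and [kappa2] is at least 6 [Pi]
    (gamma lmax)^2. *)
Lemma step_size_linear : Pi * tau <= 1 / 12.
Proof.
have k2 : 6 * Pi * (gamma ^+ 2 * lmax ^+ 2) <= kappa2 p.
  have -> : Pi = (2 + phi2 p) / phi2 p by rewrite -Pi_phi2 mulfK// gt_eqF.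
  rewrite /kappa2; have l0 := lmax_gt0; have := sqr_ge0 Lf; have := sqr_ge0 omega.
  have h1 : 0 <= 6 * (2 + phi2 p) / phi2 p * Lf ^+ 2.
    by apply: mulr_ge0 (sqr_ge0 _);
      rewrite divr_ge0 ?(ltW phi2_gt0)// mulr_ge0// addr_ge0 ?(ltW phi2_gt0).
  have h2 : 0 <= gamma ^+ 2 * lmax ^+ 2 by rewrite mulr_ge0 ?sqr_ge0.
  have h3 : 0 <= (9 * omega ^+ 2 + 3 * gamma ^+ 2) / 2 * lmax.
    by apply: mulr_ge0 (ltW l0); have := sqr_ge0 omega; have := sqr_ge0 gamma; lra.
  by move: h1 h2 h3; rewrite (mulrDr (6 * _ / _)); lra.
have g0 : 0 < gamma * lmax by rewrite mulr_gt0.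
have Pg : 0 <= 6 * Pi * (gamma ^+ 2 * lmax ^+ 2).
  exact: mulr_ge0 (mulr_ge0 (ler0n _ 6) Pi_ge0) (mulr_ge0 (sqr_ge0 _) (sqr_ge0 _)).
have k1 : kappa1 p <= gamma * lmax / 2.
  have : gamma * lmin <= gamma * lmax by rewrite ler_pM2l.
  by rewrite /kappa1; have := sqr_ge0 Lf; have := omega_gt0; lra.
have k2_ge0 : 0 <= kappa2 p by exact: le_trans k2.
have ek : eta < kappa1 p / kappa2 p by move: eta_lt; rewrite lt_min => /andP[].
have ek' : kappa2 p * eta <= kappa1 p.
  (* A zero denominator would make the quotient 0, against eta > 0. *)
  have [k20|] := eqVneq (kappa2 p) 0.
    by move: ek; rewrite k20 invr0 mulr0 => /lt_trans/(_ eta_gt0); rewrite ltxx.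
  by move=> k20; rewrite mulrC -ler_pdivlMr ?lt_def ?k20// ltW.
rewrite -(ler_pM2l g0); have := ler_wpM2r (ltW eta_gt0) k2.
by move: ek' k1; lra.
Qed.

Let r0_ge : 2 * (r - 1) ^+ 2 <= r0 p.
Proof.
rewrite /r0; have : 0 <= r ^+ 2 * (1 - phi) by rewrite mulr_ge0 ?sqr_ge0// subr_ge0.
by have -> : (1 - r) ^+ 2 = (r - 1) ^+ 2; [ring|lra].
Qed.

(* The last term of [zeta3] is the positive root of
   [kappa9 X^2 + kappa8 X = kappa7]. *)
Lemma step_size_quadratic : 6 * (Pi * tau ^+ 2) * r0 p <= kappa7 p.
Proof.
have r00 : 0 <= r0 p by apply: le_trans r0_ge; rewrite mulr_ge0 ?sqr_ge0.
have s0 : 0 <= 6 * gamma ^+ 2 * lmax ^+ 2 + (9 * omega ^+ 2 + 3 * gamma ^+ 2) / 2 * lmax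
          + 3 * omega ^+ 2 + 3 / 2.
  have h2 : 0 <= gamma ^+ 2 * lmax ^+ 2 by rewrite mulr_ge0 ?sqr_ge0.
  have h3 : 0 <= (9 * omega ^+ 2 + 3 * gamma ^+ 2) / 2 * lmax.
    by apply: mulr_ge0 (ltW lmax_gt0); have := sqr_ge0 omega; have := sqr_ge0 gamma; lra.
  by have := sqr_ge0 omega; lra.
have m0 : 0 <= 6 * gamma ^+ 2 * lmax ^+ 2 * r0 p * Pi.
  apply: mulr_ge0 Pi_ge0; apply: mulr_ge0 r00; apply: mulr_ge0 (sqr_ge0 _).
  exact: mulr_ge0 (ler0n _ 6) (sqr_ge0 _).
have k9 : 6 * gamma ^+ 2 * lmax ^+ 2 * r0 p * Pi <= kappa9 p.
  by rewrite /kappa9 lerDl mulr_ge0.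
have k9_ge0 : 0 <= kappa9 p by exact: le_trans k9.
have k8 : 0 < kappa8 p.
  rewrite /kappa8 ltr_pwDl//; last by rewrite mulr_ge0// mulr_ge0// ltW.
  by rewrite mulr_gt0// mulr_gt0// addr_gt0// mulr_gt0.
have k7 : 0 <= kappa7 p by rewrite /kappa7; have := phi2_gt0; nra.
suff quad : kappa9 p * eta ^+ 2 + kappa8 p * eta <= kappa7 p.
  have := ler_wpM2r (sqr_ge0 eta) k9; have := mulr_ge0 (ltW k8) (ltW eta_gt0).
  by move: quad; rewrite !exprMn; lra.
move: eta_lt; rewrite /zeta3 !lt_min => /and4P[_ _ _].
case: eqP => [-> ek|/eqP k90 ek].
  by rewrite mul0r add0r mulrC -ler_pdivlMr// ltW.
have k9_gt0 : 0 < kappa9 p by rewrite lt_def k90.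
move: ek; rewrite ltr_pdivlMr ?mulr_gt0// ltrBrDr => ek.
have a0 : 0 <= eta * (2 * kappa9 p) + kappa8 p.
  by apply: addr_ge0 (ltW k8); rewrite !mulr_ge0// ltW.
have b0 : 0 <= kappa8 p ^+ 2 + 4 * kappa7 p * kappa9 p.
  apply: addr_ge0 (sqr_ge0 _) _; apply: mulr_ge0 k9_ge0.
  exact: mulr_ge0 (ler0n _ 4) k7.
rewrite -(ler_pM2l k9_gt0).
have : (eta * (2 * kappa9 p) + kappa8 p) ^+ 2 <= kappa8 p ^+ 2 + 4 * kappa7 p * kappa9 p.
  by rewrite -[leRHS](sqr_sqrtr b0); apply: lerXn2r; rewrite ?nnegrE ?sqrtr_ge0// ltW.
by lra.
Qed.

(** The quantity is tau / alpha. The linear condition gives tau <= phi2 / 24, and the quadratic one,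
    as r0 >= 2 (r - 1)^2, gives tau (r - 1) <= phi2 / 6. Adding them, tau r <= 5 phi2 / 24 <= 5
    alpha r / 24. This keeps the shift of x small although alpha may be small. *)
Lemma step_size_alpha : zeta1 * (eta * omega / alpha) * lmax <= 5 / 24.
Proof.
have -> : zeta1 * (eta * omega / alpha) * lmax = tau / alpha by rewrite gamma_eq; ring.
rewrite ler_pdivrMr//.
have P0 := phi2_gt0; have t0 := tau_gt0.
have tP : tau <= phi2 p / 24.
  have := ler_wpM2r (ltW P0) step_size_linear; rewrite mulrAC Pi_phi2.
  by have := mulr_ge0 (ltW P0) (ltW t0); lra.
have tr : tau * (r - 1) <= phi2 p / 6.
  have h : 12 * (Pi * tau ^+ 2) * (r - 1) ^+ 2 <= phi2 p / 2 * (1 + phi2 p).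
    apply: le_trans step_size_quadratic.
    have Pt : 0 <= 6 * (Pi * tau ^+ 2).
      exact: mulr_ge0 (ler0n _ 6) (mulr_ge0 Pi_ge0 (sqr_ge0 _)).
    by have := ler_wpM2l Pt r0_ge; lra.
  have h2 : 12 * (2 + phi2 p) * (tau * (r - 1)) ^+ 2 <= (2 + phi2 p) * (phi2 p ^+ 2 / 3).
    have := ler_wpM2r (ltW P0) h.
    have -> : 12 * (Pi * tau ^+ 2) * (r - 1) ^+ 2 * phi2 p = 12 * (Pi * phi2 p) * (tau * (r - 1))
      ^+ 2 by ring.
    rewrite Pi_phi2 => h'; apply: le_trans h' _.
    have : 0 <= phi2 p ^+ 2 * (1 - phi2 p) by rewrite mulr_ge0 ?sqr_ge0// subr_ge0.
    by lra.
  have P2 : 0 < 2 + phi2 p by rewrite addr_gt0.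
  have h3 : (tau * (r - 1)) ^+ 2 <= (phi2 p / 6) ^+ 2.
    rewrite -(ler_pM2l P2); move: h2; lra.
  apply: le_trans (ler_norm _) _; rewrite -[leRHS]ger0_norm; last by rewrite divr_ge0// ltW.
  by rewrite -ler_sqr ?nnegrE// !real_normK ?num_real.
rewrite -(ler_pM2r r_gt0).
have : alpha * r * phi <= alpha * r by rewrite ler_piMr// mulr_ge0 ?ltW.
by move: tP tr; rewrite /phi2; lra.
Qed.

Lemma parameters_tuned : tuned n eta omega zeta1 (eta * omega / alpha) Lf lmin lmax (phi2 p).
Proof.
(* The summand 6 is a lower bound for 12 / lmin; with zeta1 >= 21/2 it makes omega >= 2 (1 + 21/2) +
   6 = 29. *)
have z1 := zeta1_large; have n1 := n1_ge1; have zo : 2 * (1 + zeta1) + 6 <= omega.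
  have : zeta4 p zeta1 < omega by apply: le_lt_trans omega_gt; rewrite le_max lexx.
  by have := zeta4_ge; have := lmin_inv_ge; lra.
split => //.
- by lra.
- by lra.
- by lra.
- by rewrite (ltW lmin_gt1).
- have : zeta5 p zeta1 < omega by apply: le_lt_trans omega_gt; rewrite le_max lexx orbT.
  move=> z5; have := le_trans zeta5_ge (ltW z5).
  by rewrite mulrA ler_pdivrMr.
(* For n >= 2, 304.5 (n - 1) exceeds 150 n. *)
- have : 21 / 2 * (n%:R - 1) * 29 <= zeta1 * omega by apply: ler_pM => //; lra.
  by lra.
- by have := step_size_linear; rewrite gamma_eq.
- by rewrite divr_ge0 ?mulr_ge0// ltW.
- exact: step_size_alpha.
Qed.

End parameters.

(** * Lower bounds on the constants of the final estimate *)

Section constants_bounds.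
Context {R : realType} {n : nat}.
Variables (d : nat) (p : setting R n).
Local Notation Lf := (p_Lf p).
Local Notation eta := (p_eta p).
Local Notation gamma := (p_gamma p).
Local Notation omega := (p_omega p).
Hypotheses (lmin_gt0 : 0 < lmin p) (lmax_ge0 : 0 <= lmax p) (phi2_gt0 : 0 < phi2 p).
Hypotheses (Lf_gt0 : 0 < Lf) (gamma_gt0 : 0 < gamma) (omega_gt0 : 0 < omega) (eta_gt0 : 0 < eta).

(** The summand 1 / (2 eta) of [A0] supplies the order eta^-1 of [kappa10], and also the lower bound
    on [kappa12]. *)
Lemma A0_ge : 1 / (2 * eta) <= A0 p.
Proof.
have e2 : 0 <= (1 + 2 * eta) * Lf ^+ 2 / (2 * eta * omega ^+ 2 * lmin p ^+ 2).
  by rewrite !(mulr_ge0, invr_ge0, exprn_ge0, addr_ge0)// ltW.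
have t0 : 0 <= Lf ^+ 2 / (omega ^+ 2 * lmin p).
  by rewrite !(mulr_ge0, invr_ge0, exprn_ge0)// ltW.
have t1 : 0 <= gamma * Lf ^+ 2 / (omega ^+ 3 * lmin p).
  by rewrite !(mulr_ge0, invr_ge0, exprn_ge0)// ltW.
have t2 : 0 <= Lf ^+ 2 / (2 * eta * omega * lmin p).
  by rewrite !(mulr_ge0, invr_ge0, exprn_ge0)// ltW.
have t3 : 0 <= gamma * Lf ^+ 2 / (2 * eta * omega ^+ 2 * lmin p).
  by rewrite !(mulr_ge0, invr_ge0, exprn_ge0)// ltW.
by rewrite /A0; have := sqr_ge0 Lf; have := Lf_gt0; lra.
Qed.

Lemma kappa10_ge : 2 / eta <= kappa10 d p.
Proof.
apply: (@le_trans _ _ (4 * A0 p)).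
  by have := A0_ge; rewrite invfM; lra.
rewrite /kappa10 /=.
have t0 : 0 <= spectral_radius (1%:M + (eta * gamma) *: (kron_id (laplacian (p_W p)) : 'M[R]_(n *
  d))) ^+ 2 / eta.
  by apply: mulr_ge0 (sqr_ge0 _) _; rewrite invr_ge0 ltW.
have t1 : 0 <= (1 / 2 + 3 * omega + 2 * omega * lmax p) * eta.
  by rewrite !(mulr_ge0, addr_ge0)// ltW.
have t2 : 0 <= (1 / (eta * omega) + 1 / 2) * (1 / lmin p).
  by rewrite !(mulr_ge0, invr_ge0, addr_ge0)// ltW.
have P0 : 0 <= (phi2 p)^-1 by rewrite invr_ge0 ltW.
have t4 : 0 <= 6 * spectral_radius ((eta * gamma) *: (kron_id (laplacian (p_W p)) : 'M[R]_(n *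
  d)) - 1%:M) ^+ 2
    * (1 + 2 / phi2 p).
  by apply: mulr_ge0 (mulr_ge0 (ler0n _ 6) (sqr_ge0 _)) _; lra.
have t5 : 0 <= eta ^+ 2 * (6 * gamma ^+ 2 * lmax p ^+ 2
    + (9 * omega ^+ 2 + 3 * gamma ^+ 2) / 2 * lmax p + 3 * omega ^+ 2 + 3 / 2).
  by rewrite !(mulr_ge0, addr_ge0, exprn_ge0, sqr_ge0)// ?ltW.
have t3 : 0 <= 12 / phi2 p by rewrite mulr_ge0.
by rewrite -!addrA lerDl !(addrA, addr_ge0).
Qed.

Lemma kappa11_ge (zeta1 : R) : gamma = zeta1 * omega ->
  (1 + zeta1) / lmin p * eta^-1 / 2 <= kappa11 p.
Proof.
move=> gE; rewrite /kappa11.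
have -> : (1 + zeta1) / lmin p / eta / 2 = (lmin p)^-1 * (1 / (2 * eta) + gamma / (2 * eta *
  omega)).
  by rewrite gE; field; rewrite !gt_eqF.
rewrite ler_wpM2l ?invr_ge0 ?(ltW lmin_gt0)//.
have t0 : 0 <= 3 * gamma / (2 * omega) by rewrite !(mulr_ge0, invr_ge0)// ltW.
have t1 : 0 <= eta * omega by rewrite mulr_ge0// ltW.
have t2 : 0 <= (lmin p)^-1 / eta by rewrite !(mulr_ge0, invr_ge0)// ltW.
by lra.
Qed.

(** The left-hand side is the coefficient of the squared mean of v in the one-step bound. *)
Lemma kappa12_ge : 2 * (eta * omega ^+ 2) <= kappa12 p.
Proof.
rewrite /kappa12; have := eta_gt0.
have k0 : 0 <= 4 * eta ^+ 2 * omega ^+ 2 by rewrite !(mulr_ge0, exprn_ge0)// ltW.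
have := ler_wpM2l k0 A0_ge.
have -> : 4 * eta ^+ 2 * omega ^+ 2 * (1 / (2 * eta)) = 2 * (eta * omega ^+ 2).
  by field; rewrite gt_eqF.
by lra.
Qed.

Lemma kappa_bar3_ge : 4 / eta <= kappa_bar3 p.
Proof. by rewrite /kappa_bar3 le_max lexx. Qed.

End constants_bounds.

(** * Expected descent *)

Section one_step_compressed.
Context {R : realType} {n d : nat}.
Variables (e : rel 'I_n) (W : 'M[R]_n) (lam : nat -> R) (Rm : 'M[R]_(n, n.-1)).
Hypotheses (n_gt0 : (0 < n)%N) (W_adj : weighted_adjacency e W).
Hypotheses (W_stoch : doubly_stochastic W).
Hypotheses (L_eigen : nonzero_eigenbasis (laplacian W) lam Rm).
Variables (eta om zt b alpha Lf Phi : R).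
Local Notation L := (laplacian W).
Local Notation lmin := (min_pos_eigenvalue L).
Local Notation lmax := (spectral_radius L).
Hypothesis tuning : tuned n eta om zt b Lf lmin lmax Phi.
Variable f : 'I_n -> 'cV[R]_d -> R.
Hypothesis f_bounded : (-oo < min_value (average f))%E.
Implicit Types x v xc xi ze Cv Y : 'I_n -> 'cV[R]_d.

Lemma norm2_ge0 x : 0 <= norm2 x.
Proof. by apply: sumr_ge0 => i _; apply: sumr_ge0 => c _; exact: sqr_ge0. Qed.

(** On a mode, [mode_Q] is half of (z + p)^2 + ((1 + zt) lam - 1) p^2, with lam >= 1 and zt >= 0. *)
Lemma energy_ge0 x v xc : 0 <= energy W lam Rm om zt b f x v xc.
Proof.
have [lmin0 lminj] := min_pos_eigenvalue_bounds n_gt0 W_adj W_stoch L_eigen.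
have n1 := network_size_gt1 n_gt0 W_adj W_stoch.
have zt1 := tuned_zt tuning; have /andP[l1 _] := tuned_lmin tuning.
apply: addr_ge0; last first.
  by rewrite mulr_ge0// subr_ge0 min_value_le.
apply: sumr_ge0 => c _; apply: addr_ge0.
  apply: sumr_ge0 => j _; set z := vmode _ _ _ _; set q := _^-1 * _.
  have lj : 1 <= lam_mode lam j by exact: le_trans l1 (lminj j).
  have zl : 0 <= ((1 + zt) * lam_mode lam j - 1) * q ^+ 2.
    apply: mulr_ge0 (sqr_ge0 _); rewrite subr_ge0.
    have : 0 <= zt * lam_mode lam j by apply: mulr_ge0 => //; lra.
    by move: lj; lra.
  by rewrite /mode_Q; have := sqr_ge0 (z + q); move: zl; lra.
have ln : 0 < lam n.
  have jn : (n - 2 < n.-1)%N by rewrite -subn1 ltn_sub2l.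
  by have := lminj (Ordinal jn); rewrite /lam_mode /= subnK// => /(lt_le_trans lmin0).
apply: mulr_ge0 (ler0n _ _) (mulr_ge0 (mulr_ge0 _ (mulr_ge0 _ _)) (sqr_ge0 _)); first by lra.
  by lra.
by rewrite invr_ge0 ltW.
Qed.

(** Y - alpha C(Y) is the convex combination of Y and Y - C(Y) / r with weights 1 - alpha r and
    alpha r. *)
Lemma compressed_contraction (r : R) Y Cv : 0 <= alpha * r <= 1 -> r != 0 ->
  norm2 (fun i => Y i - alpha *: Cv i) <=
  (1 - alpha * r) * norm2 Y + alpha * r * norm2 (fun i => r^-1 *: Cv i - Y i).
Proof.
move=> /andP[ar0 ar1] r0; rewrite /norm2 !mulr_sumr -big_split; apply: ler_sum => i _ /=.
rewrite !mulr_sumr -big_split; apply: ler_sum => c _ /=; rewrite !mxE.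
set y := Y i c 0; set u := Cv i c 0.
have -> : y - alpha * u = (1 - alpha * r) * y - alpha * r * (r^-1 * u - y) by field.
move: (r^-1 * u - y) => D; move: (alpha * r) ar0 ar1 => t t0 t1.
have := mulr_ge0 (mulr_ge0 t0 (_ : 0 <= 1 - t)) (sqr_ge0 (y + D)).
by rewrite subr_ge0 t1 => /(_ isT); lra.
Qed.

(** Here C(Y) - Y = r (C(Y) / r - Y) - (1 - r) Y. Inserting the compressor bound in the result gives
    exactly the constant [r0]. *)
Lemma compressed_gap (r : R) Y Cv : r != 0 ->
  norm2 (fun i => Cv i - Y i) <=
  2 * r ^+ 2 * norm2 (fun i => r^-1 *: Cv i - Y i) + 2 * (1 - r) ^+ 2 * norm2 Y.
Proof.
move=> r0; rewrite /norm2 !mulr_sumr -big_split; apply: ler_sum => i _ /=.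
rewrite !mulr_sumr -big_split; apply: ler_sum => c _ /=; rewrite !mxE.
set y := Y i c 0; set u := Cv i c 0.
have -> : u - y = r * (r^-1 * u - y) - (1 - r) * y by field.
move: (r^-1 * u - y) => D.
by have := sqr_ge0 (r * D + (1 - r) * y); lra.
Qed.

End one_step_compressed.

Section functional_measurability.
Context {R : realType} {n d : nat} {dT : measure_display} {T : measurableType dT}.
Variables (W : 'M[R]_n) (lam : nat -> R) (Rm : 'M[R]_(n, n.-1)) (om zt b Lf : R).
Variable f : 'I_n -> 'cV[R]_d -> R.
Hypotheses (Lf_gt0 : 0 < Lf) (f_smooth : forall i, smooth Lf (f i)).
Implicit Types g x v xc : T -> 'I_n -> 'cV[R]_d.

Lemma measurable_vmode g c j : measurable_agents g ->
  measurable_fun setT (fun w => vmode Rm (g w) c j).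
Proof. by move=> mg; apply: measurable_sum => i; apply: measurable_funM => //; exact: mg. Qed.

Lemma measurable_norm2 g : measurable_agents g -> measurable_fun setT (fun w => norm2 (g w)).
Proof.
move=> mg; apply: measurable_sum => i; apply: measurable_sum => c.
exact: measurable_funX.
Qed.

Lemma measurable_dev2 g : measurable_agents g -> measurable_fun setT (fun w => dev2 Rm (g w)).
Proof.
move=> mg; apply: measurable_sum => c; apply: measurable_sum => j.
by apply: measurable_funX; exact: measurable_vmode.
Qed.

Lemma measurable_mean2 g : measurable_agents g -> measurable_fun setT (fun w => mean2 (g w)).
Proof.
by move=> mg; apply: measurable_sum => c; apply: measurable_funX; exact: measurable_mean.
Qed.

Lemma measurable_agents_mean_grad x : measurable_agents x ->
  measurable_agents (fun w i => grad (f i) (mean (x w))).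
Proof.
move=> mx; apply: (measurable_agents_grad Lf_gt0 f_smooth (g := fun w _ => mean (x w))).
by move=> i c; exact: (measurable_mean c mx).
Qed.

Lemma measurable_mean_grad x c : measurable_agents x ->
  measurable_fun setT (fun w => mean_grad f (x w) c 0).
Proof. by move=> mx; apply: measurable_mean; exact: measurable_agents_mean_grad. Qed.

Lemma measurable_energy x v xc : measurable_agents x -> measurable_agents v ->
  measurable_agents xc ->
  measurable_fun setT (fun w => energy W lam Rm om zt b f (x w) (v w) (xc w)).
Proof.
move=> mx mv mxc.
have ms : measurable_agents (fun w => shifted_x W zt b (x w) (xc w)).
  by apply: measurable_agentsD => //; apply: measurable_agentsZ; exact: measurable_agents_lap.
have mw : measurable_agents (fun w => shifted_v W om b f (x w) (v w) (xc w)).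
  apply: measurable_agentsB; last by apply: measurable_agentsZ; exact: measurable_agents_lap.
  by apply: measurable_agentsD => //; apply: measurable_agentsZ; exact: measurable_agents_mean_grad.
apply: measurable_funD.
  apply: measurable_sum => c; apply: measurable_funD.
    apply: measurable_sum => j; rewrite /mode_Q.
    have mz := measurable_vmode c j ms; have mu := measurable_vmode c j mw.
    have mlu := measurable_funM (measurable_cst (lam_mode lam j)^-1) mu.
    apply: measurable_funD; last exact: measurable_funM.
    by apply: measurable_funD; apply: measurable_funM => //; exact: measurable_funX.
  apply: measurable_funM => //; apply: measurable_funM => //.
  by apply: measurable_funX; exact: measurable_mean.
apply: measurable_funM => //; apply: measurable_funB => //.
apply: measurable_funM => //; apply: measurable_sum => i.
apply: measurable_comp_column; last by move=> c; exact: measurable_mean.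
exact: smooth_continuous (f_smooth i).
Qed.

End functional_measurability.

Section expected_descent.
Context {R : realType} {n d : nat}.
Variables (e : rel 'I_n) (W : 'M[R]_n) (lam : nat -> R) (Rm : 'M[R]_(n, n.-1)).
Hypotheses (n_gt0 : (0 < n)%N) (W_adj : weighted_adjacency e W).
Hypotheses (W_stoch : doubly_stochastic W).
Hypotheses (L_eigen : nonzero_eigenbasis (laplacian W) lam Rm).
Variables (eta om zt b alpha r phi Lf : R).
Local Notation L := (laplacian W).
Local Notation lmin := (min_pos_eigenvalue L).
Local Notation lmax := (spectral_radius L).
Local Notation Phi := (alpha * r * phi).
Local Notation tau := (eta * (zt * om) * lmax).
Hypothesis tuning : tuned n eta om zt b Lf lmin lmax Phi.
Hypotheses (alpha_gt0 : 0 < alpha) (b_alpha : b * alpha = eta * om).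
Hypotheses (r_gt0 : 0 < r) (alpha_r : alpha * r <= 1) (phi_le1 : phi <= 1).
Hypothesis quadratic : 6 * (contraction_weight Phi * tau ^+ 2)
  * (2 * r ^+ 2 * (1 - phi) + 2 * (1 - r) ^+ 2) <= Phi / 2 * (1 + Phi).
Variable f : 'I_n -> 'cV[R]_d -> R.
Hypothesis f_smooth : forall i, smooth Lf (f i).
Hypothesis f_bounded : (-oo < min_value (average f))%E.

(** [weight_Y] and [weight_D] are the coefficients of |Y|^2 and of |C(Y) / r - Y|^2 once the two
    compressed quantities of [one_step] are split in this way. *)
Definition weight_Y : R := (1 + Phi / 2) * (1 - alpha * r)
  + 5 / 2 * (contraction_weight Phi * tau ^+ 2) * (2 * (1 - r) ^+ 2) + 5 * tau.
Definition weight_D : R := (1 + Phi / 2) * (alpha * r)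
  + 5 / 2 * (contraction_weight Phi * tau ^+ 2) * (2 * r ^+ 2).

Let Phi_gt0 : 0 < Phi. Proof. exact: tuned_Phi tuning. Qed.

Let Phi2_ge0 : 0 <= 1 + Phi / 2.
Proof. by rewrite addr_ge0// divr_ge0// ltW. Qed.

Let Pi_ge0 : 0 <= contraction_weight Phi.
Proof. by rewrite addr_ge0// divr_ge0// ltW. Qed.

Let tau_ge0 : 0 <= tau.
Proof.
have e0 := tuned_eta tuning; have z1 := tuned_zt tuning; have o1 := tuned_om tuning.
have /andP[l1 _] := tuned_lmin tuning; have l2 := tuned_lmax tuning.
by rewrite !mulr_ge0 ?(ltW e0)//; lra.
Qed.

Let Pt_ge0 : 0 <= 5 / 2 * (contraction_weight Phi * tau ^+ 2).
Proof. by apply: mulr_ge0 (mulr_ge0 Pi_ge0 (sqr_ge0 _)); rewrite divr_ge0. Qed.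

Lemma weight_D_ge0 : 0 <= weight_D.
Proof.
apply: addr_ge0; last by apply: mulr_ge0 Pt_ge0 _; rewrite mulr_ge0 ?sqr_ge0.
by apply: mulr_ge0 Phi2_ge0 _; rewrite mulr_ge0 ?ltW.
Qed.

Lemma weight_Y_ge0 : 0 <= weight_Y.
Proof.
apply: addr_ge0; last by rewrite mulr_ge0.
apply: addr_ge0; last by apply: mulr_ge0 Pt_ge0 _; rewrite mulr_ge0 ?sqr_ge0.
by apply: mulr_ge0 Phi2_ge0 _; rewrite subr_ge0.
Qed.

(** The factor (1 + Phi / 2)(1 - Phi) gains Phi / 2 to first order. The quadratic condition costs
    5/12 of Phi (1 + Phi) / 2 and 5 tau costs 5 Phi / 24, which leaves Phi / 12. A total weight of
    at most 1 lets the residual term of the potential carry over from one step to the next. *)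
Lemma weights_le1 : weight_Y + weight_D * (1 - phi) <= 1.
Proof.
have P1 := tuned_Phi_le tuning; have P0 := Phi_gt0.
have step : 24 * tau <= Phi.
  have := ler_wpM2r (ltW P0) (tuned_step tuning).
  have -> : contraction_weight Phi * tau * Phi = (2 + Phi) * tau.
    by rewrite mulrAC /contraction_weight mulrDl mul1r divfK ?gt_eqF// (addrC Phi).
  by have := mulr_ge0 (ltW P0) tau_ge0; lra.
have P2 : 0 <= Phi ^+ 2 by exact: sqr_ge0.
have -> : weight_Y + weight_D * (1 - phi) = (1 + Phi / 2) * (1 - Phi)
   + 5 / 12 * (6 * (contraction_weight Phi * tau ^+ 2)
       * (2 * r ^+ 2 * (1 - phi) + 2 * (1 - r) ^+ 2)) + 5 * tau.
  by rewrite /weight_Y /weight_D; field.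
by move: quadratic step P2; lra.
Qed.

Lemma one_step_compressed x v xc xi ze xi' Cv :
  energy W lam Rm om zt b f (next_x W eta om zt f x v xc xi Cv) (next_v W eta om v xc ze Cv)
      (next_xc alpha xc Cv)
    + norm2 (residual (next_x W eta om zt f x v xc xi Cv) (next_xc alpha xc Cv) xi')
    + eta / 4 * (n%:R * dev2 Rm x + n%:R * \sum_c mean_grad f x c 0 ^+ 2) <=
  energy W lam Rm om zt b f x v xc
    + weight_Y * norm2 (residual x xc xi)
    + weight_D * norm2 (fun i => r^-1 *: Cv i - residual x xc xi i)
    + 3 / 2 * eta^-1 * norm2 xi + 2 / 5 * ((1 + zt) / lmin * eta^-1) * norm2 ze
    + 1 / 50 * eta^-1 * norm2 xi' + 2 * (eta * om ^+ 2) * (n%:R * mean2 v).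
Proof.
set Y := residual x xc xi; apply: le_trans (one_step n_gt0 W_adj W_stoch L_eigen tuning b_alpha
  f_smooth x v xc xi ze xi' Cv) _; rewrite -/Y.
have r0 : r != 0 by rewrite gt_eqF.
have ar : 0 <= alpha * r <= 1 by rewrite alpha_r mulr_ge0 ?ltW.
have := ler_wpM2l Phi2_ge0 (compressed_contraction Y Cv ar r0).
have := ler_wpM2l Pt_ge0 (compressed_gap Y Cv r0).
rewrite /weight_Y /weight_D.
move: (norm2 Y) (norm2 (fun i => Cv i - Y i)) (norm2 (fun i => Y i - alpha *: Cv i)) => nY nE nA.
move: (norm2 (fun i => r^-1 *: Cv i - Y i)) => nD.
move: (contraction_weight Phi * tau ^+ 2) => PT; move: (energy _ _ _ _ _ _ _ _ _ _) => E0.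
move: (Phi / 2) (alpha * r) => P ar';
  move: (norm2 xi) (norm2 ze) (norm2 xi') (n%:R * mean2 v) => n1 n2 n3 n4.
move: ((1 + zt) / lmin * eta^-1) (eta * om ^+ 2) (eta^-1) => c1 c2 c3.
by lra.
Qed.

End expected_descent.

Section nonneg_integrals.
Context {R : realType} {dT : measure_display} {T : measurableType dT}.
Variable P : probability T R.
Implicit Types a h : T -> R.

Definition nonneg_measurable a : Prop := measurable_fun setT a /\ forall w, 0 <= a w.

Lemma nonneg_measurable_addZ a h (c : R) : 0 <= c -> nonneg_measurable a ->
  nonneg_measurable h -> nonneg_measurable (fun w => a w + c * h w).
Proof.
move=> c0 [ma a0] [mh h0]; split; last by move=> w; rewrite addr_ge0// mulr_ge0.
by apply: measurable_funD => //; exact: measurable_funM.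
Qed.

Lemma integral_addZ a h (c : R) : 0 <= c -> nonneg_measurable a -> nonneg_measurable h ->
  (\int[P]_w (a w + c * h w)%:E = \int[P]_w (a w)%:E + c%:E * \int[P]_w (h w)%:E)%E.
Proof.
move=> c0 [ma a0] [mh h0]; have mh' : measurable_fun setT (EFin \o h) by exact/measurable_EFinP.
under eq_integral do rewrite EFinD EFinM.
rewrite ge0_integralD//.
- rewrite ge0_integralZl//; by move=> w _; rewrite lee_fin.
- by move=> w _; rewrite lee_fin.
- exact/measurable_EFinP.
- by move=> w _; rewrite -EFinM lee_fin mulr_ge0.
- by apply/measurable_EFinP; exact: measurable_funM.
Qed.

End nonneg_integrals.

Section expected_descent.
Context {R : realType} {n d : nat} {dO dS : measure_display}.
Context {Omega : measurableType dO} {V : measurableType dS}.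
Variables (e : rel 'I_n) (W : 'M[R]_n) (lam : nat -> R) (Rm : 'M[R]_(n, n.-1)).
Hypotheses (n_gt0 : (0 < n)%N) (W_adj : weighted_adjacency e W).
Hypotheses (W_stoch : doubly_stochastic W).
Hypotheses (L_eigen : nonzero_eigenbasis (laplacian W) lam Rm).
Variables (eta om zt b alpha r phi Lf : R).
Local Notation L := (laplacian W).
Local Notation lmin := (min_pos_eigenvalue L).
Local Notation lmax := (spectral_radius L).
Local Notation Phi := (alpha * r * phi).
Local Notation tau := (eta * (zt * om) * lmax).
Hypothesis tuning : tuned n eta om zt b Lf lmin lmax Phi.
Hypotheses (alpha_gt0 : 0 < alpha) (b_alpha : b * alpha = eta * om).
Hypotheses (r_gt0 : 0 < r) (alpha_r : alpha * r <= 1) (phi_le1 : phi <= 1).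
Hypothesis quadratic : 6 * (contraction_weight Phi * tau ^+ 2)
  * (2 * r ^+ 2 * (1 - phi) + 2 * (1 - r) ^+ 2) <= Phi / 2 * (1 + Phi).
Variable f : 'I_n -> 'cV[R]_d -> R.
Hypothesis f_smooth : forall i, smooth Lf (f i).
Hypothesis f_bounded : (-oo < min_value (average f))%E.
Variables (P : probability Omega R) (mu : probability V R) (C : V -> 'cV[R]_d -> 'cV[R]_d).
Hypotheses (C_meas : measurable_compressor C) (C_bound : compressor_bound mu C phi r).
Variables (xi_x xi_v : 'I_n -> nat -> 'I_d -> {RV P >-> R}) (U : 'I_n -> nat -> {RV P >-> V}).
Hypothesis U_law : forall i k (B : set V), measurable B -> P (U i k @^-1` B) = mu B.
Hypothesis indep : mutually_independent P (source_sigma_algebra xi_x xi_v U).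
Variables (x v xc : nat -> Omega -> 'I_n -> 'cV[R]_d) (x0 : 'I_n -> 'cV[R]_d).
Let xi k w : 'I_n -> 'cV[R]_d := fun i => noise_vec (xi_x i k) w.
Let ze k w : 'I_n -> 'cV[R]_d := fun i => noise_vec (xi_v i k) w.
Let Cv := compressed C xi (fun k i w => U i k w) x xc.
Hypothesis x_0 : forall w, x 0%N w = x0.
Hypothesis v_0 : forall w, v 0%N w = fun=> 0.
Hypothesis xc_0 : forall w, xc 0%N w = fun=> 0.
Hypothesis x_S : forall k w,
  x k.+1 w = next_x W eta om zt f (x k w) (v k w) (xc k w) (xi k w) (Cv k w).
Hypothesis v_S : forall k w,
  v k.+1 w = next_v W eta om (v k w) (xc k w) (ze k w) (Cv k w).
Hypothesis xc_S : forall k w, xc k.+1 w = next_xc alpha (xc k w) (Cv k w).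
Let Y k w := residual (x k w) (xc k w) (xi k w).

Variables (N : nat -> R) (MV : nat -> \bar R).
Hypothesis xi_bound : forall k, (\int[P]_w (norm2 (xi k w))%:E <= (N k)%:E)%E.
Hypothesis ze_bound : forall k, (\int[P]_w (norm2 (ze k w))%:E <= (N k)%:E)%E.
Hypothesis v_bound : forall k, (\int[P]_w (n%:R * mean2 (v k w))%:E <= MV k)%E.

Definition potential k w : R := energy W lam Rm om zt b f (x k w) (v k w) (xc k w) + norm2 (Y k w).
Definition drift k w : R := n%:R * dev2 Rm (x k w) + n%:R * \sum_c mean_grad f (x k w) c 0 ^+ 2.

Let Lf_gt0 : 0 < Lf. Proof. exact: tuned_Lf tuning. Qed.

Let xi_meas k : measurable_agents (xi k).
Proof. by move=> i c; under eq_fun do rewrite mxE; exact: measurable_funPT. Qed.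

Let ze_meas k : measurable_agents (ze k).
Proof. by move=> i c; under eq_fun do rewrite mxE; exact: measurable_funPT. Qed.

Let U_meas k i : measurable_fun setT (fun w => U i k w).
Proof. exact: measurable_funPT. Qed.

Let run_meas k : [/\ measurable_agents (x k), measurable_agents (v k) & measurable_agents (xc k)].
Proof.
exact: (measurable_run Lf_gt0 f_smooth C_meas x_0 v_0 xc_0 x_S v_S xc_S
  (fun t (_ : (t < k)%N) => xi_meas t) (fun t _ => ze_meas t) (fun t i _ => U_meas t i)).
Qed.

Let norm2_nm (g : Omega -> 'I_n -> 'cV[R]_d) : measurable_agents g ->
  nonneg_measurable (fun w => norm2 (g w)).
Proof. by move=> mg; split; [exact: measurable_norm2|move=> w; exact: norm2_ge0]. Qed.

Let energy_nm k : nonneg_measurable (fun w => energy W lam Rm om zt b f (x k w) (v k w) (xc k w)).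
Proof.
have [mx mv mxc] := run_meas k; split;
  first exact: (measurable_energy W lam Rm om zt b Lf_gt0 f_smooth mx mv mxc).
by move=> w; exact: (energy_ge0 n_gt0 W_adj W_stoch L_eigen tuning f_bounded).
Qed.

Let Y_meas k : measurable_agents (Y k).
Proof. by have [mx _ mxc] := run_meas k; exact: measurable_residual. Qed.

Let drift_nm k : nonneg_measurable (drift k).
Proof.
have [mx mv mxc] := run_meas k; split.
  apply: measurable_funD; apply: measurable_funM => //; first exact: measurable_dev2.
  by apply: measurable_sum => c; apply: measurable_funX;
    exact: (measurable_mean_grad Lf_gt0 f_smooth c mx).
move=> w; apply: addr_ge0; apply: mulr_ge0 => //.
  by apply: sumr_ge0 => c _; apply: sumr_ge0 => j _; exact: sqr_ge0.
by apply: sumr_ge0 => c _; exact: sqr_ge0.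
Qed.

Lemma expected_drift k : (\int[P]_w (drift k w)%:E = n%:R%:E *
  (\int[P]_w (dev2 Rm (x k w))%:E + \int[P]_w (\sum_c mean_grad f (x k w) c 0 ^+ 2)%:E))%E.
Proof.
have [mx mv mxc] := run_meas k.
have m1 : measurable_fun setT (fun w => (dev2 Rm (x k w))%:E).
  by apply/measurable_EFinP; exact: measurable_dev2.
have m2 : measurable_fun setT (fun w => (\sum_c mean_grad f (x k w) c 0 ^+ 2)%:E).
  apply/measurable_EFinP; apply: measurable_sum => c; apply: measurable_funX.
  exact: (measurable_mean_grad Lf_gt0 f_smooth c mx).
have d0 w : (0 <= (dev2 Rm (x k w))%:E)%E.
  by rewrite lee_fin; apply: sumr_ge0 => c _; apply: sumr_ge0 => j _; exact: sqr_ge0.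
have g0 w : (0 <= (\sum_c mean_grad f (x k w) c 0 ^+ 2)%:E)%E.
  by rewrite lee_fin; apply: sumr_ge0 => c _; exact: sqr_ge0.
rewrite -ge0_integralD// -ge0_integralZl//; last 2 first.
- exact: emeasurable_funD.
- by move=> w _; rewrite adde_ge0.
by apply: eq_integral => w _; rewrite /drift -mulrDr EFinM EFinD.
Qed.

Let mean2_nm k : nonneg_measurable (fun w => n%:R * mean2 (v k w)).
Proof.
have [mx mv mxc] := run_meas k; split.
  by apply: measurable_funM => //; exact: measurable_mean2.
by move=> w; apply: mulr_ge0 => //; apply: sumr_ge0 => c _; exact: sqr_ge0.
Qed.

(** The new residual contains the x-noise of time k + 1, whence [N k.+1]. *)
Let noise_coef k : R := 3 / 2 * eta^-1 * N k + 2 / 5 * ((1 + zt) / lmin * eta^-1) * N k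
  + 1 / 50 * eta^-1 * N k.+1.

Lemma potential_nm k : nonneg_measurable (potential k).
Proof.
have := nonneg_measurable_addZ ler01 (energy_nm k) (norm2_nm (Y_meas k)).
by rewrite /potential; congr nonneg_measurable; apply/funext => w; rewrite mul1r.
Qed.

(* Only sums of integrals of nonnegative functions occur, so that nothing has to be
   assumed or proved about finiteness of the moments of the iterates. *)
Lemma expected_descent k :
  (\int[P]_w (potential k.+1 w)%:E + (eta / 4)%:E * \int[P]_w (drift k w)%:E <=
   \int[P]_w (potential k w)%:E + (noise_coef k)%:E + (2 * (eta * om ^+ 2))%:E * MV k)%E.
Proof.
have e0 := tuned_eta tuning; have z1 := tuned_zt tuning; have o1 := tuned_om tuning.
have /andP[l1 _] := tuned_lmin tuning.
have ei0 : 0 <= eta^-1 by rewrite invr_ge0 ltW.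
have c0 : 0 <= eta / 4 by rewrite divr_ge0 ?(ltW e0).
have c1 : 0 <= 3 / 2 * eta^-1 by rewrite mulr_ge0.
have c2 : 0 <= 2 / 5 * ((1 + zt) / lmin * eta^-1).
  by rewrite !mulr_ge0// ?invr_ge0//; lra.
have c3 : 0 <= 1 / 50 * eta^-1 by rewrite mulr_ge0.
have c4 : 0 <= 2 * (eta * om ^+ 2).
  by apply: mulr_ge0 => //; apply: mulr_ge0 (ltW e0) (sqr_ge0 _).
have wY := weight_Y_ge0 tuning alpha_r; have wD := weight_D_ge0 tuning alpha_gt0 r_gt0.
have D_meas : measurable_agents (fun w i => r^-1 *: Cv k w i - Y k w i).
  have [mx mv mxc] := run_meas k.
  apply: measurable_agentsB (Y_meas k); apply: measurable_agentsZ.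
  exact: (measurable_agents_compressed C_meas mx mxc (xi_meas k) (U_meas k)).
pose h1 w := energy W lam Rm om zt b f (x k w) (v k w) (xc k w)
  + weight_Y W eta om zt alpha r phi * norm2 (Y k w).
have m1 : nonneg_measurable h1 by exact: nonneg_measurable_addZ (energy_nm k) (norm2_nm (Y_meas k)).
pose h2 w := h1 w + weight_D W eta om zt alpha r phi * norm2 (fun i => r^-1 *: Cv k w i - Y k w i).
have m2 : nonneg_measurable h2 by exact: nonneg_measurable_addZ (norm2_nm D_meas).
pose h3 w := h2 w + 3 / 2 * eta^-1 * norm2 (xi k w).
have m3 : nonneg_measurable h3 by exact: nonneg_measurable_addZ (norm2_nm (xi_meas k)).
pose h4 w := h3 w + 2 / 5 * ((1 + zt) / lmin * eta^-1) * norm2 (ze k w).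
have m4 : nonneg_measurable h4 by exact: nonneg_measurable_addZ (norm2_nm (ze_meas k)).
pose h5 w := h4 w + 1 / 50 * eta^-1 * norm2 (xi k.+1 w).
have m5 : nonneg_measurable h5 by exact: nonneg_measurable_addZ (norm2_nm (xi_meas k.+1)).
rewrite -integral_addZ//; last exact: potential_nm.
apply: (@le_trans _ _ (\int[P]_w (h5 w + 2 * (eta * om ^+ 2) * (n%:R * mean2 (v k w)))%:E)%E).
  apply: ge0_le_integral_nonmeasurable => w.
    have [_ p0] := potential_nm k.+1; have [_ d0] := drift_nm k.
    by rewrite lee_fin addr_ge0// mulr_ge0.
  rewrite lee_fin /h5 /h4 /h3 /h2 /h1 /potential /Y x_S v_S xc_S.
  exact: (one_step_compressed n_gt0 W_adj W_stoch L_eigen tuning alpha_gt0 b_alpha r_gt0 alpha_r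
    f_smooth).
rewrite integral_addZ//; apply: leeD; last by rewrite lee_wpmul2l.
rewrite /noise_coef !EFinD !addeA.
rewrite integral_addZ//; last exact: norm2_nm.
apply: leeD; last by rewrite [leRHS]EFinM lee_wpmul2l.
rewrite integral_addZ//; last exact: norm2_nm.
apply: leeD; last by rewrite [leRHS]EFinM lee_wpmul2l.
rewrite integral_addZ//; last exact: norm2_nm.
apply: leeD; last by rewrite [leRHS]EFinM lee_wpmul2l.
rewrite integral_addZ//; last exact: norm2_nm.
rewrite integral_addZ//; last exact: norm2_nm.
have -> : (\int[P]_w (potential k w)%:E = \int[P]_w (energy W lam Rm om zt b f (x k w) (v k w)
  (xc k w))%:E
    + 1%:E * \int[P]_w (norm2 (Y k w))%:E)%E.
  rewrite -integral_addZ//; last exact: norm2_nm.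
  by apply: eq_integral => w _; rewrite mul1r.
rewrite -addeA; apply: leeD => //.
set IY := (\int[P]_w (norm2 (Y k w))%:E)%E.
have IY0 : (0 <= IY)%E by apply: integral_ge0 => w _; rewrite lee_fin norm2_ge0.
have phi0 : 0 <= 1 - phi by rewrite subr_ge0.
have errD : (\int[P]_w (norm2 (fun i => r^-1 *: Cv k w i - Y k w i))%:E <= (1 - phi)%:E * IY)%E.
  rewrite /IY -ge0_integralZl//; last 2 first.
  - by apply/measurable_EFinP; case: (norm2_nm (Y_meas k)).
  - by move=> w _; rewrite lee_fin norm2_ge0.
  exact: (compression_error_bound phi_le1 C_meas C_bound U_law indep Lf_gt0 f_smooth
    x_0 v_0 xc_0 x_S v_S xc_S k).
apply: (@le_trans _ _ ((weight_Y W eta om zt alpha r phi)%:E * IY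
    + (weight_D W eta om zt alpha r phi)%:E * ((1 - phi)%:E * IY))%E).
  by apply: leeD => //; rewrite lee_wpmul2l.
rewrite muleA -EFinM -ge0_muleDl ?lee_fin ?mulr_ge0// lee_wpmul2r// lee_fin.
exact: (weights_le1 tuning quadratic).
Qed.

(** All terms are kept on additive sides, since differences of possibly infinite expectations would
    not telescope. *)
Lemma expected_telescope K :
  (\int[P]_w (potential K w)%:E + (eta / 4)%:E * \sum_(0 <= k < K) \int[P]_w (drift k w)%:E <=
   \int[P]_w (potential 0%N w)%:E + \sum_(0 <= k < K) (noise_coef k)%:E
     + (2 * (eta * om ^+ 2))%:E * \sum_(0 <= k < K) MV k)%E.
Proof.
have e0 := tuned_eta tuning.
have c0 : 0 <= eta / 4 by rewrite divr_ge0 ?(ltW e0).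
have c4 : 0 <= 2 * (eta * om ^+ 2).
  by apply: mulr_ge0 => //; apply: mulr_ge0 (ltW e0) (sqr_ge0 _).
have dI k : (0 <= \int[P]_w (drift k w)%:E)%E.
  by apply: integral_ge0 => w _; rewrite lee_fin; case: (drift_nm k).
have MV0 k : (0 <= MV k)%E.
  apply: le_trans (v_bound k); apply: integral_ge0 => w _; rewrite lee_fin.
  by case: (mean2_nm k).
elim: K => [|K IH]; first by rewrite !big_geq// !mule0 !adde0.
rewrite !big_nat_recr//=.
have sd : (0 <= \sum_(0 <= k < K) \int[P]_w (drift k w)%:E)%E by exact: sume_ge0.
have sm : (0 <= \sum_(0 <= k < K) MV k)%E by exact: sume_ge0.
rewrite (ge0_muleDr _ sd (dI K)) (ge0_muleDr _ sm (MV0 K)).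
have := expected_descent K; move: IH.
move: (\int[P]_w (potential K.+1 w)%:E)%E (\int[P]_w (potential K w)%:E)%E => p' p1.
move: (\int[P]_w (potential 0%N w)%:E)%E ((noise_coef K)%:E)%E => p0 nk.
move: ((eta / 4)%:E * \int[P]_w (drift K w)%:E)%E ((eta / 4)%:E * \sum_(0 <= k < K) _)%E => D S.
move: (\sum_(0 <= k < K) (noise_coef k)%:E)%E => Ns.
move: (_%:E * \sum_(0 <= k < K) MV k)%E (_%:E * MV K)%E => Ms mk IH1 step.
apply: (@le_trans _ _ (p1 + nk + mk + S)%E).
  by rewrite (addeC S) addeA; apply: leeD.
have -> : (p1 + nk + mk + S = (p1 + S) + (nk + mk))%E by rewrite -(addeA p1) addeAC.
have -> : (p0 + (Ns + nk) + (Ms + mk) = p0 + Ns + Ms + (nk + mk))%E.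
  by rewrite -!addeA; congr (_ + (_ + _))%E; exact: addeCA.
exact: leeD.
Qed.

End expected_descent.

(** The drift sum is multiplied by 4 / (eta n), at most [k3 / n], and divided by T. The error must
    therefore accumulate T times, not T + 1 times, although the sum has T + 1 terms. *)
Lemma conclude_average {R : realType} (n T : nat) (eta k3 k12 : R) (S B M VI : \bar R) :
  (0 < n)%N -> (0 < T)%N -> 0 < eta -> 4 / eta <= k3 -> 0 <= k12 ->
  (0 <= S)%E -> (0 <= B)%E -> (0 <= M)%E -> (0 <= VI)%E ->
  ((eta / 4)%:E * (n%:R%:E * S) <= B)%E ->
  (B <= n%:R%:E * M + (k12 * T%:R)%:E * VI)%E ->
  ((T%:R^-1)%:E * S <= k3%:E * M * (T%:R^-1)%:E + (k3 * k12 / n%:R)%:E * VI)%E.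
Proof.
move=> n0 T0 e0 k3_ge k12_ge S0 B0 M0 V0 SB BM.
have nR : 0 < n%:R :> R by rewrite ltr0n.
have TR : 0 < T%:R :> R by rewrite ltr0n.
have k30 : 0 <= k3 by apply: le_trans k3_ge; rewrite divr_ge0 ?(ltW e0).
have ti : 0 <= T%:R^-1 :> R by rewrite invr_ge0.
have S_le : (S <= (k3 / n%:R)%:E * B)%E.
  apply: (@le_trans _ _ ((4 / eta / n%:R)%:E * ((eta / 4)%:E * (n%:R%:E * S)))%E).
    rewrite !muleA -!EFinM; have -> : 4 / eta / n%:R * (eta / 4) * n%:R = 1.
      by field; rewrite !gt_eqF.
    by rewrite mul1e.
  apply: (@le_trans _ _ ((4 / eta / n%:R)%:E * B)%E).
    by rewrite lee_wpmul2l// lee_fin !mulr_ge0 ?invr_ge0 ?(ltW e0).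
  by rewrite lee_wpmul2r// lee_fin ler_wpM2r ?invr_ge0 ?(ltW nR).
have kn : (0 <= (k3 / n%:R)%:E)%E by rewrite lee_fin mulr_ge0 ?invr_ge0.
have ti' : (0 <= (T%:R^-1 : R)%:E)%E by rewrite lee_fin.
apply: le_trans (lee_wpmul2l ti' S_le) _.
apply: le_trans (lee_wpmul2l ti' (lee_wpmul2l kn BM)) _.
have nM : (0 <= n%:R%:E * M)%E by rewrite mule_ge0 ?lee_fin.
have kV : (0 <= (k12 * T%:R)%:E * VI)%E by rewrite mule_ge0 ?lee_fin ?mulr_ge0.
rewrite muleA -EFinM (ge0_muleDr _ nM kV).
rewrite !muleA -!EFinM (muleAC _ M) -EFinM.
by rewrite le_eqVlt; apply/orP; left; apply/eqP; congr (_%:E * _ + _%:E * _)%E; field;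
  rewrite !gt_eqF.
Qed.

Theorem theorem4 (R : realType) (n d : nat) (n_gt0 : (0 < n)%N)
  (d_gt0 : (0 < d)%N) (p : setting R n)
  (* objective *)
  (f : 'I_n -> 'cV[R]_d -> R)
  (Lf_gt0 : 0 < p_Lf p)
  (f_smooth : forall i, smooth (p_Lf p) (f i))
  (f_bounded : (-oo < min_value (average f))%E)
  (* network *)
  (e : rel 'I_n) (e_sym : symmetric e)
  (W_adj : weighted_adjacency e (p_W p))
  (G_connected : graph_connected e)
  (W_stoch : doubly_stochastic (p_W p))
  (lam : nat -> R) (Rm : 'M[R]_(n, n.-1))
  (L_eigen : nonzero_eigenbasis (laplacian (p_W p)) lam Rm)
  (* compressor *)
  (dS : measure_display) (S : measurableType dS) (mu : probability S R)
  (C : S -> 'cV[R]_d -> 'cV[R]_d)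
  (C_meas : measurable_compressor C)
  (phi_gt0 : 0 < p_phi p) (phi_le1 : p_phi p <= 1) (r_gt0 : 0 < p_r p)
  (C_bound : compressor_bound mu C (p_phi p) (p_r p))
  (* noise and compressor randomness *)
  (dO : measure_display) (Omega : measurableType dO) (P : probability Omega R)
  (s_x s_v q : 'I_n -> R)
  (s_x_gt0 : forall i, 0 < s_x i) (s_v_gt0 : forall i, 0 < s_v i)
  (q_gt0 : forall i, 0 < q i) (q_lt1 : forall i, q i < 1)
  (xi_x xi_v : 'I_n -> nat -> 'I_d -> {RV P >-> R})
  (U : 'I_n -> nat -> {RV P >-> S})
  (xi_x_law : forall i k j, laplace_law (xi_x i k j) (s_x i * q i ^+ k))
  (xi_v_law : forall i k j, laplace_law (xi_v i k j) (s_v i * q i ^+ k))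
  (U_law : forall i k (B : set S), measurable B -> P (U i k @^-1` B) = mu B)
  (indep : mutually_independent P (source_sigma_algebra xi_x xi_v U))
  (* algorithm *)
  (x0 : 'I_n -> 'cV[R]_d)
  (x v xc xhat : nat -> Omega -> 'I_n -> 'cV[R]_d)
  (run : PPDC p f C xi_x xi_v U x0 x v xc xhat)
  (* parameters *)
  (zeta1 : R)
  (zeta1_ge :
     Num.max ((13 + zeta4 p zeta1) / (2 * lmin p)) 1 <= zeta1)
  (gamma_gt0 : 0 < p_gamma p)
  (gamma_eq : p_gamma p = zeta1 * p_omega p)
  (omega_gt0 : 0 < p_omega p)
  (omega_gt : zeta2 p zeta1 < p_omega p)
  (alpha_gt0 : 0 < p_alpha p) (alpha_lt : p_alpha p < 1 / p_r p)
  (eta_gt0 : 0 < p_eta p) (eta_lt : p_eta p < zeta3 p)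
  (T : nat) (T_ge1 : (1 <= T)%N) :
  ((T%:R^-1)%:E *
     \sum_(0 <= k < T.+1)
        ('E_P[(fun w => (l2norm (stack (x k w) - mean_stack (x k w)) ^+ 2)%R)]
         + 'E_P[(fun w => (l2norm (grad (average f) (mean (x k w))) ^+ 2)%R)])
   <= (kappa_bar3 p)%:E *
        M2 d p
          'E_P[(fun w => lyapunov p f lam Rm (x 0%N w) (v 0%N w) (xc 0%N w)
                           (fun i => noise_vec (xi_x i 0%N) w))]
          q s_x s_v *
        (T%:R^-1)%:E
      + (kappa_check1 p)%:E *
        'E_P[(fun w =>
           (l2norm (limn (fun N => \sum_(0 <= t < N)
              mean_stack (fun i => noise_vec (xi_v i t) w))) ^+ 2)%R)])%E.
Proof.
have n1 := network_size_gt1 n_gt0 W_adj W_stoch.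
have [lmin0 lminj] := min_pos_eigenvalue_bounds n_gt0 W_adj W_stoch L_eigen.
have lmaxj := spectral_radius_bound n_gt0 W_adj W_stoch L_eigen.
have j0 : 'I_n.-1 by exists 0%N; rewrite -subn1 subn_gt0.
have lmax_ge : lmin p <= lmax p by exact: le_trans (lminj j0) (lmaxj j0).
have lmin_le := min_pos_eigenvalue_le n_gt0 W_adj W_stoch L_eigen.
have tuning := parameters_tuned n1 lmin0 lmin_le lmax_ge Lf_gt0 phi_gt0 phi_le1 r_gt0 zeta1_ge
  gamma_gt0 gamma_eq omega_gt0 omega_gt alpha_gt0 alpha_lt eta_gt0 eta_lt.
have quad := step_size_quadratic lmin0 lmax_ge phi_gt0 phi_le1 r_gt0 gamma_gt0 omega_gt0
  alpha_gt0 eta_gt0 eta_lt.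
have alpha_r : p_alpha p * p_r p <= 1 by rewrite -ler_pdivlMr// ltW.
have phi2_gt0 : 0 < phi2 p by rewrite /phi2 !mulr_gt0.
have b_alpha : p_eta p * p_omega p / p_alpha p * p_alpha p = p_eta p * p_omega p.
  by rewrite divfK// gt_eqF.
pose xi k w : 'I_n -> 'cV[R]_d := fun i => noise_vec (xi_x i k) w.
pose ze k w : 'I_n -> 'cV[R]_d := fun i => noise_vec (xi_v i k) w.
pose Cv := compressed C xi (fun k i w => U i k w) x xc.
have x_0 w : x 0%N w = x0 by apply/funext => i; case: (run w) => + _ => /(_ i)[].
have v_0 w : v 0%N w = fun=> 0 by apply/funext => i; case: (run w) => + _ => /(_ i)[].
have xc_0 w : xc 0%N w = fun=> 0 by apply/funext => i; case: (run w) => + _ => /(_ i)[].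
have xhatE k w j : xhat k w j = xc k w j + Cv k w j.
  by case: (run w) => _ /(_ k j)[].
have x_S k w : x k.+1 w = next_x (p_W p) (p_eta p) (p_omega p) zeta1 f (x k w) (v k w) (xc k w)
    (xi k w) (Cv k w).
  apply/funext => i; case: (run w) => _ /(_ k i)[_ -> _ _]; rewrite gamma_eq /next_x /lap.
  by under eq_bigr do rewrite xhatE.
have v_S k w : v k.+1 w = next_v (p_W p) (p_eta p) (p_omega p) (v k w) (xc k w) (ze k w) (Cv k w).
  apply/funext => i; case: (run w) => _ /(_ k i)[_ _ -> _]; rewrite /next_v /lap.
  by under eq_bigr do rewrite xhatE.
have xc_S k w : xc k.+1 w = next_xc (p_alpha p) (xc k w) (Cv k w).
  apply/funext => i; case: (run w) => _ /(_ k i)[_ _ _ ->]; rewrite xhatE /next_xc.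
  by rewrite scalerDr addrA -scalerDl subrK scale1r.
pose VI := (\int[P]_w (l2norm (limn (fun N => \sum_(0 <= t < N)
              mean_stack (fun i => noise_vec (xi_v i t) w))) ^+ 2)%:E)%E.
have VI0 : (0 <= VI)%E by apply: integral_ge0 => w _; rewrite lee_fin sqr_ge0.
(* As v_0 = 0, time 0 contributes nothing; the T + 1 terms thus cost only T times [VI], which
   matches the division by T. *)
pose MV k : \bar R := if k is 0%N then 0%E else VI.
have mean_v k w : mean (v k w) = mean (fun i => \sum_(0 <= t < k) ze t w i).
  elim: k => [|k IH].
    by rewrite v_0; congr mean; apply/funext => i; rewrite big_geq.
  rewrite v_S /next_v; transitivity (mean (v k w) + mean (ze k w)).
    rewrite -meanD -[RHS]addr0 -(scaler0 _ (p_eta p * p_omega p)).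
    rewrite -(mean_laplacian W_adj W_stoch (fun k0 => xc k w k0 + Cv k w k0)).
    by rewrite -meanZ -meanD.
  by rewrite IH -meanD; congr mean; apply/funext => i; rewrite big_nat_recr.
have v_bound k : (\int[P]_w (n%:R * mean2 (v k w))%:E <= MV k)%E.
  case: k => [|k].
    rewrite integral0_eq// => w _; rewrite /mean2 mean_v; congr (_%:E).
    rewrite big1 ?mulr0// => c _; rewrite mean_component /avg big1 ?mulr0 ?expr0n// => i _.
    by rewrite /component big_geq// mxE.
  under eq_integral do rewrite /mean2 mean_v.
  exact: (noise_sum_limit s_x_gt0 s_v_gt0 q_gt0 q_lt1 xi_x_law xi_v_law indep k.+1 n_gt0).
pose nu k := 2 * d%:R * q_bar q ^+ (2 * k) * s_bar s_x s_v ^+ 2.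
have nu0 k : 0 <= nu k.
  rewrite mulr_ge0 ?sqr_ge0// mulr_ge0// exprn_ge0//.
  by have /andP[/ltW] := q_bar_bounds q_gt0 q_lt1 n_gt0.
have quad' : 6 * (contraction_weight (phi2 p) * (p_eta p * (zeta1 * p_omega p) * lmax p) ^+ 2)
    * r0 p <= kappa7 p by rewrite -gamma_eq.
have tel := @expected_telescope R n d dO dS Omega S e (p_W p) lam Rm n_gt0 W_adj W_stoch L_eigen
  (p_eta p) (p_omega p) zeta1 _ (p_alpha p) (p_r p) (p_phi p) (p_Lf p) tuning alpha_gt0 b_alpha
  r_gt0 alpha_r phi_le1 quad' f f_smooth f_bounded P mu C C_meas C_bound xi_x xi_v U U_law indep
  x v xc x0 x_0 v_0 xc_0 x_S v_S xc_S (fun k => n%:R * nu k) MV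
  (noise_x_bound s_v s_x_gt0 q_gt0 xi_x_law) (noise_v_bound s_x s_v_gt0 q_gt0 xi_v_law)
  v_bound T.+1.
have pot0 : (\int[P]_w (potential (p_W p) lam Rm (p_omega p) zeta1
    (p_eta p * p_omega p / p_alpha p) f xi_x x v xc 0 w)%:E =
    'E_P[(fun w => lyapunov p f lam Rm (x 0%N w) (v 0%N w) (xc 0%N w)
                           (fun i => noise_vec (xi_x i 0%N) w))])%E.
  rewrite unlock; apply: eq_integral => w _; congr (_%:E).
  rewrite (lyapunovE n_gt0 W_adj W_stoch L_eigen) gamma_eq mulfK ?gt_eqF// /potential /energy
    addrAC; congr (_ + _ + _).
  have lap0 i : lap (p_W p) (xc 0%N w) i = 0.
    by rewrite /lap xc_0 big1// => k _; rewrite scaler0.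
  congr lyapunov_modes; apply/funext => i; rewrite /shifted_x /shifted_v lap0 scaler0.
    by rewrite addr0.
  by rewrite subr0.
have expE (g : Omega -> R) : 'E_P[g]%E = (\int[P]_w (g w)%:E)%E by rewrite unlock.
pose S0 := (\sum_(0 <= k < T.+1)
        ('E_P[(fun w => (l2norm (stack (x k w) - mean_stack (x k w)) ^+ 2)%R)]
         + 'E_P[(fun w => (l2norm (grad (average f) (mean (x k w))) ^+ 2)%R)]))%E.
have term0 k : (0 <= 'E_P[(fun w => (l2norm (stack (x k w) - mean_stack (x k w)) ^+ 2)%R)]
         + 'E_P[(fun w => (l2norm (grad (average f) (mean (x k w))) ^+ 2)%R)])%E.
  by rewrite adde_ge0// expectation_ge0// => w; exact: sqr_ge0.
have drifts : (\sum_(0 <= k < T.+1) \int[P]_w (drift Rm f x k w)%:E = n%:R%:E * S0)%E.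
  rewrite /S0 ge0_sume_distrr//; apply: eq_bigr => k _.
  rewrite (expected_drift Rm tuning f_smooth C_meas x_0 v_0 xc_0 x_S v_S xc_S) !expE.
  congr (_ * (_ + _))%E; apply: eq_integral => w _; congr (_%:E).
    by rewrite (centered_norm n_gt0 W_adj W_stoch L_eigen).
  by rewrite l2norm_sqr grad_average// => i; case: (f_smooth i).
have EV0 : (0 <= 'E_P[(fun w => lyapunov p f lam Rm (x 0%N w) (v 0%N w) (xc 0%N w)
                           (fun i => noise_vec (xi_x i 0%N) w))])%E.
  rewrite -pot0; apply: integral_ge0 => w _; rewrite lee_fin addr_ge0 ?norm2_ge0//.
  exact: (energy_ge0 n_gt0 W_adj W_stoch L_eigen tuning f_bounded).
have NU0 : (0 <= \sum_(0 <= k <oo) (nu k)%:E)%E by apply: nneseries_ge0 => k _ _; rewrite lee_fin.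
have k10 := kappa10_ge d lmin0 (le_trans (ltW lmin0) lmax_ge) phi2_gt0 Lf_gt0 gamma_gt0 omega_gt0
  eta_gt0.
have k11 := kappa11_ge lmin0 gamma_gt0 omega_gt0 eta_gt0 gamma_eq.
have k12 := kappa12_ge lmin0 Lf_gt0 gamma_gt0 omega_gt0 eta_gt0.
have ei0 : 0 <= (p_eta p)^-1 by rewrite invr_ge0 ltW.
have z0 : 0 <= (1 + zeta1) / lmin p / p_eta p.
  have z1 := tuned_zt tuning; rewrite !mulr_ge0 ?invr_ge0 ?(ltW lmin0) ?(ltW eta_gt0)//; lra.
have k1011 : 0 <= kappa10 d p + kappa11 p by move: k10 k11 ei0 z0; lra.
have k12_ge0 : 0 <= kappa12 p.
  by apply: le_trans k12; rewrite mulr_ge0// mulr_ge0 ?sqr_ge0// ltW.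
set EV := 'E_P[_]%E in pot0 EV0 *.
have M0 : (0 <= M2 d p EV q s_x s_v)%E.
  rewrite /M2 adde_ge0// mule_ge0// ?lee_fin ?invr_ge0//.
rewrite -/S0; set Elim := 'E_P[_]%E; have -> : Elim = VI by rewrite /Elim unlock.
pose B := (EV + \sum_(0 <= k < T.+1) (3 / 2 * (p_eta p)^-1 * (n%:R * nu k)
  + 2 / 5 * ((1 + zeta1) / lmin p * (p_eta p)^-1) * (n%:R * nu k)
  + 1 / 50 * (p_eta p)^-1 * (n%:R * nu k.+1))%:E
  + (2 * (p_eta p * p_omega p ^+ 2))%:E * \sum_(0 <= k < T.+1) MV k)%E.
have nR : 0 < n%:R :> R by rewrite ltr0n.
have noise_le : (\sum_(0 <= k < T.+1) (3 / 2 * (p_eta p)^-1 * (n%:R * nu k)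
  + 2 / 5 * ((1 + zeta1) / lmin p * (p_eta p)^-1) * (n%:R * nu k)
  + 1 / 50 * (p_eta p)^-1 * (n%:R * nu k.+1))%:E <=
  n%:R%:E * ((kappa10 d p + kappa11 p)%:E * \sum_(0 <= k <oo) (nu k)%:E))%E.
  (* Step T involves the noise of time T + 1, hence T + 2 terms of the series. The coefficients 3/2
     + 1/50 of eta^-1 and 2/5 of (1 + zeta1) / (lmin eta) fit into the 2 and 1/2 supplied by
     [kappa10] and [kappa11]. *)
  apply: (@le_trans _ _ (n%:R%:E * ((kappa10 d p + kappa11 p)%:E
    * \sum_(0 <= k < T.+2) (nu k)%:E))%E); last first.
    rewrite lee_wpmul2l ?lee_fin ?(ltW nR)// lee_wpmul2l ?lee_fin//.
    by apply: nneseries_lim_ge => k _ _; rewrite lee_fin.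
  rewrite !sumEFin -!EFinM lee_fin !big_split /= -!mulr_sumr.
  have s1 : \sum_(0 <= k < T.+1) nu k <= \sum_(0 <= k < T.+2) nu k.
    by rewrite [leRHS]big_nat_recr//= lerDl.
  have s2 : \sum_(0 <= k < T.+1) nu k.+1 <= \sum_(0 <= k < T.+2) nu k.
    by rewrite [leRHS]big_nat_recl//= lerDr.
  have s0 : 0 <= \sum_(0 <= k < T.+2) nu k by exact: sumr_ge0.
  set Sx := \sum_(0 <= k < T.+1) nu k in s1 *; set Sy := \sum_(0 <= k < T.+1) nu k.+1 in s2 *.
  set SS := \sum_(0 <= k < T.+2) nu k in s0 s1 s2 *.
  have i1 : 3 / 2 * (p_eta p)^-1 * Sx <= 3 / 2 * (p_eta p)^-1 * SS by rewrite ler_wpM2l// mulr_ge0.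
  have i2 : 2 / 5 * ((1 + zeta1) / lmin p * (p_eta p)^-1) * Sx <=
      2 / 5 * ((1 + zeta1) / lmin p * (p_eta p)^-1) * SS by rewrite ler_wpM2l// mulr_ge0.
  have i3 : 1 / 50 * (p_eta p)^-1 * Sy <= 1 / 50 * (p_eta p)^-1 * SS by rewrite ler_wpM2l//
    mulr_ge0.
  have i4 : (3 / 2 * (p_eta p)^-1 + 2 / 5 * ((1 + zeta1) / lmin p * (p_eta p)^-1)
      + 1 / 50 * (p_eta p)^-1) * SS <= (kappa10 d p + kappa11 p) * SS.
    by rewrite ler_wpM2r//; move: k10 k11 ei0 z0; lra.
  have := ler_wpM2l (ltW nR) i4; have := ler_wpM2l (ltW nR) i1.
  have := ler_wpM2l (ltW nR) i2; have := ler_wpM2l (ltW nR) i3.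
  by lra.
have sumMV : (\sum_(0 <= k < T.+1) MV k = T%:R%:E * VI)%E.
  rewrite big_nat_recl//= add0e.
  elim: {T_ge1 tel S0 term0 drifts B noise_le} T => [|m IH]; first by rewrite big_geq// mul0e.
  by rewrite big_nat_recr//= IH -natr1 EFinD ge0_muleDl ?lee_fin// mul1e.
have S00 : (0 <= S0)%E by apply: sume_ge0 => k _; exact: term0.
have SB : ((p_eta p / 4)%:E * (n%:R%:E * S0) <= B)%E.
  rewrite -drifts /B -pot0; apply: le_trans tel; rewrite leeDr//.
  apply: integral_ge0 => w _; rewrite lee_fin addr_ge0 ?norm2_ge0//.
  exact: (energy_ge0 n_gt0 W_adj W_stoch L_eigen tuning f_bounded).
have B0 : (0 <= B)%E.
  by apply: le_trans SB; rewrite !mule_ge0// lee_fin ?(ltW nR)// divr_ge0 ?(ltW eta_gt0).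
apply: (@conclude_average R n T (p_eta p) (kappa_bar3 p) (kappa12 p) S0 B) => //.
  exact: kappa_bar3_ge.
have EVn : (0 <= (n%:R^-1)%:E * EV)%E by rewrite mule_ge0// lee_fin invr_ge0 ltW.
have NUk : (0 <= (kappa10 d p + kappa11 p)%:E * \sum_(0 <= k <oo) (nu k)%:E)%E.
  by rewrite mule_ge0.
rewrite /B sumMV /M2 (ge0_muleDr _ EVn NUk).
have -> : (n%:R%:E * ((n%:R^-1)%:E * EV) = EV)%E.
  by rewrite muleA -EFinM mulfV ?gt_eqF// mul1e.
apply: leeD; first exact: leeD.
by rewrite muleA -EFinM lee_wpmul2r// lee_fin ler_wpM2r.
Qed.
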